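(* Let $(M,c)$ be a four-dimensional manifold endowed with a pseudoconformal structure $c=CO(2,2)$ of signature $(2,2)$, and let $V\subset(M,c)$ be a lightlike hypersurface whose isotropic geodesics can be prolonged indefinitely. Let $$D=4\,(3h_{22}b_0+h_{33}a_0)(h_{22}b_0+3h_{33}a_0).$$ If $D$ does not vanish on $V$, then it is possible to construct on $V$ a third-order frame bundle intrinsically connected with the geometry of $V$: namely, among the second-order frames at a point $x=A_0\in V$, the points $A_2$ and $A_3$ are uniquely determined, in the $\alpha$-plane $A_0\wedge A_1\wedge A_2$ and the $\beta$-plane $A_0\wedge A_1\wedge A_3$ respectively, by the condition $h_{222}=h_{223}=h_{233}=h_{333}=0$. In this frame bundle, $h_{abc}=0$.
   Context: Everything is smooth. Conformal structure and frames. $c$ is a conformal class of pseudo-Riemannian metrics of signature $(2,2)$; $C_x\subset T_x(M)$ is its isotropic (null) cone. $T_x(M)$ is compactified to a pseudoconformal space, realized as a hyperquadric in a projective space $P^5_x$ with scalar product $(\cdot,\cdot)$, in which $x$ itself is a point. Isotropic frames $\{A_0,\dots,A_5\}$ of $P^5_x$ satisfy $A_0=x$, $(A_0,A_5)=-1$, $(A_1,A_4)=-1$, $(A_2,A_3)=1$, all other scalar products being zero; $A_1,\dots,A_4$ represent a basis of $T_x(M)$. The normal conformal (Cartan) connection is written $dA_0=\omega_0^0A_0+\omega^iA_i$, $dA_i=\omega_i^0A_0+\omega_i^jA_j+\omega_i^5A_5$, $dA_5=\omega_5^iA_i-\omega_0^0A_5$ ($i,j=1,\dots,4$), with $\omega_i^5=g_{ij}\omega^j$,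 $\omega_5^i=g^{ij}\omega_j^0$, $g_{ij}=(A_i,A_j)$, $g_{ik}\omega^k_j+g_{kj}\omega^k_i=0$; $c$ is represented by $g=2(\omega^2\omega^3-\omega^1\omega^4)$. The structure equations are $d\omega^i=\omega_0^0\wedge\omega^i+\omega^j\wedge\omega^i_j$, $d\omega_0^0=\omega^i\wedge\omega_i^0$, $d\omega^i_j=\omega^0_j\wedge\omega^i+\omega_j^k\wedge\omega_k^i+\omega_j^5\wedge\omega_5^i+C^i_{jkl}\omega^k\wedge\omega^l$, $d\omega_i^0=\omega_i^0\wedge\omega_0^0+\omega_i^j\wedge\omega_j^0+C_{ijk}\omega^j\wedge\omega^k$, with $C^i_{jki}=0$; $C_{ijkl}=g_{im}C^m_{jkl}$ is the tensor of conformal curvature (skew in $i,j$ and in $k,l$, with the usual symmetries of a Weyl tensor). Notation: $a_0=C_{1212}$, $a_1=C_{1214}$, $b_0=C_{1313}$, $b_1=C_{1314}$ (components in the frame under consideration). The cone $C_x$: $\xi^2\xi^3-\xi^1\xi^4=0$ carries two families of plane generators: $\alpha$-generators $\xi^1+\lambda\xi^3=0,\ \xi^2+\lambda\xi^4=0$ and $\beta$-generators $\xi^1+\mu\xi^2=0,\ \xi^3+\mu\xi^4=0$ ($\lambda,\mu\in\mathbf{R}\cup\{\infty\}$). Lightlike hypersurfaces. A hypersurface $V\subset M$ ($\dim V=3$) is lightlike if $T_x(V)$ is tangent to $C_x$ for each $x\in V$. Then $T_x(V)$ contains one $\alpha$-generator and one $\beta$-generator, meeting in the isotropic line $l$ along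 which $T_x(V)$ is tangent to $C_x$. First-order frames of $V$: $A_0=x$, $A_1\in l=A_0A_1$, $A_0\wedge A_1\wedge A_2$ is the $\alpha$-plane, $A_0\wedge A_1\wedge A_3$ the $\beta$-plane (so $A_4$ lies on the isotropic line through $A_0$ such that $A_0\wedge A_1\wedge A_4$ is conjugate to the screen subspace $S_x=A_0\wedge A_2\wedge A_3$ with respect to $C_x$). In such frames $V$ satisfies $\omega^4=0$, and $\omega^1,\omega^2,\omega^3$ are independent on $V$. The isotropic geodesics of $V$ are the lines $\omega^2=\omega^3=0$ on $V$; prolonged indefinitely, each carries the geometry of a projective line $P^1$ and is identified with the line $A_0A_1$. On $V$: $\omega_1^3=\lambda_{22}\omega^2+\lambda_{23}\omega^3$, $\omega_1^2=\lambda_{23}\omega^2+\lambda_{33}\omega^3$. The point $H=A_1-\lambda_{23}A_0$ of $l$ does not depend on the choice of first-order frame. Second-order frames are first-order frames with $A_1=H$, i.e. with $\lambda_{23}=0$; for them put $h_{22}=\lambda_{22}$, $h_{33}=\lambda_{33}$, so $\omega_1^3=h_{22}\omega^2$, $\omega_1^2=h_{33}\omega^3$. At a fixed $x$ the points $A_2,A_3$ of second-order frames still move freely in the $\alpha$- and $\beta$-planes. Points are considered as points of the projective space, i.e. up to normalizing factors. The third-order quantities $h_{abc}$ are the functions on the bundle of second-order frames uniquely determined by the identities $dh_{22}+h_{22}(\omega_0^0-2\omega_2^2-\omega_1^1)+2a_0\omega^1=h_{222}\omega^2+h_{223}\omega^3$, $\omega_1^0=h_{22}h_{33}\omega^1-(h_{223}+2a_1)\omega^2-(h_{233}+2b_1)\omega^3$,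 $dh_{33}+h_{33}(\omega_0^0+2\omega_2^2-\omega_1^1)+2b_0\omega^1=h_{233}\omega^2+h_{333}\omega^3$, which hold on that bundle (they are obtained by exterior differentiation of $\omega_1^3=h_{22}\omega^2$, $\omega_1^2=h_{33}\omega^3$ and Cartan's lemma). *)

(* Defs.v *)
(* MathComp / MathComp-Analysis; [R : realType] is the field of real numbers. *)
From HB Require Import structures.
From mathcomp Require Import all_boot all_order all_algebra.
From mathcomp Require Import all_classical all_reals all_analysis.

Set Implicit Arguments.
Unset Strict Implicit.
Unset Printing Implicit Defensive.
Import Order.TTheory GRing.Theory Num.Theory.
Import numFieldNormedType.Exports.
Local Open Scope classical_set_scope.
Local Open Scope ring_scope.

(** * Smooth functions and 1-forms on open subsets of a normed space *)

Fixpoint Ck (R : realType) (W : normedModType R) (k : nat) (O : set W)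
    (f : W -> R^o) : Prop :=
  match k with
  | 0 => forall x, O x -> {for x, continuous f}
  | k'.+1 => (forall x, O x -> differentiable f x) /\
             (forall v : W, Ck k' O (fun x => 'D_v f x))
  end.

Definition smooth_on (R : realType) (W : normedModType R) (O : set W)
  (f : W -> R^o) : Prop := forall k, Ck k O f.

(* A scalar 1-form is a function of a point and of a vector. *)
Definition wedge (R : realType) (W : normedModType R) (al be : W -> R) (v w : W) : R :=
  al v * be w - al w * be v.

Definition dform (R : realType) (W : normedModType R) (th : W -> W -> R^o)
    (y v w : W) : R :=
  'D_v (fun z => th z w) y - 'D_w (fun z => th z v) y.

(** * Four-dimensional smooth manifolds *)

Record chart (R : realType) (M : Type) := Chart {
  cdom : set M;
  cmap : M -> 'rV[R]_4;
  cinv : 'rV[R]_4 -> M }.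

Definition cimg (R : realType) (M : Type) (u : chart R M) : set 'rV[R]_4 :=
  cmap u @` cdom u.

Definition is_chart (R : realType) (M : topologicalType) (u : chart R M) : Prop :=
  [/\ open (cdom u), open (cimg u),
      forall x, cdom u x -> cinv u (cmap u x) = x,
      forall x, cdom u x -> {for x, continuous (cmap u)} &
      forall y, cimg u y -> {for y, continuous (cinv u)}].

Definition overlap (R : realType) (M : Type) (u v : chart R M) : set 'rV[R]_4 :=
  cmap u @` (cdom u `&` cdom v).

Definition transition (R : realType) (M : Type) (u v : chart R M)
  (y : 'rV[R]_4) : 'rV[R]_4 := cmap v (cinv u y).

Definition compatible (R : realType) (M : Type) (u v : chart R M) : Prop :=
  (forall j : 'I_4, smooth_on (overlap u v) (fun y => transition u v y 0 j)) /\
  (forall j : 'I_4, smooth_on (overlap v u) (fun y => transition v u y 0 j)).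

(* [atlas] is the maximal atlas. *)
Record manifold4 (R : realType) := Manifold4 {
  carrier :> topologicalType;
  atlas : set (chart R carrier);
  manifold_hausdorff : hausdorff_space carrier;
  manifold_countable : @second_countable carrier;
  atlas_chart : forall u, atlas u -> is_chart u;
  atlas_cover : forall x : carrier, exists2 u, atlas u & cdom u x;
  atlas_compatible : forall u v, atlas u -> atlas v -> compatible u v;
  atlas_maximal : forall u, is_chart u ->
    (forall v, atlas v -> compatible u v) -> atlas u }.

(** * Conformal structures of signature (2,2) *)

Definition bilin (R : realType) (g : 'M[R]_4) (v w : 'rV[R]_4) : R :=
  (v *m g *m w^T) 0 0.

Definition signature22 (R : realType) (g : 'M[R]_4) : Prop :=
  exists2 P : 'M[R]_4, P \in unitmx &
    P *m g *m P^T = diag_mx (\row_(i < 4) if (i < 2)%N then 1 else -1).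

(* A covariant 2-tensor is given by its matrix in each chart of the atlas, as a
   function of the coordinates; values outside the chart are irrelevant. *)
Definition tensor2 (R : realType) (M : manifold4 R) : Type :=
  chart R M -> 'rV[R]_4 -> 'M[R]_4.

Definition pushvec (R : realType) (M : Type) (u v : chart R M)
    (y a : 'rV[R]_4) : 'rV[R]_4 :=
  \row_(j < 4) 'D_a (fun z => transition u v z 0 j : R^o) y.

Definition is_metric22 (R : realType) (M : manifold4 R) (g : tensor2 M) : Prop :=
  (forall u, atlas u ->
     (forall i j : 'I_4, smooth_on (cimg u) (fun y => g u y i j)) /\
     (forall y, cimg u y -> (g u y)^T = g u y /\ signature22 (g u y))) /\
  (forall u v, atlas u -> atlas v -> forall y, overlap u v y ->
     forall a b, bilin (g u y) a b =
       bilin (g v (transition u v y)) (pushvec u v y a) (pushvec u v y b)).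

Definition conformal_to (R : realType) (M : manifold4 R) (g g' : tensor2 M) : Prop :=
  exists2 s : M -> R, (forall x, 0 < s x) &
    forall u, atlas u -> forall y, cimg u y -> g' u y = s (cinv u y) *: g u y.

Definition conformal_structure22 (R : realType) (M : manifold4 R)
    (c : set (tensor2 M)) : Prop :=
  exists2 g, is_metric22 g & c = [set g' | is_metric22 g' /\ conformal_to g g'].

(** * Isotropic frames and the normal conformal connection *)

Definition i0 : 'I_6 := @Ordinal 6 0 isT.
Definition i1 : 'I_6 := @Ordinal 6 1 isT.
Definition i2 : 'I_6 := @Ordinal 6 2 isT.
Definition i3 : 'I_6 := @Ordinal 6 3 isT.
Definition i4 : 'I_6 := @Ordinal 6 4 isT.
Definition i5 : 'I_6 := @Ordinal 6 5 isT.

(* The indices 1, ..., 4 of the tangential vertices. *)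
Definition tg (i : 'I_6) : bool := (0 < i < 5)%N.

(* (A_0,A_5) = (A_1,A_4) = -1, (A_2,A_3) = 1, the other products are zero. *)
Definition gram (R : realType) : 'M[R]_6 :=
  \matrix_(a < 6, b < 6)
    if (a + b == 5)%N then (if (a == i2) || (a == i3) then 1 else -1) else 0.

(* Connection forms of a moving frame in a chart: [w y v a b] is the value
   omega_a^b(v) at y, so that dA_a = \sum_b omega_a^b A_b, and omega^i is
   omega_0^i. *)
Definition forms (R : realType) : Type := 'rV[R]_4 -> 'rV[R]_4 -> 'M[R]_6.

(* The tensor C^i_{jkl} is [C y i j k l]; only indices 1, ..., 4 matter. *)
Definition tensor4 (R : realType) : Type :=
  'rV[R]_4 -> 'I_6 -> 'I_6 -> 'I_6 -> 'I_6 -> R.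

Definition lower (R : realType) (C : tensor4 R) : tensor4 R :=
  fun y i j k l => \sum_(m | tg m) gram R i m * C y m j k l.

Definition weyl_symmetries (R : realType) (C : tensor4 R) (y : 'rV[R]_4) : Prop :=
  forall i j k l, tg i -> tg j -> tg k -> tg l ->
  [/\ lower C y j i k l = - lower C y i j k l,
      lower C y i j l k = - lower C y i j k l,
      lower C y i j k l + lower C y i k l j + lower C y i l j k = 0,
      lower C y k l i j = lower C y i j k l &
      \sum_(m | tg m) C y m j k m = 0].

Definition structure_equations (R : realType) (O : set 'rV[R]_4) (w : forms R)
    (C : tensor4 R) (C3 : 'rV[R]_4 -> 'I_6 -> 'I_6 -> 'I_6 -> R) : Prop :=
  forall y v t, O y ->
  let d a b := dform (fun z s => w z s a b) y v t in
  let W a b b' a' := wedge (fun s => w y s a b) (fun s => w y s b' a') v t in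
  [/\ forall i, tg i ->
        d i0 i = W i0 i0 i0 i + \sum_(j | tg j) W i0 j j i,
      d i0 i0 = \sum_(i | tg i) W i0 i i i0,
      forall i j, tg i -> tg j ->
        d j i = W j i0 i0 i + \sum_(k | tg k) W j k k i + W j i5 i5 i
                + \sum_(k | tg k) \sum_(l | tg l) C y i j k l * W i0 k i0 l &
      forall i, tg i ->
        d i i0 = W i i0 i0 i0 + \sum_(j | tg j) W i j j i0
                 + \sum_(j | tg j) \sum_(k | tg k) C3 y i j k * W i0 j i0 k].

(* [C] is the tensor of conformal curvature in the frame with forms [w]. *)
Definition conformal_curvature (R : realType) (O : set 'rV[R]_4) (w : forms R)
    (C : tensor4 R) : Prop :=
  (forall y, O y -> weyl_symmetries C y) /\
  exists2 C3 : 'rV[R]_4 -> 'I_6 -> 'I_6 -> 'I_6 -> R,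
    (forall y i j k, O y -> C3 y i k j = - C3 y i j k) &
    structure_equations O w C C3.

(* [w] are the forms, in the coordinates of [u], of the normal conformal
   connection of [c] with respect to an isotropic frame field {A_0, ..., A_5}
   over the open set of points with coordinates in [O].  Skewness with respect to
   [gram] collects the relations omega_5^0 = omega_0^5 = 0,
   omega_5^5 = - omega_0^0, omega_i^5 = g_ij omega^j, omega_5^i = g^ij omega_j^0,
   g_ik omega_j^k + g_kj omega_i^k = 0.  The last clause but one says that
   2(omega^2 omega^3 - omega^1 omega^4) represents [c].  Such a frame field
   identifies P^5_x with the projective space of row vectors of length 6. *)
Definition reference_frame (R : realType) (M : manifold4 R) (c : set (tensor2 M))
    (u : chart R M) (O : set 'rV[R]_4) (w : forms R) : Prop :=
  [/\ [/\ open O, O `<=` cimg u,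
      forall y, O y -> linear (w y) &
      forall v a b, smooth_on O (fun y => w y v a b)],
      forall y v, O y -> w y v *m gram R + (w y v *m gram R)^T = 0,
      forall g y, c g -> O y -> exists2 s : R, 0 < s & forall v t,
        w y v i0 i2 * w y t i0 i3 + w y v i0 i3 * w y t i0 i2
        - w y v i0 i1 * w y t i0 i4 - w y v i0 i4 * w y t i0 i1
        = s * bilin (g u y) v t &
      exists C, conformal_curvature O w C].

(* The rows of [F] are the vertices of an isotropic frame at the point x, written
   in a reference frame; A_0 = x. *)
Definition isotropic_frame (R : realType) (F : 'M[R]_6) : Prop :=
  F *m gram R *m F^T = gram R /\ (forall b, b != i0 -> F i0 b = 0).

(* The differentials dA_a in the direction [v], written in the reference frame
   with forms [w], and the connection forms of the moving frame [G]. *)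
Definition frame_diff (R : realType) (w : forms R) (G : 'rV[R]_4 -> 'M[R]_6)
    (y v : 'rV[R]_4) : 'M[R]_6 :=
  (\matrix_(a < 6, b < 6) 'D_v (fun z => G z a b : R^o) y) + G y *m w y v.

Definition frame_forms (R : realType) (w : forms R) (G : 'rV[R]_4 -> 'M[R]_6) :
  forms R := fun y v => frame_diff w G y v *m invmx (G y).

(** * Lightlike hypersurfaces *)

(* A slice chart: in it V is the hyperplane where the last coordinate vanishes. *)
Definition slice_chart (R : realType) (M : manifold4 R) (V : set M)
    (u : chart R M) : Prop :=
  atlas u /\ forall x, cdom u x -> (V x <-> cmap u x 0 ord_max = 0).

Definition hypersurface (R : realType) (M : manifold4 R) (V : set M) : Prop :=
  forall x, V x -> exists2 u, slice_chart V u & cdom u x.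

(* The tangent space of V at a point of V, in a slice chart. *)
Definition tangentV (R : realType) : set 'rV[R]_4 := [set v | v 0 ord_max = 0].
Arguments tangentV {R}.

(* The hyperplanes tangent to C_x are the orthogonal complements of the nonzero
   isotropic vectors. *)
Definition lightlike_hypersurface (R : realType) (M : manifold4 R)
    (c : set (tensor2 M)) (V : set M) : Prop :=
  hypersurface V /\
  forall x u g, V x -> slice_chart V u -> cdom u x -> c g ->
  let gx := g u (cmap u x) in
  exists xi : 'rV[R]_4, [/\ xi != 0, bilin gx xi xi = 0 &
    forall v, tangentV v <-> bilin gx xi v = 0].

Definition velocity (R : realType) (M : Type) (u : chart R M) (gam : R -> M)
    (t : R) : 'rV[R]_4 :=
  \row_(j < 4) derive1 (fun s => cmap u (gam s) 0 j : R^o) t.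

(* A curve along which, near each parameter value, there are isotropic frames with
   dA_0 = A_1 dt and dA_1 = - A_0 dt.  This is an isotropic geodesic; developed
   into the fixed projective line A_0A_1, its point is
   cos t E_0 + sin t E_1 for a constant basis, so that, t running through all of R,
   the whole line is covered. *)
Definition complete_isotropic_geodesic (R : realType) (M : manifold4 R)
    (c : set (tensor2 M)) (gam : R -> M) : Prop :=
  forall t0 : R, exists u O w (F : R -> 'M[R]_6),
  atlas u /\ reference_frame c u O w /\ exists2 e : R, 0 < e &
    let I : set R := [set t | `|t - t0| < e] in
    [/\ forall t, I t -> cdom u (gam t) /\ O (cmap u (gam t)),
        forall j : 'I_4, smooth_on (W := R^o) I (fun t => cmap u (gam t) 0 j),
        forall a b, smooth_on (W := R^o) I (fun t => F t a b) &
        forall t, I t -> isotropic_frame (F t) /\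
          let dF := (\matrix_(a < 6, b < 6) derive1 (fun s => F s a b : R^o) t)
                    + F t *m w (cmap u (gam t)) (velocity u gam t) in
          row i0 dF = row i1 (F t) /\ row i1 dF = - row i0 (F t)].

(* The isotropic geodesic of V through each of its points (the integral curve of
   the field of lines l orthogonal to T(V)) is a part of an isotropic geodesic
   of M carrying a whole projective line. *)
Definition isotropic_geodesics_prolongable (R : realType) (M : manifold4 R)
    (c : set (tensor2 M)) (V : set M) : Prop :=
  forall x, V x -> exists gam : R -> M,
  [/\ gam 0 = x,
      \forall t \near (0 : R), V (gam t) /\
        (forall u g v, slice_chart V u -> cdom u (gam t) -> c g -> tangentV v ->
           bilin (g u (cmap u (gam t))) (velocity u gam t) v = 0) &
      complete_isotropic_geodesic c gam].

(** * Frames adapted to a lightlike hypersurface *)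

(* The plane A_0 A_1 A_2 is an alpha-generator, resp. A_0 A_1 A_3 is a
   beta-generator; lambda = l.2 / l.1 and mu = m.2 / m.1. *)
Definition alpha_plane (R : realType) (F : 'M[R]_6) : Prop :=
  exists2 l : R * R, l != (0, 0) & forall a, a \in [:: i1; i2] ->
    l.1 * F a i1 + l.2 * F a i3 = 0 /\ l.1 * F a i2 + l.2 * F a i4 = 0.

Definition beta_plane (R : realType) (F : 'M[R]_6) : Prop :=
  exists2 m : R * R, m != (0, 0) & forall a, a \in [:: i1; i3] ->
    m.1 * F a i1 + m.2 * F a i2 = 0 /\ m.1 * F a i3 + m.2 * F a i4 = 0.

(* [G] is a field of isotropic frames over the points with coordinates in [O'],
   written in the reference frame [w]; at the points of V its values are
   first-order frames: omega^4 = 0 on V says that T(V) is spanned by A_1, A_2, A_3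
   modulo A_0, hence A_1 lies on l. *)
Definition first_order_frame_field (R : realType) (M : manifold4 R) (V : set M)
    (u : chart R M) (O : set 'rV[R]_4) (w : forms R)
    (O' : set 'rV[R]_4) (G : 'rV[R]_4 -> 'M[R]_6) : Prop :=
  [/\ open O' /\ O' `<=` O,
      forall a b, smooth_on O' (fun y => G y a b),
      forall y, O' y -> isotropic_frame (G y) &
      forall y, O' y -> V (cinv u y) ->
        [/\ forall v, tangentV v -> frame_forms w G y v i0 i4 = 0,
            alpha_plane (G y) & beta_plane (G y)]].

(* The functions h_22 and h_33 live on V; they are carried by smooth functions of
   the ambient coordinates, of which only the restriction to V matters. *)
Record frame_field (R : realType) := FrameField {
  ff_dom : set 'rV[R]_4;
  ff_mx :> 'rV[R]_4 -> 'M[R]_6;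
  ff_C : tensor4 R;
  ff_h22 : 'rV[R]_4 -> R;
  ff_h33 : 'rV[R]_4 -> R }.

(* lambda_23 = 0, that is, A_1 is the point H. *)
Definition second_order_frame_field (R : realType) (M : manifold4 R) (V : set M)
    (u : chart R M) (O : set 'rV[R]_4) (w : forms R) (s : frame_field R) : Prop :=
  let om := frame_forms w s in
  [/\ first_order_frame_field V u O w (ff_dom s) s,
      conformal_curvature (ff_dom s) om (ff_C s),
      smooth_on (ff_dom s) (ff_h22 s), smooth_on (ff_dom s) (ff_h33 s) &
      forall y v, ff_dom s y -> V (cinv u y) -> tangentV v ->
        om y v i1 i3 = ff_h22 s y * om y v i0 i2 /\
        om y v i1 i2 = ff_h33 s y * om y v i0 i3].

Definition ca0 (R : realType) (s : frame_field R) y := lower (ff_C s) y i1 i2 i1 i2.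
Definition ca1 (R : realType) (s : frame_field R) y := lower (ff_C s) y i1 i2 i1 i4.
Definition cb0 (R : realType) (s : frame_field R) y := lower (ff_C s) y i1 i3 i1 i3.
Definition cb1 (R : realType) (s : frame_field R) y := lower (ff_C s) y i1 i3 i1 i4.

Definition Dinv (R : realType) (s : frame_field R) (y : 'rV[R]_4) : R :=
  4 * (3 * ff_h22 s y * cb0 s y + ff_h33 s y * ca0 s y)
    * (ff_h22 s y * cb0 s y + 3 * ff_h33 s y * ca0 s y).

(* The quantities h_222, h_223, h_233, h_333 of the frame s(y) are k222, ..., k333;
   the identities on the frame bundle are pulled back to V by the section [s], and
   determine the k's since omega^1, omega^2, omega^3 are independent on V. *)
Definition third_order_quantities (R : realType) (w : forms R) (s : frame_field R)
    (y : 'rV[R]_4) (k222 k223 k233 k333 : R) : Prop :=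
  let om a b v := frame_forms w s y v a b in
  let h22 := ff_h22 s y in
  let h33 := ff_h33 s y in
  forall v, tangentV v ->
  [/\ 'D_v (ff_h22 s : _ -> R^o) y
        + h22 * (om i0 i0 v - 2 * om i2 i2 v - om i1 i1 v) + 2 * ca0 s y * om i0 i1 v
      = k222 * om i0 i2 v + k223 * om i0 i3 v,
      om i1 i0 v = h22 * h33 * om i0 i1 v - (k223 + 2 * ca1 s y) * om i0 i2 v
                   - (k233 + 2 * cb1 s y) * om i0 i3 v &
      'D_v (ff_h33 s : _ -> R^o) y
        + h33 * (om i0 i0 v + 2 * om i2 i2 v - om i1 i1 v) + 2 * cb0 s y * om i0 i1 v
      = k233 * om i0 i2 v + k333 * om i0 i3 v].

Definition same_point (R : realType) (p q : 'rV[R]_6) : Prop :=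
  exists2 k : R, k != 0 & p = k *: q.

(* Main.v *)
Require Import Defs.
From HB Require Import structures.
From mathcomp Require Import all_boot all_order all_algebra.
From mathcomp Require Import all_classical all_reals all_analysis.
From mathcomp Require Import ring lra.
Set Implicit Arguments.
Unset Strict Implicit.
Unset Printing Implicit Defensive.
Import Order.TTheory GRing.Theory Num.Theory.
Import numFieldNormedType.Exports.
Local Open Scope classical_set_scope.
Local Open Scope ring_scope.

(** The idea is to move the vertices A_2 and A_3 and to see how the third-order
    quantities h_abc change.

    Two second-order frames at a point are related by a matrix T that preserves
    the scalar products and, along V, maps each of A_0, A_1, the alpha-plane and
    the beta-plane to itself up to scale: A_2 becomes a combination
    q A_0 + p A_1 + t2 A_2 and A_3 a combination t A_0 + r A_1 + t3 A_3, while A_4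
    and A_5 follow.  The four numbers p, q, r, t are the freedom left by the
    second-order frames ([adapted_of_planes], [adapted_change], [change_H]).

    The identities defining the h_abc hold for every second-order frame field:
    they come from the exterior derivatives of omega_1^3 = h_22 omega^2 and
    omega_1^2 = h_33 omega^3 and from Cartan's lemma ([exterior_second_order],
    [cartan_lemma], [third_order_exists]).  Comparing them in two frames gives,
    up to nonzero factors and with P, Q, A, S for the normalized parameters,
      h'_222 = h_222 - 3 h_22 X - 2 a_0 P,   h'_233 = h_233 + h_33 X - 2 b_0 P,
      h'_223 = h_223 + h_22 Y - 2 a_0 A,     h'_333 = h_333 - 3 h_33 Y - 2 b_0 A,
    where X = Q - A h_22 and Y = S - P h_33 ([third_order_change]).  The conditions
    h'_abc = 0 thus split into a linear system for (X, P) and another one for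
    (Y, A); the product of their determinants is - D, so that for D different
    from 0 they have exactly one solution, that is, A_2 and A_3 are determined up
    to scale ([third_order_system]).  Solving the systems along V gives a smooth
    frame field in which the h_abc vanish ([third_order_frame_exists]).

    It remains to provide the objects that are compared.  A first-order frame
    field exists near every point of V because the isotropic direction of T(V) is
    a 2 x 2 matrix of rank one, whose factors depend rationally on it
    ([isotropic_direction], [first_order_exists]); moving A_1 along A_0 A_1 makes it
    of second order ([second_order_exists]).  That the connection forms of such
    fields satisfy the structure equations of the normal conformal connection
    follows from the tensoriality of the curvature ([curv_gauge],
    [conformal_curvature_gauge]), which rests on the symmetry of second
    derivatives ([smooth_derive_comm]). *)

(** * Calculus of smooth functions on an open set *)

Section SmoothCalculus.
Variables (R : realType) (W : normedModType R).
Implicit Types (O : set W) (f g : W -> R^o) (x y v t : W).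

Lemma differentiable_near f g x :
  (\forall z \near x, f z = g z) -> differentiable f x -> differentiable g x.
Proof.
move=> fg df.
have h0 : \forall z \near x, (g z : R^o) - f z = 0.
  apply: filterS fg => z ->; exact: (subrr (g z : R)).
pose h : W -> R^o := fun z => g z - f z.
have -> : g = f + h by apply/funext => z; rewrite /h fctE addrC subrK.
apply: differentiableD => //.
have hx : h x = 0 by exact: (nbhs_singleton h0).
have e0 : h \o shift x = cst (h x) + (cst 0 : W -> R^o) +o_ 0 id.
  apply/eqaddoP => e e_gt0.
  have : \forall z \near (0 : W), h (z + x) = 0.
    by have := h0; rewrite (near_shift 0 x) /= ; apply: filterS => z /=; rewrite subr0.
  apply: filterS => z /= hz.
  rewrite !fctE /= hz hx.
  have -> : (0 - (0 + 0) : R^o) = 0 by rewrite addr0 (subrr (0 : R)).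
  by rewrite normr0 mulr_ge0 // ltW.
have dh : 'd h x = (cst 0 : W -> R^o) :> (W -> R^o).
  have -> : (cst 0 : W -> R^o) = (\0 : {linear W -> R^o}) by [].
  apply: diff_unique; first exact: cst_continuous.
  exact: e0.
apply/diff_locallyP; rewrite dh; split; last exact: e0.
exact: cst_continuous.
Qed.

Lemma near_open O x (P : W -> Prop) :
  open O -> O x -> (forall z, O z -> P z) -> \forall z \near x, P z.
Proof. by move=> oO Ox OP; near=> z; apply: OP; near: z; exact: open_nbhs_nbhs.
Unshelve. all: by end_near. Qed.

Lemma Ck_eq k O f g :
  open O -> (forall z, O z -> f z = g z) -> Ck k O f -> Ck k O g.
Proof.
elim: k f g => [|k IH] f g oO fg /=.
  move=> cf x Ox; have nfg := near_open oO Ox fg.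
  rewrite /prop_for /continuous_at -(fg _ Ox).
  exact: (cvg_trans (near_eq_cvg nfg) (cf x Ox)).
move=> [df Df]; split.
  by move=> x Ox; apply: differentiable_near (df x Ox); apply: near_open fg.
move=> v; apply: IH (Df v) => // z Oz.
by apply: near_eq_derive; apply: near_open fg.
Qed.

Lemma Ck_sub k O O' f : O' `<=` O -> Ck k O f -> Ck k O' f.
Proof.
elim: k f => [|k IH] f sO /=; first by move=> cf x /sO; exact: cf.
by move=> [df Df]; split; [move=> x /sO; exact: df | move=> v; exact: IH].
Qed.

Lemma Ck_pred k O f : Ck k.+1 O f -> Ck k O f.
Proof.
elim: k f => [|k IH] f; first by move=> [df _] x Ox; exact: differentiable_continuous (df x Ox).
by move=> [df Df]; split => // v; apply: IH.
Qed.

Lemma Ck_cst k O (a : R) : Ck k O (fun=> a).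
Proof.
elim: k a => [|k IH] a; first by move=> x _; exact: cst_continuous.
split; first by move=> x _; exact: differentiable_cst.
by move=> v; have -> : (fun x => 'D_v (fun=> a : R^o) x) = (fun=> 0) by
  apply/funext => x; exact: derive_cst.
Qed.

Lemma CkD k O f g : open O -> Ck k O f -> Ck k O g -> Ck k O (fun z => f z + g z).
Proof.
elim: k f g => [|k IH] f g oO /=.
  by move=> cf cg x Ox; apply: (@continuousD _ _ _ f g); [exact: cf | exact: cg].
move=> [df Df] [dg Dg]; split.
  by move=> x Ox; apply: (@differentiableD _ _ _ f g); [exact: df | exact: dg].
move=> v; apply: (@Ck_eq _ _ (fun z => 'D_v f z + 'D_v g z)) => //; last exact: IH.
by move=> z Oz; rewrite (@deriveD _ _ _ f g)//; apply: diff_derivable; [exact: df | exact: dg].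
Qed.

Lemma derive_mul f g x v : differentiable f x -> differentiable g x ->
  'D_v (fun z => f z * g z : R^o) x = 'D_v f x * g x + f x * 'D_v g x.
Proof.
move=> df dg; rewrite (@deriveM _ _ f g); [|exact: diff_derivable..].
by rewrite addrC; congr (_ + _); rewrite mulrC.
Qed.

Lemma CkM k O f g : open O -> Ck k O f -> Ck k O g -> Ck k O (fun z => f z * g z).
Proof.
elim: k f g => [|k IH] f g oO.
  by move=> cf cg x Ox; apply: (@continuousM _ _ f g); [exact: cf | exact: cg].
move=> sf sg; have [kf kg] := (Ck_pred sf, Ck_pred sg).
case: sf sg => [df Df] [dg Dg]; split.
  by move=> x Ox; apply: (@differentiableM _ _ f g); [exact: df | exact: dg].
move=> v; apply: (@Ck_eq _ _ (fun z => 'D_v f z * g z + f z * 'D_v g z)) => //.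
  by move=> z Oz; rewrite derive_mul//; [exact: df | exact: dg].
apply: CkD => //; apply: IH => //; [exact: Df|exact: Dg].
Qed.

Lemma CkV k O f : open O -> (forall z, O z -> f z != 0) -> Ck k O f ->
  Ck k O (fun z => (f z)^-1).
Proof.
move=> oO f0; elim: k => [|k IH] sf.
  by move=> x Ox; apply: cvgV; [exact: f0 | exact: sf].
have kf := Ck_pred sf; case: sf => df Df; split.
  by move=> x Ox; apply: (@differentiableV _ _ f); [exact: df | exact: f0].
move=> v; apply: (@Ck_eq _ _ (fun z => -1 * ((f z)^-1 * (f z)^-1) * 'D_v f z)) => //.
  move=> z Oz; rewrite deriveV ?f0//; last by apply: diff_derivable; exact: df.
  by rewrite /GRing.scale /= expr2 invfM mulN1r.
apply: CkM => //; last exact: Df.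
apply: CkM => //; first exact: Ck_cst.
by apply: CkM => //; exact: IH.
Qed.

Lemma smooth_eq O f g :
  open O -> (forall z, O z -> f z = g z) -> smooth_on O f -> smooth_on O g.
Proof. by move=> oO fg sf k; apply: Ck_eq fg _. Qed.

Lemma smooth_sub O O' f : O' `<=` O -> smooth_on O f -> smooth_on O' f.
Proof. by move=> sO sf k; apply: Ck_sub sO _. Qed.

Lemma smooth_cst O (a : R) : smooth_on O (fun=> a).
Proof. by move=> k; exact: Ck_cst. Qed.

Lemma smoothD O f g : open O -> smooth_on O f -> smooth_on O g ->
  smooth_on O (fun z => f z + g z).
Proof. by move=> oO sf sg k; apply: CkD. Qed.

Lemma smoothM O f g : open O -> smooth_on O f -> smooth_on O g ->
  smooth_on O (fun z => f z * g z).
Proof. by move=> oO sf sg k; apply: CkM. Qed.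

Lemma smoothV O f : open O -> (forall z, O z -> f z != 0) -> smooth_on O f ->
  smooth_on O (fun z => (f z)^-1).
Proof. by move=> oO f0 sf k; apply: CkV. Qed.

Lemma smoothN O f : open O -> smooth_on O f -> smooth_on O (fun z => - f z).
Proof.
move=> oO sf; apply: (@smooth_eq _ (fun z => -1 * f z)) => //.
  by move=> z _; rewrite mulN1r.
by apply: smoothM => //; exact: smooth_cst.
Qed.

Lemma smoothB O f g : open O -> smooth_on O f -> smooth_on O g ->
  smooth_on O (fun z => f z - g z).
Proof. by move=> oO sf sg; apply: smoothD => //; exact: smoothN. Qed.

Lemma smooth_sum (I : Type) (r : seq I) (P : pred I) O (F : I -> W -> R^o) :
  open O -> (forall i, P i -> smooth_on O (F i)) ->
  smooth_on O (fun z => \sum_(i <- r | P i) F i z).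
Proof.
move=> oO sF; elim: r => [|i r IH].
  by apply: (smooth_eq oO _ (smooth_cst O 0)) => z _; rewrite big_nil.
case Pi: (P i); last by apply: (smooth_eq oO _ IH) => z _; rewrite big_cons Pi.
apply: (smooth_eq oO _ (smoothD oO (sF i Pi) IH)) => z _.
by rewrite big_cons Pi.
Qed.

Lemma smooth_prod (I : Type) (r : seq I) (P : pred I) O (F : I -> W -> R^o) :
  open O -> (forall i, P i -> smooth_on O (F i)) ->
  smooth_on O (fun z => \prod_(i <- r | P i) F i z).
Proof.
move=> oO sF; elim: r => [|i r IH].
  by apply: (smooth_eq oO _ (smooth_cst O 1)) => z _; rewrite big_nil.
case Pi: (P i); last by apply: (smooth_eq oO _ IH) => z _; rewrite big_cons Pi.
apply: (smooth_eq oO _ (smoothM oO (sF i Pi) IH)) => z _.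
by rewrite big_cons Pi.
Qed.

Lemma smooth_differentiable O f x : smooth_on O f -> O x -> differentiable f x.
Proof. by move=> /(_ 1%N) [df _]; exact: df. Qed.

Lemma smooth_derive O f v : smooth_on O f -> smooth_on O (fun z => 'D_v f z).
Proof. by move=> sf k; have [_] := sf k.+1; exact. Qed.

Lemma smooth_continuous O f x : smooth_on O f -> O x -> {for x, continuous f}.
Proof. by move=> /(_ 0); exact. Qed.

Lemma smooth_open_neq0 O f : open O -> smooth_on O f ->
  open [set z | O z /\ f z != 0].
Proof.
move=> oO sf; rewrite openE => z /= [Oz fz].
have nf : \forall w \near z, f w != 0.
  exact: (cvgr_neq0 (f z) (smooth_continuous sf Oz) fz).
apply: filterS2 (open_nbhs_nbhs (conj oO Oz)) nf => w Ow fw.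
by split.
Qed.

Lemma derive_linear f x (a : R) v t : differentiable f x ->
  'D_(a *: v + t) f x = a * 'D_v f x + 'D_t f x.
Proof. by move=> df; rewrite !deriveE // linearP. Qed.

Lemma derive_add f g x v : differentiable f x -> differentiable g x ->
  'D_v (fun z => f z + g z : R^o) x = 'D_v f x + 'D_v g x.
Proof. by move=> df dg; rewrite (@deriveD _ _ _ f g) //; exact: diff_derivable. Qed.

Lemma derive_sub f g x v : differentiable f x -> differentiable g x ->
  'D_v (fun z => f z - g z : R^o) x = 'D_v f x - 'D_v g x.
Proof. by move=> df dg; rewrite (@deriveB _ _ _ f g) //; exact: diff_derivable. Qed.

Lemma differentiable_sumf (I : Type) (r : seq I) (F : I -> W -> R^o) x :
  (forall i, differentiable (F i) x) ->
  differentiable (fun z => \sum_(i <- r) F i z : R^o) x.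
Proof.
move=> dF; elim: r => [|i r IH].
  have -> : (fun z => \sum_(i <- [::]) F i z : R^o) = cst 0.
    by apply/funext => z; rewrite big_nil.
  exact: differentiable_cst.
have -> : (fun z => \sum_(j <- i :: r) F j z : R^o) =
          F i + (fun z => \sum_(j <- r) F j z : R^o).
  by apply/funext => z; rewrite big_cons.
exact: differentiableD.
Qed.

Lemma derive_sumf (I : Type) (r : seq I) (F : I -> W -> R^o) x v :
  (forall i, differentiable (F i) x) ->
  'D_v (fun z => \sum_(i <- r) F i z : R^o) x = \sum_(i <- r) 'D_v (F i) x.
Proof.
move=> dF; elim: r => [|i r IH].
  have -> : (fun z => \sum_(i <- [::]) F i z : R^o) = cst 0.
    by apply/funext => z; rewrite big_nil.
  by rewrite derive_cst big_nil.
rewrite big_cons -IH -derive_add //; last exact: differentiable_sumf.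
by congr ('D_v _ x); apply/funext => z; rewrite big_cons.
Qed.

End SmoothCalculus.

Section Schwarz.
Variables (R : realType) (W : normedModType R).
Implicit Types (O : set W) (f g : W -> R^o) (x y v t : W).

Lemma derive_comp_shift g (a : W) x v : differentiable g (x + a) ->
  differentiable (fun z => g (z + a) : R^o) x /\
  'D_v (fun z => g (z + a) : R^o) x = 'D_v g (x + a).
Proof.
move=> dg; split.
  by apply: (@differentiable_comp _ _ _ _ (fun z => z + a) g).
by rewrite /derive; congr (lim (_ @ 0^')); apply/funext => h /=; rewrite addrA.
Qed.

Lemma is_derive_line g x v (s : R) : differentiable g (x + s *: v) ->
  is_derive s (1 : R) (fun r : R => g (x + r *: v)) ('D_v g (x + s *: v)).
Proof.
move=> /(@diff_derivable _ _ _ _ _ v) dg.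
have e : (fun h : R => h^-1 *: (((fun r : R => g (x + r *: v)) \o shift s) (h *: (1 : R)) - g (x + s *: v)))
  = (fun h : R => h^-1 *: ((g \o shift (x + s *: v)) (h *: v) - g (x + s *: v))).
  apply/funext => h /=; congr (_ *: (g _ - _)).
  by rewrite (_ : h *: (1 : R) = h) ?scalerDl 1?addrCA //; exact: mulr1.
apply: DeriveDef; first by rewrite /derivable e; exact: dg.
by rewrite /derive e.
Qed.

Lemma MVT_line g x v (h : R) : 0 < h ->
  (forall s, 0 <= s <= h -> differentiable g (x + s *: v)) ->
  exists2 c, 0 < c < h & g (x + h *: v) - g x = h * 'D_v g (x + c *: v).
Proof.
move=> h0 dg.
have [| |c ch] := @MVT R (fun r => g (x + r *: v)) (fun s => 'D_v g (x + s *: v)) 0 h h0.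
- move=> s; rewrite in_itv /= => /andP[s0 sh]; apply: is_derive_line.
  by apply: dg; rewrite (ltW s0) (ltW sh).
- apply: derivable_within_continuous => s; rewrite in_itv /= => sh.
  by have [] := is_derive_line (dg _ sh).
rewrite scale0r addr0 subr0 mulrC => e; exists c => //.
Qed.

(** Two applications of the mean value theorem.  The left-hand side is symmetric
    in [v] and [t], so that it also gives a value of the mixed derivative in the
    other order; letting the parallelogram shrink makes the two orders agree. *)
Lemma second_difference f x v t (h : R) : 0 < h ->
  (forall a b, 0 <= a <= h -> 0 <= b <= h ->
     differentiable f (x + a *: v + b *: t) /\
     differentiable (fun z => 'D_v f z : R^o) (x + a *: v + b *: t)) ->
  exists c d, [/\ 0 < c < h, 0 < d < h &
   f (x + h *: v + h *: t) - f (x + h *: v) - (f (x + h *: t) - f x)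
   = h * (h * 'D_t (fun z => 'D_v f z : R^o) (x + c *: v + d *: t))].
Proof.
move=> h0 df.
have hh : 0 <= h <= h by rewrite lexx ltW.
have h00 : (0 : R) <= 0 <= h by rewrite lexx ltW.
have df0 a : 0 <= a <= h -> differentiable f (x + a *: v).
  by move=> ah; have [] := df a 0 ah h00; rewrite scale0r addr0.
have dg a : 0 <= a <= h ->
  differentiable (fun z => f (z + h *: t) - f z : R^o) (x + a *: v) /\
  'D_v (fun z => f (z + h *: t) - f z : R^o) (x + a *: v) =
   'D_v f (x + a *: v + h *: t) - 'D_v f (x + a *: v).
  move=> ah; have [d1 _] := df a h ah hh.
  have [d2 e2] := derive_comp_shift v d1; have d3 := df0 a ah; split.
    exact: (@differentiableB _ _ _ (fun z => f (z + h *: t) : R^o) f).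
  by rewrite (derive_sub v d2 d3) e2.
have [a ah|c ch e] := @MVT_line (fun z => f (z + h *: t) - f z : R^o) x v h h0.
  by have [] := dg a ah.
have chw : 0 <= c <= h by case/andP: ch => *; rewrite !ltW.
have [b bh|d dh e'] := @MVT_line (fun z => 'D_v f z : R^o) (x + c *: v) t h h0.
  by have [] := df c b chw bh.
exists c, d; split => //.
by rewrite -e' -(dg c chw).2 -e.
Qed.

Lemma near_parallelogram x v t (P : W -> Prop) : (\forall z \near x, P z) ->
  exists2 e : R, 0 < e & forall a b, 0 <= a <= e -> 0 <= b <= e ->
    P (x + a *: v + b *: t).
Proof.
move=> /nbhs_normP[e /= e0 eP].
have k0 : 0 < `|v| + `|t| + 1 by rewrite ltr_wpDl // addr_ge0.
exists (e / (`|v| + `|t| + 1) / 2); first by rewrite !divr_gt0.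
set r := e / _ / 2 => a b /andP[a0 ar] /andP[b0 br].
have r0 : 0 < r by rewrite !divr_gt0.
apply: eP; rewrite /= -addrA opprD addrA subrr sub0r normrN.
apply: (le_lt_trans (ler_normD _ _)).
rewrite !normrZ !ger0_norm //.
apply: (@le_lt_trans _ _ (r * (`|v| + `|t| + 1))).
  rewrite !mulrDr mulr1 -[leLHS]addr0 lerD ?(ltW r0) // lerD // ler_wpM2r //.
have -> : r * (`|v| + `|t| + 1) = e / 2 by rewrite /r mulrAC divfK // gt_eqF.
by rewrite gtr_pMr // invf_lt1 // ltr1n.
Qed.

Lemma eq_of_common_approx (p r : R) :
  (forall e, 0 < e -> exists2 s, `|p - s| < e & `|r - s| < e) -> p = r.
Proof.
move=> H; apply/eqP; rewrite -subr_eq0 -normr_eq0 eq_le normr_ge0 andbT leNgt.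
apply/negP => pr; have [|s ps rs] := H (`|p - r| / 2); first by rewrite divr_gt0.
suff : `|p - r| < `|p - r| by rewrite ltxx.
rewrite -{1}(subrKA s) [ltRHS]splitr.
by apply: (le_lt_trans (ler_normD _ _)); apply: ltrD => //; rewrite distrC.
Qed.

Lemma smooth_derive_comm O f x v t : open O -> smooth_on O f -> O x ->
  'D_v (fun z => 'D_t f z : R^o) x = 'D_t (fun z => 'D_v f z : R^o) x.
Proof.
move=> oO sf Ox.
pose A := fun z => 'D_v (fun z => 'D_t f z : R^o) z : R^o.
pose B := fun z => 'D_t (fun z => 'D_v f z : R^o) z : R^o.
rewrite -[LHS]/(A x) -[RHS]/(B x); apply: eq_of_common_approx => e e0.
have near_cont (g : W -> R^o) : {for x, continuous g} -> \forall z \near x, `|(g x : R) - (g z : R)| < e.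
  by move=> /cvgrPdist_lt /(_ _ e0).
have cA := near_cont A (smooth_continuous (smooth_derive v (smooth_derive t sf)) Ox).
have cB := near_cont B (smooth_continuous (smooth_derive t (smooth_derive v sf)) Ox).
have nO : \forall z \near x, O z by exact: open_nbhs_nbhs.
have [h h0 hP] := near_parallelogram v t (filterI nO (filterI cA cB)).
have [a b ah bh|c [d [/andP[c0 ch] /andP[d0 dh] eB]]] := @second_difference f x v t h h0.
  have [Oz _] := hP _ _ ah bh; split.
    exact: smooth_differentiable sf Oz.
  exact: smooth_differentiable (smooth_derive v sf) Oz.
have [a b ah bh|c' [d' [/andP[c0' ch'] /andP[d0' dh'] eA]]] := @second_difference f x t v h h0.
  have [Oz _] := hP _ _ bh ah.
  rewrite -addrA (addrC (a *: t)) addrA; split.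
    exact: smooth_differentiable sf Oz.
  exact: smooth_differentiable (smooth_derive t sf) Oz.
have AB : A (x + c' *: t + d' *: v) = B (x + c *: v + d *: t).
  have hu : h != 0 by rewrite gt_eqF.
  rewrite (addrAC x) in eA.
  have sym (p q r s : R) : p - q - (r - s) = p - r - (q - s) by ring.
  have e3 : h * (h * (A (x + c' *: t + d' *: v) : R)) = h * (h * (B (x + c *: v + d *: t) : R)).
    exact: etrans (esym eA) (etrans (sym _ _ _ _) eB).
  exact: (mulfI hu (mulfI hu e3)).
have w01 (r : R) : 0 < r -> r < h -> 0 <= r <= h by move=> r0 rh; rewrite !ltW.
have [_ [_ nB]] := hP _ _ (w01 _ c0 ch) (w01 _ d0 dh).
have [_ [nA _]] := hP _ _ (w01 _ d0' dh') (w01 _ c0' ch').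
rewrite (addrAC x) in nA; exists (A (x + c' *: t + d' *: v)); first exact: nA.
by rewrite AB; exact: nB.
Qed.
End Schwarz.

(** * Smooth matrix-valued functions *)

Section MatrixCalculus.
Variables (R : realType) (W : normedModType R).
Implicit Types (O : set W) (y v t : W).

Definition smooth_mx m n (O : set W) (F : W -> 'M[R]_(m, n)) : Prop :=
  forall a b, smooth_on O (fun y => F y a b).

Definition dmx m n (v : W) (F : W -> 'M[R]_(m, n)) (y : W) : 'M[R]_(m, n) :=
  \matrix_(a, b) 'D_v (fun z => F z a b : R^o) y.

Lemma smooth_mx_sub m n O O' (F : W -> 'M[R]_(m, n)) : O' `<=` O ->
  smooth_mx O F -> smooth_mx O' F.
Proof. by move=> sO sF a b; exact: smooth_sub (sF a b). Qed.

Lemma smooth_mx_cst m n O (A : 'M[R]_(m, n)) : smooth_mx O (fun=> A).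
Proof. by move=> a b; exact: smooth_cst. Qed.

Lemma smooth_mxD m n O (F G : W -> 'M[R]_(m, n)) : open O ->
  smooth_mx O F -> smooth_mx O G -> smooth_mx O (fun z => F z + G z).
Proof.
move=> oO sF sG a b; apply: (smooth_eq oO _ (smoothD oO (sF a b) (sG a b))).
by move=> z _; rewrite mxE.
Qed.

Lemma smooth_mxM m n p O (F : W -> 'M[R]_(m, n)) (G : W -> 'M[R]_(n, p)) :
  open O -> smooth_mx O F -> smooth_mx O G -> smooth_mx O (fun z => F z *m G z).
Proof.
move=> oO sF sG a b.
apply: (@smooth_eq _ _ _ (fun z => \sum_j F z a j * G z j b)) => //.
  by move=> z _; rewrite mxE.
by apply: smooth_sum => // j _; apply: smoothM.
Qed.

Lemma smooth_mx_tr m n O (F : W -> 'M[R]_(m, n)) :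
  smooth_mx O F -> smooth_mx O (fun z => (F z)^T).
Proof.
move=> sF a b; have -> : (fun z => (F z)^T a b : R^o) = (fun z => F z b a).
  by apply/funext => z; rewrite mxE.
exact: sF.
Qed.

Lemma smooth_det n O (F : W -> 'M[R]_n) : open O -> smooth_mx O F ->
  smooth_on O (fun z => \det (F z)).
Proof.
move=> oO sF; apply: smooth_sum => // s _; apply: smoothM => //; first exact: smooth_cst.
by apply: smooth_prod => // i _; exact: sF.
Qed.

Lemma smooth_invmx n O (F : W -> 'M[R]_n) : open O -> smooth_mx O F ->
  (forall z, O z -> F z \in unitmx) -> smooth_mx O (fun z => invmx (F z)).
Proof.
move=> oO sF uF a b.
apply: (@smooth_eq _ _ _ (fun z => (\det (F z))^-1 * cofactor (F z) b a)) => //.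
  by move=> z Oz; rewrite /invmx uF // !mxE.
have sdet := smooth_det oO sF.
apply: smoothM => //.
  by apply: smoothV => // z /uF; rewrite unitmxE unitfE.
apply: smoothM => //; first exact: smooth_cst.
apply: smooth_det => // i j.
apply: (@smooth_eq _ _ _ (fun z => F z (lift b i) (lift a j))) => //.
by move=> z _; rewrite !mxE.
Qed.

Lemma smooth_dmx m n O (F : W -> 'M[R]_(m, n)) v : open O -> smooth_mx O F ->
  smooth_mx O (dmx v F).
Proof.
move=> oO sF a b; apply: (smooth_eq oO _ (smooth_derive v (sF a b))).
by move=> z _; rewrite mxE.
Qed.

Lemma dmx_eq m n O (F G : W -> 'M[R]_(m, n)) y v : open O -> O y ->
  (forall z, O z -> F z = G z) -> dmx v F y = dmx v G y.
Proof.
move=> oO Oy FG; apply/matrixP => a b; rewrite !mxE; apply: near_eq_derive.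
by apply: near_open Oy _ => // z Oz; rewrite FG.
Qed.

Lemma dmx_cst m n (A : 'M[R]_(m, n)) y v : dmx v (fun=> A) y = 0.
Proof. by apply/matrixP => a b; rewrite !mxE; exact: derive_cst. Qed.

Lemma dmxD m n O (F G : W -> 'M[R]_(m, n)) y v :
  smooth_mx O F -> smooth_mx O G -> O y ->
  dmx v (fun z => F z + G z) y = dmx v F y + dmx v G y.
Proof.
move=> sF sG Oy; apply/matrixP => a b; rewrite !mxE -derive_add.
- by congr ('D_v _ y); apply/funext => z; rewrite mxE.
- exact: smooth_differentiable (sF a b) Oy.
- exact: smooth_differentiable (sG a b) Oy.
Qed.

Lemma dmxM m n p O (F : W -> 'M[R]_(m, n)) (G : W -> 'M[R]_(n, p)) y v :
  open O -> smooth_mx O F -> smooth_mx O G -> O y ->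
  dmx v (fun z => F z *m G z) y = dmx v F y *m G y + F y *m dmx v G y.
Proof.
move=> oO sF sG Oy; apply/matrixP => a b.
have dF i j := smooth_differentiable (sF i j) Oy.
have dG i j := smooth_differentiable (sG i j) Oy.
rewrite !mxE -big_split /=.
transitivity ('D_v (fun z => \sum_j F z a j * G z j b : R^o) y).
  by congr ('D_v _ y); apply/funext => z; rewrite mxE.
rewrite (@derive_sumf _ _ _ _ (fun j z => F z a j * G z j b : R^o)).
  by apply: eq_bigr => j _; rewrite !mxE derive_mul.
by move=> j; exact: (differentiableM (dF a j) (dG j b)).
Qed.

Lemma dmx_tr m n (F : W -> 'M[R]_(m, n)) y v :
  dmx v (fun z => (F z)^T) y = (dmx v F y)^T.
Proof.
by apply/matrixP => a b; rewrite !mxE; congr ('D_v _ y); apply/funext => z; rewrite mxE.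
Qed.

Lemma dmx_comm m n O (F : W -> 'M[R]_(m, n)) y v t : open O -> smooth_mx O F ->
  O y -> dmx v (dmx t F) y = dmx t (dmx v F) y.
Proof.
move=> oO sF Oy; apply/matrixP => a b; rewrite [LHS]mxE [RHS]mxE.
have E s : (fun z => dmx s F z a b : R^o) = (fun z => 'D_s (fun z => F z a b : R^o) z).
  by apply/funext => z; rewrite mxE.
rewrite !E; exact: (smooth_derive_comm v t oO (sF a b) Oy).
Qed.

Lemma dmx_linear m n O (F : W -> 'M[R]_(m, n)) y (k : R) v t : smooth_mx O F -> O y ->
  dmx (k *: v + t) F y = k *: dmx v F y + dmx t F y.
Proof.
move=> sF Oy; apply/matrixP => a b; rewrite !mxE derive_linear //.
exact: smooth_differentiable (sF a b) Oy.
Qed.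

End MatrixCalculus.

(** * The Gram matrix of isotropic frames *)

Section Gram.
Variable R : realType.
Implicit Types A B F : 'M[R]_6.

Lemma ind6 (P : 'I_6 -> Prop) :
  P i0 -> P i1 -> P i2 -> P i3 -> P i4 -> P i5 -> forall i, P i.
Proof.
move=> P0 P1 P2 P3 P4 P5 [] m.
have E (i j : 'I_6) : P i -> val i = val j -> P j by move=> Pi /val_inj <-.
case: m => [|[|[|[|[|[|//]]]]]] h.
- exact: E P0 _.
- exact: E P1 _.
- exact: E P2 _.
- exact: E P3 _.
- exact: E P4 _.
- exact: E P5 _.
Qed.

Lemma sum6 (V : nmodType) (f : 'I_6 -> V) :
  \sum_i f i = f i0 + (f i1 + (f i2 + (f i3 + (f i4 + f i5)))).
Proof.
rewrite !big_ord_recl big_ord0 addr0.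
by do !congr (_ + _); congr f; apply: val_inj.
Qed.

Lemma sum_tg (V : nmodType) (f : 'I_6 -> V) :
  \sum_(i | tg i) f i = f i1 + (f i2 + (f i3 + f i4)).
Proof. by rewrite big_mkcond sum6 /= add0r addr0. Qed.

Lemma sum6_tg (V : nmodType) (f : 'I_6 -> V) :
  \sum_i f i = f i0 + \sum_(i | tg i) f i + f i5.
Proof. by rewrite sum6 sum_tg !addrA. Qed.

Lemma mul_gram A a :
  [/\ [/\ (A *m gram R) a i0 = - A a i5, (A *m gram R) a i1 = - A a i4 &
          (A *m gram R) a i2 = A a i3],
      (A *m gram R) a i3 = A a i2, (A *m gram R) a i4 = - A a i1 &
      (A *m gram R) a i5 = - A a i0].
Proof.
have E b : (A *m gram R) a b = \sum_c A a c * gram R c b by rewrite mxE.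
by split=> //; [split=> // |..]; rewrite E sum6 !mxE /=;
  rewrite !(mulr0, mulrN1, mulr1, add0r, addr0).
Qed.

Lemma tr_gram : (gram R)^T = gram R.
Proof.
apply/matrixP => a b; rewrite !mxE addnC.
case: ifP => // /eqP e.
by move: a b e; elim/ind6; elim/ind6.
Qed.

Lemma gram_mul_gram : gram R *m gram R = 1%:M.
Proof.
apply/matrixP; elim/ind6; elim/ind6; rewrite mxE sum6 !mxE /=;
  by rewrite !(mulr0, mul0r, mulrN1, mulr1, add0r, addr0, opprK).
Qed.

Lemma gram_mul A b :
  [/\ [/\ (gram R *m A) i0 b = - A i5 b, (gram R *m A) i1 b = - A i4 b &
          (gram R *m A) i2 b = A i3 b],
      (gram R *m A) i3 b = A i2 b, (gram R *m A) i4 b = - A i1 b &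
      (gram R *m A) i5 b = - A i0 b].
Proof.
have E a : (gram R *m A) a b = (A^T *m gram R) b a.
  by rewrite -[gram R *m A]trmxK trmx_mul tr_gram mxE.
by rewrite !E; have [[-> -> ->] -> -> ->] := mul_gram A^T b; rewrite !mxE.
Qed.

(** The vertices of a frame form a pseudo-orthonormal basis, so that the inverse
    of a frame is polynomial in its entries. *)
Lemma orthogonal_inv F : F *m gram R *m F^T = gram R ->
  F \in unitmx /\ invmx F = gram R *m F^T *m gram R.
Proof.
move=> iF; have e : F *m (gram R *m F^T *m gram R) = 1%:M.
  by rewrite !mulmxA iF gram_mul_gram.
have [uF _] := mulmx1_unit e; split => //.
by rewrite -[RHS](mulKmx uF) e mulmx1.
Qed.

Lemma orthogonal_tr F : F *m gram R *m F^T = gram R -> F^T *m gram R *m F = gram R.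
Proof.
move=> iF; have [uF e] := orthogonal_inv iF.
have := mulVmx uF; rewrite e => h.
rewrite -[RHS]mulmx1 -h !mulmxA gram_mul_gram; congr (_ *m _ *m _).
by rewrite mul1mx.
Qed.

(** The Lie algebra of the group of matrices preserving the Gram matrix. *)
Definition skew A : Prop := A *m gram R + (A *m gram R)^T = 0.

Lemma skewE A : skew A ->
  [/\ [/\ A i0 i5 = 0, A i1 i4 = 0, A i2 i3 = 0 & A i3 i2 = 0],
      [/\ A i4 i1 = 0, A i5 i0 = 0, A i1 i5 = - A i0 i4, A i2 i5 = A i0 i3 & A i3 i5 = A i0 i2],
      [/\ A i4 i5 = - A i0 i1, A i5 i5 = - A i0 i0, A i2 i4 = A i1 i3, A i3 i4 = A i1 i2 & A i4 i4 = - A i1 i1],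
      [/\ A i3 i3 = - A i2 i2, A i4 i3 = A i2 i1, A i4 i2 = A i3 i1 & A i5 i4 = - A i1 i0] &
      [/\ A i5 i3 = A i2 i0, A i5 i2 = A i3 i0 & A i5 i1 = - A i4 i0]].
Proof.
move=> sk; have K a b (p q : R) : (A *m gram R) a b = p -> (A *m gram R) b a = q -> p + q = 0.
  by move=> <- <-; move/matrixP/(_ a b): sk; rewrite !mxE.
have nn (p q : R) : - p + - q = 0 -> q = - p by lra.
have pp (p q : R) : p + q = 0 -> q = - p by lra.
have pn (p q : R) : p + - q = 0 -> q = p by lra.
have np (p q : R) : - p + q = 0 -> q = p by lra.
have n0 (p : R) : - p + - p = 0 -> p = 0 by lra.
have p0 (p : R) : p + p = 0 -> p = 0 by lra.
have [[e00 e01 e02] e03 e04 e05] := mul_gram A i0.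
have [[e10 e11 e12] e13 e14 e15] := mul_gram A i1.
have [[e20 e21 e22] e23 e24 e25] := mul_gram A i2.
have [[e30 e31 e32] e33 e34 e35] := mul_gram A i3.
have [[e40 e41 e42] e43 e44 e45] := mul_gram A i4.
have [[e50 e51 e52] e53 e54 e55] := mul_gram A i5.
split; split.
- exact: n0 (K _ _ _ _ e00 e00).
- exact: n0 (K _ _ _ _ e11 e11).
- exact: p0 (K _ _ _ _ e22 e22).
- exact: p0 (K _ _ _ _ e33 e33).
- exact: n0 (K _ _ _ _ e44 e44).
- exact: n0 (K _ _ _ _ e55 e55).
- exact: nn (K _ _ _ _ e01 e10).
- exact: pn (K _ _ _ _ e02 e20).
- exact: pn (K _ _ _ _ e03 e30).
- exact: nn (K _ _ _ _ e04 e40).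
- exact: nn (K _ _ _ _ e05 e50).
- exact: pn (K _ _ _ _ e12 e21).
- exact: pn (K _ _ _ _ e13 e31).
- exact: nn (K _ _ _ _ e14 e41).
- exact: pp (K _ _ _ _ e23 e32).
- exact: np (K _ _ _ _ e24 e42).
- exact: np (K _ _ _ _ e34 e43).
- exact: nn (K _ _ _ _ e15 e51).
- exact: np (K _ _ _ _ e25 e52).
- exact: np (K _ _ _ _ e35 e53).
- exact: nn (K _ _ _ _ e45 e54).
Qed.

End Gram.

(** * Change of frame for the conformal connection *)

Section Gauge.
Variable R : realType.
Local Notation W := 'rV[R]_4.
Implicit Types (O : set W) (y v t : W) (w : forms R) (G : W -> 'M[R]_6).

Definition forms_smooth O w : Prop := forall v, smooth_mx O (fun y => w y v).

(** The matrix of curvature 2-forms d omega - omega /\ omega; the sign agrees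
    with the convention dA_a = omega_a^b A_b. *)
Definition curv w y v t : 'M[R]_6 :=
  dmx v (fun z => w z t) y - dmx t (fun z => w z v) y
  - (w y v *m w y t - w y t *m w y v).

Lemma frame_diffE w G y v : frame_diff w G y v = dmx v G y + G y *m w y v.
Proof. by []. Qed.

Lemma frame_forms_mul w G y v : G y \in unitmx ->
  frame_forms w G y v *m G y = dmx v G y + G y *m w y v.
Proof. by move=> uG; rewrite /frame_forms -mulmxA mulVmx // mulmx1. Qed.

Lemma frame_forms_smooth O w G : open O -> forms_smooth O w -> smooth_mx O G ->
  (forall y, O y -> G y \in unitmx) -> forms_smooth O (frame_forms w G).
Proof.
move=> oO sw sG uG v; apply: smooth_mxM => //; last exact: smooth_invmx.
by apply: smooth_mxD => //; [exact: smooth_dmx | apply: smooth_mxM].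
Qed.

(** The curvature is tensorial: the second derivatives of the frame cancel
    because they commute, and the terms of first order cancel in pairs. *)
Lemma curv_gauge O w G y v t : open O -> forms_smooth O w -> smooth_mx O G ->
  (forall y, O y -> G y \in unitmx) -> O y ->
  curv (frame_forms w G) y v t = G y *m curv w y v t *m invmx (G y).
Proof.
move=> oO sw sG uG Oy; have uGy := uG _ Oy.
set om := frame_forms w G.
have som : forms_smooth O om by exact: frame_forms_smooth.
have eq0 s z : O z -> om z s *m G z = dmx s G z + G z *m w z s.
  by move=> Oz; apply: frame_forms_mul; exact: uG.
have eq1 s r : dmx r (fun z => om z s) y *m G y + om y s *m dmx r G y
   = dmx r (dmx s G) y + (dmx r G y *m w y s + G y *m dmx r (fun z => w z s) y).
  rewrite -(dmxM _ oO (som s) sG Oy) (dmx_eq _ oO Oy (eq0 s)).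
  by rewrite (dmxD _ (smooth_dmx _ oO sG) (smooth_mxM oO sG (sw s)) Oy) (dmxM _ oO sG (sw s) Oy).
suff e : curv om y v t *m G y = G y *m curv w y v t by rewrite -e mulmxK.
have evt := eq1 t v; have etv := eq1 v t.
rewrite (dmx_comm t v oO sG Oy) in etv.
have ev := eq0 v y Oy; have et := eq0 t y Oy.
have evt2 : om y v *m om y t *m G y
    = om y v *m dmx t G y + (dmx v G y *m w y t + G y *m w y v *m w y t).
  by rewrite -mulmxA et mulmxDr mulmxA ev mulmxDl.
have etv2 : om y t *m om y v *m G y
    = om y t *m dmx v G y + (dmx t G y *m w y v + G y *m w y t *m w y v).
  by rewrite -mulmxA ev mulmxDr mulmxA et mulmxDl.
rewrite /curv !mulmxBl !mulmxBr evt2 etv2 !mulmxA.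
have comb (P Q A B S a b c d e f : 'M[R]_6) :
    P + A = S + (a + c) -> Q + B = S + (b + d) ->
    P - Q - (B + (a + e) - (A + (b + f))) = c - d - (e - f).
  move=> /(canRL (addrK _)) -> /(canRL (addrK _)) ->.
  by apply/matrixP => i j; rewrite !mxE; ring.
exact: comb evt etv.
Qed.

Lemma skew_gauge O w G y v : open O -> smooth_mx O G ->
  (forall z, O z -> G z *m gram R *m (G z)^T = gram R) ->
  skew (w y v) -> O y -> skew (frame_forms w G y v).
Proof.
move=> oO sG iG sk Oy; have [uG eG] := orthogonal_inv (iG _ Oy).
have e : frame_forms w G y v *m gram R
       = (dmx v G y + G y *m w y v) *m gram R *m (G y)^T.
  by rewrite /frame_forms eG frame_diffE -!mulmxA gram_mul_gram mulmx1.
have d0 : dmx v G y *m gram R *m (G y)^T + G y *m gram R *m (dmx v G y)^T = 0.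
  have sGg := smooth_mxM oO sG (smooth_mx_cst O (gram R)).
  have := dmx_eq v oO Oy iG.
  rewrite dmx_cst (dmxM _ oO sGg (smooth_mx_tr sG) Oy).
  by rewrite (dmxM _ oO sG (smooth_mx_cst O (gram R)) Oy) dmx_cst mulmx0 addr0 dmx_tr.
have skw : G y *m (w y v *m gram R) *m (G y)^T + G y *m (w y v *m gram R)^T *m (G y)^T = 0.
  by rewrite -mulmxDl -mulmxDr sk mulmx0 mul0mx.
rewrite /skew e !trmx_mul trmxK tr_gram linearD /= !trmx_mul.
rewrite !mulmxDl !mulmxDr addrACA !mulmxA.
rewrite trmx_mul tr_gram !mulmxA in skw.
by rewrite d0 skw addr0.
Qed.

Lemma skew_curv O w y v t : open O -> forms_smooth O w ->
  (forall z s, O z -> skew (w z s)) -> O y -> skew (curv w y v t).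
Proof.
move=> oO sw sk Oy.
have skd s r : skew (dmx r (fun z => w z s) y).
  have e0 z : O z -> w z s *m gram R + (w z s *m gram R)^T = 0 by exact: sk.
  have sg := smooth_mx_cst O (gram R).
  have := dmx_eq r oO Oy e0; rewrite dmx_cst.
  rewrite (dmxD _ (smooth_mxM oO (sw s) sg) (smooth_mx_tr (smooth_mxM oO (sw s) sg)) Oy).
  by rewrite dmx_tr (dmxM _ oO (sw s) sg Oy) dmx_cst mulmx0 addr0.
have skE (A : 'M[R]_6) : skew A <-> A *m gram R = - (gram R *m A^T).
  rewrite /skew trmx_mul tr_gram; split => [/eqP|->]; last by rewrite addNr.
  by rewrite addr_eq0 => /eqP.
have skB (A B : 'M[R]_6) : skew A -> skew B -> skew (A - B).
  rewrite !skE => sA sB.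
  by rewrite mulmxBl sA sB linearB /= mulmxBr opprB opprK addrC.
have skc (A B : 'M[R]_6) : skew A -> skew B -> skew (A *m B - B *m A).
  rewrite !skE => sA sB.
  rewrite mulmxBl -!mulmxA sA sB !mulmxN !mulmxA sA sB !mulNmx !opprK.
  by rewrite linearB /= !trmx_mul mulmxBr opprB !mulmxA.
exact: skB (skB _ _ (skd _ _) (skd _ _)) (skc _ _ (sk _ _ Oy) (sk _ _ Oy)).
Qed.

End Gauge.

(** * The tensor of conformal curvature under a change of frame *)

Section CurvatureTensor.
Variable R : realType.
Local Notation W := 'rV[R]_4.
Implicit Types (O : set W) (y v t : W) (w : forms R) (G : W -> 'M[R]_6).

Definition wedge0 w y v t (c d : 'I_6) : R :=
  wedge (fun s => w y s i0 c) (fun s => w y s i0 d) v t.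

Lemma dform_curv w a b y v t :
  dform (fun z s => w z s a b) y v t =
  curv w y v t a b
  + \sum_c wedge (fun s => w y s a c) (fun s => w y s c b) v t.
Proof. by rewrite /dform /curv /wedge sumrB !mxE subrK. Qed.

(** By skewness, the structure equations only prescribe the entries of the
    matrix of curvature 2-forms in the columns of index less than 5. *)
Lemma structure_equationsE O w C C3 :
  (forall z s, O z -> skew (w z s)) ->
  structure_equations O w C C3 <->
  forall y v t, O y ->
  [/\ forall i, tg i -> curv w y v t i0 i = 0,
      curv w y v t i0 i0 = 0,
      forall i j, tg i -> tg j -> curv w y v t j i =
        \sum_(k | tg k) \sum_(l | tg l) C y i j k l * wedge0 w y v t k l &
      forall i, tg i -> curv w y v t i i0 =
        \sum_(j | tg j) \sum_(k | tg k) C3 y i j k * wedge0 w y v t j k].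
Proof.
move=> sk; have E y v t : O y ->
    let d a b := dform (fun z s => w z s a b) y v t in
    let W a b b' a' := wedge (fun s => w y s a b) (fun s => w y s b' a') v t in
  [/\ forall i, d i0 i = curv w y v t i0 i + (W i0 i0 i0 i + \sum_(j | tg j) W i0 j j i),
      d i0 i0 = curv w y v t i0 i0 + \sum_(i | tg i) W i0 i i i0,
      forall i j, d j i = curv w y v t j i + (W j i0 i0 i + \sum_(k | tg k) W j k k i + W j i5 i5 i) &
      forall i, d i i0 = curv w y v t i i0 + (W i i0 i0 i0 + \sum_(j | tg j) W i j j i0)].
  move=> Oy d W0; rewrite /d.
  have W5 a : W0 i0 i5 i5 a = 0.
    rewrite /W0 /wedge; have [[-> _ _ _] _ _ _ _] := skewE (sk _ v Oy).
    by have [[-> _ _ _] _ _ _ _] := skewE (sk _ t Oy); rewrite !mul0r subrr.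
  have W50 a : W0 a i5 i5 i0 = 0.
    rewrite /W0 /wedge; have [_ [_ -> _ _ _] _ _ _] := skewE (sk _ v Oy).
    by have [_ [_ -> _ _ _] _ _ _] := skewE (sk _ t Oy); rewrite !mulr0 subrr.
  have W00 : W0 i0 i0 i0 i0 = 0 by rewrite /W0 /wedge mulrC subrr.
  split=> [i||i j|i]; rewrite dform_curv sum6_tg //.
  - by rewrite [wedge (fun s => w y s i0 i5) _ _ _]W5 addr0.
  - rewrite [wedge (fun s => w y s i0 i5) _ _ _]W5.
    by rewrite [wedge (fun s => w y s i0 i0) _ _ _]W00 addr0 add0r.
  - by rewrite [wedge (fun s => w y s i i5) _ _ _]W50 addr0.
split=> H y v t Oy; have [E1 E2 E3 E4] := E y v t Oy.
  have [H1 H2 H3 H4] := H y v t Oy; split.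
  - by move=> i ti; have := H1 i ti; rewrite E1 => /(canRL (addrK _)) ->; rewrite subrr.
  - by have := H2; rewrite E2 => /(canRL (addrK _)) ->; rewrite subrr.
  - by move=> i j ti tj; have := H3 i j ti tj; rewrite E3 [LHS]addrC => /addrI.
  - by move=> i ti; have := H4 i ti; rewrite E4 [LHS]addrC => /addrI.
have [H1 H2 H3 H4] := H y v t Oy; split.
- by move=> i ti; rewrite E1 H1 // add0r.
- by rewrite E2 H2 add0r.
- by move=> i j ti tj; rewrite E3 H3 // addrC.
- by move=> i ti; rewrite E4 H4 // addrC.
Qed.

(** The curvature 2-forms with lowered indices, as skew matrices [B c d] in the
    frame indices, one for each pair of coframe indices.  Unlike the tensor
    itself, these matrices change by congruence under a change of frame. *)
Definition curv_array w (B : W -> 'I_6 -> 'I_6 -> 'M[R]_6) y : Prop :=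
  forall v t, curv w y v t *m gram R =
    \sum_(c | tg c) \sum_(d | tg d) wedge0 w y v t c d *: B y c d.

(** With C_ijkl = B k l j i these are the symmetries of a Weyl tensor; the
    vanishing of the row of A_0 says that the connection has no torsion. *)
Definition weyl_array (B : 'I_6 -> 'I_6 -> 'M[R]_6) : Prop :=
  [/\ forall c d, tg c -> tg d -> (B c d)^T = - B c d /\ B d c = - B c d,
      forall c d e, tg c -> tg d -> B c d i0 e = 0,
      forall i j k l, tg i -> tg j -> tg k -> tg l ->
        B k l j i + B l j k i + B j k l i = 0,
      forall i j k l, tg i -> tg j -> tg k -> tg l -> B i j l k = B k l j i &
      forall j k, tg j -> tg k ->
        \sum_(m | tg m) \sum_(i | tg i) gram R m i * B k m j i = 0].

Lemma lowerE (C : tensor4 R) y j k l :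
  [/\ lower C y i1 j k l = - C y i4 j k l, lower C y i2 j k l = C y i3 j k l,
      lower C y i3 j k l = C y i2 j k l & lower C y i4 j k l = - C y i1 j k l].
Proof.
by split; rewrite /lower sum_tg !mxE /= !(mul0r, mul1r, mulN1r, add0r, addr0).
Qed.

(** The entries of [B c d] in the row and the column of A_5 are the C_ijk, up to
    sign; the vanishing of those in the row and the column of A_0 comes from the
    equations for d omega^i and d omega_0^0. *)
Lemma curvature_array O w C : open O -> forms_smooth O w ->
  (forall z s, O z -> skew (w z s)) -> conformal_curvature O w C ->
  exists B, forall y, O y -> weyl_array (B y) /\ curv_array w B y.
Proof.
move=> oO sw sk [wC [C3 C3s /(structure_equationsE _ _ sk) se]].
pose B y c d : 'M[R]_6 := \matrix_(a, e)
  if tg a then (if tg e then lower C y e a c d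
                else if e == i5 then - C3 y a c d else 0)
  else if (a == i5) && tg e then C3 y e c d else 0.
exists B => y Oy; split.
  have Btg c d a e : tg a -> tg e -> B y c d a e = lower C y e a c d.
    by move=> ta te; rewrite mxE ta te.
  split.
  - move=> c d tc td; split; apply/matrixP => a e; rewrite !mxE.
      case ta: (tg a); case te: (tg e); rewrite /= ?andbF ?andbT ?oppr0 //.
      + by have [-> _ _ _ _] := wC y Oy _ _ _ _ te ta tc td.
      + by case: ifP => // _; rewrite ?opprK ?oppr0.
      + by case: ifP => // _; rewrite ?opprK ?oppr0.
    case ta: (tg a); case te: (tg e); rewrite /= ?andbF ?andbT ?oppr0 //.
    + by have [_ -> _ _ _] := wC y Oy _ _ _ _ te ta tc td.
    + by case: ifP => // _; rewrite ?oppr0 // C3s.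
    + by case: ifP => // _; rewrite ?oppr0 // C3s.
  - by move=> c d e _ _; rewrite mxE.
  - by move=> i j k l ti tj tk tl; rewrite !Btg //; have [_ _ -> _ _] := wC y Oy _ _ _ _ ti tj tk tl.
  - by move=> i j k l ti tj tk tl; rewrite !Btg //; have [_ _ _ -> _] := wC y Oy _ _ _ _ ti tj tk tl.
  - move=> j k tj tk; have [_ _ _ _ tr] := wC y Oy _ _ _ _ tj tj tk tk.
    rewrite -[RHS]tr.
    apply: eq_bigr => m tm.
    transitivity (\sum_(i | tg i) gram R m i * lower C y i j k m).
      by apply: eq_bigr => i ti; rewrite Btg.
    rewrite sum_tg; have [-> -> -> ->] := lowerE C y j k m.
    by move: m tm; elim/ind6 => //= _; rewrite !mxE /= !(mul0r, mul1r, mulN1r, opprK, add0r, addr0).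
move=> v t; have [s1 s2 s3 s4] := se y v t Oy.
have sX := skew_curv v t oO sw sk Oy.
set X := curv w y v t in s1 s2 s3 s4 sX *.
have [[k05 _ _ _] _ _ _ _] := skewE sX.
pose S (f : 'I_6 -> 'I_6 -> R) := \sum_(c | tg c) \sum_(d | tg d) f c d * wedge0 w y v t c d.
have SN f : S (fun c d => - f c d) = - S f.
  rewrite /S -sumrN; apply: eq_bigr => c _; rewrite -sumrN; apply: eq_bigr => d _.
  by rewrite mulNr.
have SE f (s : R) a e : (forall c d, B y c d a e = f c d) -> s = S f ->
    s = (\sum_(c | tg c) \sum_(d | tg d) wedge0 w y v t c d *: B y c d) a e.
  move=> Bf ->; rewrite summxE; apply: eq_bigr => c _; rewrite summxE; apply: eq_bigr => d _.
  by rewrite mxE mulrC Bf.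
have S0 : 0 = S (fun _ _ => 0).
  by rewrite /S big1 // => c _; rewrite big1 // => d _; rewrite mul0r.
have K0 e : (X *m gram R) i0 e = 0.
  have [[m0 m1 m2] m3 m4 m5] := mul_gram X i0.
  by move: e; elim/ind6; rewrite ?(m0, m1, m2, m3, m4, m5) ?k05 ?s2 ?s1 // oppr0.
have KN a e : (X *m gram R) a e = - (X *m gram R) e a.
  have := congr1 (fun M : 'M[R]_6 => M a e) sX.
  by rewrite /= [LHS]mxE [RHS]mxE [(_^T) a e]mxE => /eqP; rewrite addr_eq0 => /eqP.
have Kt a e : tg a -> tg e -> (X *m gram R) a e = S (fun c d => lower C y e a c d).
  move=> ta; have [[m0 m1 m2] m3 m4 m5] := mul_gram X a.
  have L k l := lowerE C y a k l.
  have Lx (f g : 'I_6 -> 'I_6 -> R) : (forall c d, f c d = g c d) -> S g = S f.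
    by move=> fg; apply: eq_bigr => c _; apply: eq_bigr => d _; rewrite fg.
  move: e; elim/ind6 => // _; rewrite ?(m1, m2, m3, m4) s3 // -/(S _) -?SN;
    by apply: Lx => c d; have [] := L c d.
have K5 a : tg a -> (X *m gram R) a i5 = S (fun c d => - C3 y a c d).
  by move=> ta; have [_ _ _ ->] := mul_gram X a; rewrite s4 // SN.
have cov a : [\/ a = i0, tg a | a = i5].
  by move: a; elim/ind6; by [constructor 1 | constructor 2 | constructor 3].
apply/matrixP => a e.
case: (cov a) => [->|ta|->]; last first.
- case: (cov e) => [->|te|->].
  + by apply: SE (_ : _ = S (fun _ _ => 0)); [move=> c d; rewrite mxE | rewrite KN K0 oppr0].
  + apply: SE (_ : _ = S (fun c d => C3 y e c d)) => [c d|]; first by rewrite mxE /= te.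
    by rewrite KN K5 // SN opprK.
  + apply: SE (_ : _ = S (fun _ _ => 0)); [by move=> c d; rewrite mxE|].
    by rewrite -S0; have [_ _ _ ->] := mul_gram X i5; have [_ [_ -> _ _ _] _ _ _] := skewE sX; rewrite oppr0.
- case: (cov e) => [->|te|->].
  + by apply: SE (_ : _ = S (fun _ _ => 0)); [move=> c d; rewrite mxE ta | rewrite KN K0 oppr0].
  + by apply: SE (Kt a e ta te) => c d; rewrite mxE ta te.
  + by apply: SE (K5 a ta) => c d; rewrite mxE ta.
- by apply: SE (_ : _ = S (fun _ _ => 0)); [move=> c d; rewrite mxE | rewrite K0].
Qed.

End CurvatureTensor.

Section CurvatureGauge.
Variable R : realType.
Local Notation W := 'rV[R]_4.
Implicit Types (O : set W) (y v t : W) (w : forms R) (G : W -> 'M[R]_6).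

Definition array_tensor (B : W -> 'I_6 -> 'I_6 -> 'M[R]_6) : tensor4 R :=
  fun y m j k l => \sum_(i | tg i) gram R m i * B y k l j i.

Lemma array_tensorE B y j k l :
  [/\ array_tensor B y i1 j k l = - B y k l j i4, array_tensor B y i2 j k l = B y k l j i3,
      array_tensor B y i3 j k l = B y k l j i2 & array_tensor B y i4 j k l = - B y k l j i1].
Proof.
by split; rewrite /array_tensor sum_tg !mxE /= !(mul0r, mul1r, mulN1r, add0r, addr0).
Qed.

Lemma lower_array_tensor B y i j k l : tg i ->
  lower (array_tensor B) y i j k l = B y k l j i.
Proof.
have [e1 e2 e3 e4] := lowerE (array_tensor B) y j k l.
have [a1 a2 a3 a4] := array_tensorE B y j k l.
by move: i; elim/ind6 => // _; rewrite ?(e1, e2, e3, e4) ?(a1, a2, a3, a4) ?opprK.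
Qed.

Lemma conformal_curvature_array O w B :
  (forall z s, O z -> skew (w z s)) ->
  (forall y, O y -> weyl_array (B y) /\ curv_array w B y) ->
  conformal_curvature O w (array_tensor B).
Proof.
move=> sk HB; split.
  move=> y Oy i j k l ti tj tk tl; have [[w1 w2 w3 w4 w5] _] := HB y Oy.
  rewrite !lower_array_tensor //; split.
  - by have [/matrixP/(_ j i)] := w1 k l tk tl; rewrite !mxE.
  - by have [_ ->] := w1 k l tk tl; rewrite mxE.
  - exact: w3.
  - exact: w4.
  - exact: w5.
exists (fun y i j k => if tg j && tg k then - B y j k i i5 else 0).
  move=> y i j k Oy; rewrite andbC; case: ifP => [/andP[tj tk]|]; rewrite ?oppr0 //.
  by have [[w1 _ _ _ _] _] := HB y Oy; have [_ ->] := w1 j k tj tk; rewrite mxE.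
apply/(structure_equationsE _ _ sk) => y v t Oy.
have [[w1 w2 w3 w4 w5] cB] := HB y Oy.
set X := curv w y v t.
pose S (f : 'I_6 -> 'I_6 -> R) := \sum_(c | tg c) \sum_(d | tg d) f c d * wedge0 w y v t c d.
have SN f : S (fun c d => - f c d) = - S f.
  rewrite /S -sumrN; apply: eq_bigr => c _; rewrite -sumrN; apply: eq_bigr => d _.
  by rewrite mulNr.
have KE a e : (X *m gram R) a e = S (fun c d => B y c d a e).
  rewrite cB summxE; apply: eq_bigr => c _; rewrite summxE; apply: eq_bigr => d _.
  by rewrite mxE mulrC.
have Lx (f g : 'I_6 -> 'I_6 -> R) :
    (forall c d, tg c -> tg d -> f c d = g c d) -> S f = S g.
  by move=> fg; apply: eq_bigr => c tc; apply: eq_bigr => d td; rewrite fg.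
have XE a : [/\ [/\ X a i0 = - S (fun c d => B y c d a i5), X a i1 = - S (fun c d => B y c d a i4) &
          X a i2 = S (fun c d => B y c d a i3)],
      X a i3 = S (fun c d => B y c d a i2), X a i4 = - S (fun c d => B y c d a i1) &
      X a i5 = - S (fun c d => B y c d a i0)].
  have -> : X = X *m gram R *m gram R by rewrite -mulmxA gram_mul_gram mulmx1.
  by rewrite -!KE; exact: mul_gram.
have S0 e : S (fun c d => B y c d i0 e) = 0.
  by rewrite /S big1 // => c tc; rewrite big1 // => d td; rewrite w2 // mul0r.
split.
- have [[_ e1 e2] e3 e4 _] := XE i0.
  by elim/ind6 => // _; rewrite ?(e1, e2, e3, e4) S0 ?oppr0.
- by have [[-> _ _] _ _ _] := XE i0; rewrite S0 oppr0.
- move=> i j ti tj; rewrite -/(S (fun k l => array_tensor B y i j k l)).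
  have [[_ e1 e2] e3 e4 _] := XE j; move: i ti; elim/ind6 => // _;
    rewrite ?(e1, e2, e3, e4) -?SN; apply: Lx => c d _ _;
    by have [] := array_tensorE B y j c d.
- move=> i ti; have [[-> _ _] _ _ _] := XE i; rewrite -SN.
  by apply: (Lx _ (fun c d => if tg c && tg d then - B y c d i i5 else 0)) => c d -> ->.
Qed.

(** Congruence in the frame indices, substitution of the coframe in the two
    others; the denominator is there because A_0, hence the coframe, is rescaled
    by G_00. *)
Definition gauge_array (G : 'M[R]_6) (B : 'I_6 -> 'I_6 -> 'M[R]_6) k l : 'M[R]_6 :=
  \sum_(c | tg c) \sum_(d | tg d)
    (G k c * G l d / G i0 i0 ^+ 2) *: (G *m B c d *m G^T).

Lemma isotropic_frame_tg (G : 'M[R]_6) : isotropic_frame G ->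
  [/\ G i0 i0 != 0, forall j, tg j -> G j i5 = 0 & G i0 i0 * G i5 i5 = 1].
Proof.
move=> [iG G0].
have E a : - (G i0 i0 * G a i5) = gram R i0 a.
  rewrite -iG -mulmxA mxE sum6 !(G0 i1, G0 i2, G0 i3, G0 i4, G0 i5) //.
  rewrite !mul0r !addr0; have [[-> _ _] _ _ _] := gram_mul G^T a.
  by rewrite mxE mulrN.
have e5 : G i0 i0 * G i5 i5 = 1.
  by have /eqP := E i5; rewrite mxE /= eqr_oppLR opprK => /eqP.
have G00 : G i0 i0 != 0.
  by apply/eqP => g0; move: e5; rewrite g0 mul0r => /eqP; rewrite eq_sym oner_eq0.
split => // j tj; apply: (mulfI G00); apply: oppr_inj; rewrite E mulr0 oppr0.
by move: j tj; elim/ind6 => // _; rewrite mxE.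
Qed.

Lemma sum_pairs (F : 'I_6 -> 'I_6 -> 'I_6 -> 'I_6 -> R) :
  \sum_(a | tg a) \sum_(b | tg b) \sum_(c | tg c) \sum_(d | tg d) F a b c d =
  \sum_(c | tg c) \sum_(d | tg d) \sum_(a | tg a) \sum_(b | tg b) F a b c d.
Proof.
transitivity (\sum_(a | tg a) \sum_(c | tg c) \sum_(d | tg d) \sum_(b | tg b) F a b c d).
  apply: eq_bigr => a _; rewrite exchange_big; apply: eq_bigr => c _; exact: exchange_big.
by rewrite exchange_big; apply: eq_bigr => c _; exact: exchange_big.
Qed.

Lemma gauge_arrayE (G : 'M[R]_6) B k l j i : isotropic_frame G -> weyl_array B ->
  tg i -> tg j ->
  gauge_array G B k l j i =
  \sum_(c | tg c) \sum_(d | tg d) \sum_(a | tg a) \sum_(e | tg e)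
    G k c * G l d * G j a * G i e / G i0 i0 ^+ 2 * B c d a e.
Proof.
move=> iG [w1 w2 _ _ _] ti tj; have [G00 G5 _] := isotropic_frame_tg iG.
rewrite summxE; apply: eq_bigr => c tc; rewrite summxE; apply: eq_bigr => d td.
have w2' e : B c d e i0 = 0.
  have [/matrixP/(_ e i0)] := w1 c d tc td; rewrite !mxE w2 // => /eqP.
  by rewrite eq_sym oppr_eq0 => /eqP.
rewrite mxE -mulmxA mxE sum6_tg G5 // mul0r addr0.
have -> : (B c d *m G^T) i0 i = 0.
  by rewrite mxE big1 // => e _; rewrite w2 // mul0r.
rewrite mulr0 add0r mulr_sumr; apply: eq_bigr => a ta.
rewrite mxE sum6_tg w2' mul0r add0r [_^T i5 i]mxE G5 // mulr0 addr0 mulr_sumr mulr_sumr.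
by apply: eq_bigr => e te; rewrite [_^T e i]mxE; ring.
Qed.

Lemma sum_rot (F : 'I_6 -> 'I_6 -> 'I_6 -> R) :
  \sum_(a | tg a) \sum_(b | tg b) \sum_(c | tg c) F a b c =
  \sum_(c | tg c) \sum_(a | tg a) \sum_(b | tg b) F a b c.
Proof.
by rewrite [RHS]exchange_big; apply: eq_bigr => a _; rewrite exchange_big.
Qed.

Lemma orthogonal_tg (G : 'M[R]_6) d e : isotropic_frame G -> tg d -> tg e ->
  \sum_(m | tg m) \sum_(i | tg i) gram R m i * (G m d * G i e) = gram R d e.
Proof.
move=> [iG G0] td te.
have G0t a : tg a -> G i0 a = 0.
  by move=> ta; apply: G0; move: ta; apply: contraL => /eqP ->.
transitivity ((G^T *m (gram R *m G)) d e); last by rewrite mulmxA orthogonal_tr.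
rewrite mxE sum6_tg [_^T d i0]mxE G0t // mul0r add0r.
have [_ _ _ ->] := gram_mul G e; rewrite G0t // oppr0 mulr0 addr0.
apply: eq_bigr => m tm; rewrite [(_ *m _) m e]mxE sum6_tg G0t // mulr0 add0r.
have -> : gram R m i5 = 0 by move: m tm; elim/ind6 => // _; rewrite mxE.
rewrite mul0r addr0 mulr_sumr; apply: eq_bigr => i ti.
by rewrite [_^T d m]mxE; ring.
Qed.

Lemma weyl_array_gauge (G : 'M[R]_6) B : isotropic_frame G -> weyl_array B ->
  weyl_array (gauge_array G B).
Proof.
move=> iG wB; have E k l j i := gauge_arrayE k l iG wB (i := i) (j := j).
have [G00 G5 _] := isotropic_frame_tg iG.
have [w1 w2 w3 w4 w5] := wB.
split.
- move=> c d tc td; split.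
    rewrite /gauge_array linear_sum -sumrN; apply: eq_bigr => k tk.
    rewrite linear_sum -sumrN; apply: eq_bigr => l tl /=.
    have [wT _] := w1 k l tk tl.
    by rewrite linearZ /= !trmx_mul trmxK wT mulNmx mulmxN scalerN mulmxA.
  rewrite /gauge_array exchange_big -sumrN; apply: eq_bigr => k tk.
  rewrite -sumrN; apply: eq_bigr => l tl /=.
  by have [_ ->] := w1 k l tk tl; rewrite mulmxN mulNmx scalerN (mulrC (G d l)).
- move=> k l e tk tl; rewrite summxE big1 // => c tc; rewrite summxE big1 // => d td.
  rewrite mxE -mulmxA mxE sum6_tg; case: iG => _ G0.
  rewrite (G0 i5) // mul0r addr0 (big1 _ _ (fun i => G i0 i * _ i e)) ?addr0; last first.
    by move=> i ti; rewrite G0 ?mul0r //; move: ti; apply: contraL => /eqP ->.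
  rewrite [(_ *m _) i0 e]mxE (big1 _ predT) ?mulr0 // => i _.
  by rewrite w2 // mul0r.
- move=> i j k l ti tj tk tl; rewrite !E //.
  rewrite [X in _ + X + _]sum_rot [X in _ + _ + X]sum_rot [X in _ + _ + X]sum_rot.
  rewrite -!big_split /= big1 // => c tc; rewrite -!big_split /= big1 // => d td.
  rewrite -!big_split /= big1 // => a ta; rewrite -!big_split /= big1 // => e te.
  have := w3 e a c d te ta tc td => h.
  by transitivity (G k c * G l d * G j a * G i e / G i0 i0 ^+ 2
     * (B c d a e + B d a c e + B a c d e)); [ring | rewrite h mulr0].
- move=> i j k l ti tj tk tl; rewrite !E // sum_pairs exchange_big.
  apply: eq_bigr => c tc; apply: eq_bigr => d td; rewrite exchange_big.
  apply: eq_bigr => a ta; apply: eq_bigr => e te.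
  by rewrite (w4 e a c d) //; ring.
- move=> j k tj tk.
  pose F m i c d a e := G k c * G j a / G i0 i0 ^+ 2 * B c d a e
                        * (gram R m i * (G m d * G i e)).
  transitivity (\sum_(m | tg m) \sum_(i | tg i) \sum_(c | tg c) \sum_(d | tg d)
                \sum_(a | tg a) \sum_(e | tg e) F m i c d a e).
    apply: eq_bigr => m tm; apply: eq_bigr => i ti; rewrite E //.
    do 4!(rewrite mulr_sumr; apply: eq_bigr => ? _).
    by rewrite /F; ring.
  rewrite sum_pairs big1 // => c tc.
  transitivity (\sum_(d | tg d) \sum_(a | tg a) \sum_(e | tg e)
     G k c * G j a / G i0 i0 ^+ 2 * (gram R d e * B c d a e)).
    apply: eq_bigr => d td; rewrite sum_pairs.
    apply: eq_bigr => a ta; apply: eq_bigr => e te.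
    rewrite -(orthogonal_tg iG td te) mulr_suml mulr_sumr; apply: eq_bigr => m tm.
    rewrite mulr_suml mulr_sumr; apply: eq_bigr => i ti.
    by rewrite /F; ring.
  rewrite exchange_big big1 // => a ta.
  under eq_bigr => d td do rewrite -mulr_sumr.
  by rewrite -mulr_sumr w5 // mulr0.
Qed.

(** This is dA'_0 = G_00 dA_0 modulo A_0, expanded in both frames. *)
Lemma coframe_gauge O w G y v c : open O -> smooth_mx O G ->
  (forall z, O z -> isotropic_frame (G z)) -> (forall z s, O z -> skew (w z s)) ->
  O y -> tg c ->
  w y v i0 c = (G y i0 i0)^-1 * \sum_(k | tg k) frame_forms w G y v i0 k * G y k c.
Proof.
move=> oO sG iG sk Oy tc; have [G00 _ _] := isotropic_frame_tg (iG _ Oy).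
have iG' z : O z -> G z *m gram R *m (G z)^T = gram R by move=> /iG [].
have [uG _] := orthogonal_inv (iG' _ Oy).
have c0 : c != i0 by move: tc; apply: contraL => /eqP ->.
have G0 z a : O z -> a != i0 -> G z i0 a = 0 by move=> /iG [_]; apply.
have := congr1 (fun A : 'M[R]_6 => A i0 c) (frame_forms_mul w v uG).
have -> : (dmx v G y + G y *m w y v) i0 c = G y i0 i0 * w y v i0 c.
  rewrite mxE mxE (@near_eq_derive _ _ _ _ (cst 0)); last first.
    by apply: (near_open oO Oy) => z Oz; rewrite G0.
  rewrite derive_cst add0r mxE (bigD1 i0) //= big1 ?addr0 // => a a0.
  by rewrite G0 // mul0r.
have sko := skew_gauge oO sG iG' (sk _ v Oy) Oy.
have [[z05 _ _ _] _ _ _ _] := skewE sko.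
by rewrite /= mxE sum6_tg z05 mul0r addr0 (G0 y c) // mulr0 add0r => ->; rewrite mulKf.
Qed.

(** The normalization of the connection is a condition on its curvature, which
    is tensorial; hence it does not depend on the frame field. *)
Lemma conformal_curvature_gauge O w G C : open O -> forms_smooth O w ->
  (forall z s, O z -> skew (w z s)) -> smooth_mx O G ->
  (forall z, O z -> isotropic_frame (G z)) -> conformal_curvature O w C ->
  exists C', conformal_curvature O (frame_forms w G) C'.
Proof.
move=> oO sw sk sG iG /(curvature_array oO sw sk)[B HB].
have iG' z : O z -> G z *m gram R *m (G z)^T = gram R by move=> /iG [].
have uG z : O z -> G z \in unitmx by move=> /iG' /orthogonal_inv [].
exists (array_tensor (fun y => gauge_array (G y) (B y))).
apply: conformal_curvature_array.
  by move=> z s Oz; exact: (skew_gauge oO sG iG' (sk _ s Oz) Oz).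
move=> y Oy; have [wB cB] := HB y Oy; split; first exact: weyl_array_gauge (iG _ Oy) wB.
move=> v t; rewrite (curv_gauge v t oO sw sG uG Oy).
have [_ ->] := orthogonal_inv (iG' _ Oy).
rewrite -!mulmxA gram_mul_gram mulmx1 !mulmxA -(mulmxA (G y)) cB.
set om := frame_forms w G.
have wE c d : tg c -> tg d -> wedge0 w y v t c d =
    \sum_(k | tg k) \sum_(l | tg l)
      G y k c * G y l d / G y i0 i0 ^+ 2 * wedge0 om y v t k l.
  move=> tc td; rewrite /wedge0 /wedge !(coframe_gauge _ oO sG iG sk Oy) // -/om.
  set g := (G y i0 i0)^-1.
  have dist (f h : 'I_6 -> R) : g * (\sum_(k | tg k) f k) * (g * \sum_(l | tg l) h l)
      = \sum_(k | tg k) \sum_(l | tg l) g * g * (f k * h l).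
    rewrite mulrACA big_distrlr /= mulr_sumr; apply: eq_bigr => k _.
    by rewrite mulr_sumr.
  rewrite !dist -sumrB; apply: eq_bigr => k tk.
  rewrite -sumrB; apply: eq_bigr => l tl.
  by rewrite -exprVn -/g; ring.
transitivity (\sum_(c | tg c) \sum_(d | tg d) \sum_(k | tg k) \sum_(l | tg l)
   wedge0 om y v t k l *: ((G y k c * G y l d / G y i0 i0 ^+ 2)
      *: (G y *m B y c d *m (G y)^T))).
  rewrite mulmx_sumr mulmx_suml; apply: eq_bigr => c tc.
  rewrite mulmx_sumr mulmx_suml; apply: eq_bigr => d td.
  rewrite wE // -scalemxAr -scalemxAl scaler_suml; apply: eq_bigr => k tk.
  by rewrite scaler_suml; apply: eq_bigr => l tl; rewrite scalerA mulrC.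
apply/matrixP => a e; rewrite !summxE.
transitivity (\sum_(c | tg c) \sum_(d | tg d) \sum_(k | tg k) \sum_(l | tg l)
   (wedge0 om y v t k l *: ((G y k c * G y l d / G y i0 i0 ^+ 2)
      *: (G y *m B y c d *m (G y)^T))) a e).
  by do 4!(apply: eq_bigr => ? _; rewrite ?summxE).
rewrite sum_pairs; apply: eq_bigr => k tk; rewrite summxE; apply: eq_bigr => l tl.
rewrite /gauge_array [RHS]mxE !summxE mulr_sumr; apply: eq_bigr => c tc.
by rewrite !summxE mulr_sumr; apply: eq_bigr => d td; rewrite mxE.
Qed.

End CurvatureGauge.

(** * Coframes and tangent vectors of the hypersurface *)

Section Coframes.
Variable R : realType.
Local Notation W := 'rV[R]_4.
Implicit Types (O : set W) (y v t : W) (w om : forms R) (G : W -> 'M[R]_6).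

(** What is used of the connection forms of a frame field: besides smoothness,
    linearity and skewness, that omega^1, ..., omega^4 form a coframe. *)
Record connection_forms O om : Prop := ConnectionForms {
  cf_open : open O;
  cf_smooth : forms_smooth O om;
  cf_skew : forall y v, O y -> skew (om y v);
  cf_linear : forall y, O y -> linear (om y);
  cf_coframe : forall y v, O y -> (forall i, tg i -> om y v i0 i = 0) -> v = 0 }.

Lemma signature22_nondegenerate (g : 'M[R]_4) v : signature22 g ->
  (forall t, bilin g v t = 0) -> v = 0.
Proof.
move=> [P uP eP] bv.
have ug : g \in unitmx.
  have : P *m g *m P^T \in unitmx.
    rewrite eP unitmxE det_diag unitfE; apply/prodf_neq0 => i _.
    by rewrite mxE; case: ifP => _; rewrite ?oppr_eq0 oner_eq0.
  by rewrite !unitmx_mul => /andP[/andP[]].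
have vg : v *m g = 0.
  apply/matrixP => a j; rewrite (ord1 a) [RHS]mxE -(bv (delta_mx 0 j)) /bilin.
  by rewrite trmx_delta -colE [RHS]mxE.
by rewrite -(mulmxK ug v) vg mul0mx.
Qed.

Lemma conformal_structure_inhabited (M : manifold4 R) (c : set (tensor2 M)) :
  conformal_structure22 c -> exists2 g, c g & is_metric22 g.
Proof.
move=> [g mg ->]; exists g => //; split => //; exists (fun=> 1); first by move=> x; exact: ltr01.
by move=> u au y uy; rewrite scale1r.
Qed.

Lemma reference_connection_forms (M : manifold4 R) (c : set (tensor2 M))
    (u : chart R M) O w :
  conformal_structure22 c -> atlas u -> reference_frame c u O w ->
  connection_forms O w.
Proof.
move=> hc au [[oO sO lw sw] sk gc _]; split => //.
- move=> y v Oy w0; have [g cg [mg _]] := conformal_structure_inhabited hc.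
  have [_ /(_ y (sO _ Oy)) [_ sg]] := mg u au.
  have [s s0 e] := gc g y cg Oy.
  apply: (signature22_nondegenerate sg) => t.
  have := e v t; rewrite !w0 // !mul0r !subr0 addr0 => /esym/eqP.
  by rewrite mulf_eq0 gt_eqF //= => /eqP.
Qed.

Lemma connection_forms_sub O O' om : open O' -> O' `<=` O ->
  connection_forms O om -> connection_forms O' om.
Proof.
move=> oO' sO [oO sm sk li co]; split => //.
- by move=> v; apply: smooth_mx_sub (sm v).
- by move=> y v /sO; exact: sk.
- by move=> y /sO; exact: li.
- by move=> y v /sO; exact: co.
Qed.

Lemma connection_forms_gauge O w G : connection_forms O w -> smooth_mx O G ->
  (forall z, O z -> isotropic_frame (G z)) ->
  connection_forms O (frame_forms w G).
Proof.
move=> [oO sm sk li co] sG iG.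
have iG' z : O z -> G z *m gram R *m (G z)^T = gram R by move=> /iG [].
have uG z : O z -> G z \in unitmx by move=> /iG' /orthogonal_inv [].
split => //.
- exact: frame_forms_smooth.
- by move=> y v Oy; exact: (skew_gauge oO sG iG' (sk _ v Oy) Oy).
- move=> y Oy a v t; rewrite /frame_forms !frame_diffE (dmx_linear _ _ _ sG Oy) li //.
  rewrite mulmxDr -scalemxAr addrACA -scalerDr mulmxDl -scalemxAl.
  by [].
- move=> y v Oy w0; apply: (co y v Oy) => i ti.
  rewrite (coframe_gauge _ oO sG iG sk Oy ti) big1 ?mulr0 // => k tk.
  by rewrite w0 // mul0r.
Qed.

Definition tgi (i : 'I_4) : 'I_6 := inord i.+1.

Definition j1 : 'I_4 := @Ordinal 4 0 isT.
Definition j2 : 'I_4 := @Ordinal 4 1 isT.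
Definition j3 : 'I_4 := @Ordinal 4 2 isT.
Definition j4 : 'I_4 := @Ordinal 4 3 isT.

Lemma tgiE : [/\ tgi j1 = i1, tgi j2 = i2, tgi j3 = i3 & tgi j4 = i4].
Proof. by split; apply: val_inj; rewrite /= inordK. Qed.

Lemma sum4 (V : nmodType) (f : 'I_4 -> V) : \sum_i f i = f j1 + (f j2 + (f j3 + f j4)).
Proof.
rewrite !big_ord_recl big_ord0 addr0.
by do !congr (_ + _); congr f; apply: val_inj.
Qed.

Definition coframe om y : 'M[R]_4 :=
  \matrix_(j, i) om y (delta_mx 0 j) i0 (tgi i).

Definition dualv om y (i : 'I_4) : W := row i (invmx (coframe om y)).

Lemma linear_coord m n (f : W -> 'M[R]_(m, n)) v : linear f ->
  f v = \sum_j v 0 j *: f (delta_mx 0 j).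
Proof.
move=> lf; pose F : {linear W -> 'M[R]_(m, n)} := HB.pack f (GRing.isLinear.Build _ _ _ _ f lf).
rewrite -[f]/(F : _ -> _) {1}[v]row_sum_delta linear_sum.
by apply: eq_bigr => j _; rewrite linearZ.
Qed.

Lemma mul_coframe om y v : linear (om y) ->
  v *m coframe om y = \row_i om y v i0 (tgi i).
Proof.
move=> lo; apply/rowP => i; rewrite !mxE (linear_coord v lo) summxE.
by apply: eq_bigr => j _; rewrite !mxE.
Qed.

Section Dual.
Variables (O : set W) (om : forms R).
Hypothesis cf : connection_forms O om.

Lemma coframe_unit y : O y -> coframe om y \in unitmx.
Proof.
move=> Oy; rewrite -row_free_unit -kermx_eq0; apply/rowV0P => v.
move=> /sub_kermxP; rewrite mul_coframe; last exact: cf_linear cf _ Oy.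
move=> e; apply: (cf_coframe cf Oy) => i ti.
have [e1 e2 e3 e4] := tgiE.
have E j : om y v i0 (tgi j) = 0 by move/rowP/(_ j): e; rewrite !mxE.
by move: i ti; elim/ind6 => // _; rewrite -?(e1, e2, e3, e4) E.
Qed.

Lemma dualvE y i j : O y -> om y (dualv om y i) i0 (tgi j) = (i == j)%:R.
Proof.
move=> Oy; have := mul_coframe (dualv om y i) (cf_linear cf Oy).
move=> /rowP/(_ j); rewrite [RHS]mxE => <-.
rewrite /dualv -row_mul mulVmx; last exact: coframe_unit.
by rewrite row1 mxE eqxx /= eq_sym.
Qed.

Lemma dual_values y : O y ->
  [/\ [/\ om y (dualv om y j1) i0 i1 = 1, om y (dualv om y j1) i0 i2 = 0
        & om y (dualv om y j1) i0 i3 = 0],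
      [/\ om y (dualv om y j2) i0 i1 = 0, om y (dualv om y j2) i0 i2 = 1
        & om y (dualv om y j2) i0 i3 = 0] &
      [/\ om y (dualv om y j3) i0 i1 = 0, om y (dualv om y j3) i0 i2 = 0
        & om y (dualv om y j3) i0 i3 = 1]].
Proof.
move=> Oy; have [e1 e2 e3 _] := tgiE.
have D i j k : tgi j = k -> om y (dualv om y i) i0 k = (i == j)%:R.
  by move=> <-; exact: dualvE.
have [k1 k2 k3] := And3 (fun i => D i _ _ e1) (fun i => D i _ _ e2) (fun i => D i _ _ e3).
by split; split; rewrite (k1, k2, k3).
Qed.

Lemma smooth_dualv i : smooth_mx O (fun y => dualv om y i).
Proof.
have oO := cf_open cf.
have sc : smooth_mx O (coframe om).
  move=> j k; apply: (smooth_eq oO _ (cf_smooth cf (delta_mx 0 j) i0 (tgi k))).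
  by move=> z _; rewrite mxE.
have si := smooth_invmx oO sc coframe_unit.
move=> a b; apply: (smooth_eq oO _ (si i b)) => z _.
by rewrite mxE.
Qed.

Lemma smooth_contract (X : W -> W) : smooth_mx O X ->
  smooth_mx O (fun y => om y (X y)).
Proof.
move=> sX a b; have oO := cf_open cf.
apply: (@smooth_eq _ _ _ (fun y => \sum_j X y 0 j * om y (delta_mx 0 j) a b)) => //.
  move=> z Oz; rewrite (linear_coord (X z) (cf_linear cf Oz)) summxE.
  by apply: eq_bigr => j _; rewrite mxE.
apply: smooth_sum => // j _; apply: (smoothM oO (sX 0 j)); exact: (cf_smooth cf).
Qed.

Lemma smooth_derive_along (f : W -> R^o) (X : W -> W) : smooth_on O f ->
  smooth_mx O X -> smooth_on O (fun y => 'D_(X y) f y).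
Proof.
move=> sf sX; have oO := cf_open cf.
apply: (@smooth_eq _ _ _ (fun y => \sum_j X y 0 j * 'D_(delta_mx 0 j) f y)) => //.
  move=> z Oz; have df := smooth_differentiable sf Oz.
  rewrite deriveE // {2}[X z]row_sum_delta linear_sum.
  by apply: eq_bigr => j _; rewrite linearZ deriveE.
apply: smooth_sum => // j _; apply: (smoothM oO (sX 0 j)); exact: smooth_derive.
Qed.

Lemma coframe_expand y v : O y ->
  v = om y v i0 i1 *: dualv om y j1 + om y v i0 i2 *: dualv om y j2
    + om y v i0 i3 *: dualv om y j3 + om y v i0 i4 *: dualv om y j4.
Proof.
move=> Oy; have [e1 e2 e3 e4] := tgiE.
rewrite -[LHS](mulmxK (coframe_unit Oy)) (mul_coframe v (cf_linear cf Oy)).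
rewrite mulmx_sum_row sum4 !mxE e1 e2 e3 e4 !addrA.
by [].
Qed.

(** The kernel of omega^4 and the tangent hyperplane have the same dimension. *)
Lemma tangent_dualv y : O y -> (forall v, tangentV v -> om y v i0 i4 = 0) ->
  forall v, om y v i0 i4 = 0 -> tangentV v.
Proof.
move=> Oy t4 v v4; have [e1 e2 e3 e4] := tgiE.
set f := dualv om y j4.
have f4 : om y f i0 i4 = 1 by rewrite -e4 dualvE.
have f_nt : f 0 ord_max != 0.
  by apply/eqP => ft; have := t4 f ft; rewrite f4 => /eqP; rewrite oner_eq0.
clearbody f; pose r := v 0 ord_max / f 0 ord_max.
have : tangentV ((- r) *: f + v).
  by rewrite /tangentV /= !mxE mulNr /r divfK // addNr.
move=> /t4; rewrite (cf_linear cf Oy) mxE mxE f4 v4 mulr1 addr0 => /eqP.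
rewrite oppr_eq0 /r mulf_eq0 invr_eq0 (negbTE f_nt) orbF => /eqP.
by [].
Qed.

End Dual.

(** A difference quotient along the hyperplane only involves points of it. *)
Lemma derive_tangent O (f g : W -> R^o) y v : open O -> O y ->
  y 0 ord_max = 0 -> tangentV v ->
  (forall z, O z -> z 0 ord_max = 0 -> f z = g z) -> 'D_v f y = 'D_v g y.
Proof.
move=> oO Oy y0 v0 fg; rewrite /derive; congr (lim _).
have nO : \forall h \near (0 : R), O (h *: v + y).
  have c : (fun h : R => h *: v + y) @ 0 --> y.
    rewrite -[X in _ --> X]add0r -(scale0r v).
    by apply: cvgD; [exact: scalel_continuous | exact: cvg_cst].
  exact: c _ (open_nbhs_nbhs (conj oO Oy)).
have E : \forall h \near (0 : R), h^-1 *: ((f \o shift y) (h *: v) - f y)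
    = h^-1 *: ((g \o shift y) (h *: v) - g y).
  apply: filterS nO => h Oh; rewrite /= !fg //.
  by rewrite !mxE v0 mulr0 add0r.
rewrite eqEsubset; split; apply/near_eq_cvg/cvg_within => //.
by apply: filterS E => h ->.
Qed.

End Coframes.

(** * The third-order quantities of a second-order frame field *)

Section Cartan.
Variable R : realType.
Local Notation W := 'rV[R]_4.
Implicit Types (O : set W) (y v t : W) (w om : forms R).

Lemma slice_trace (M : manifold4 R) (V : set M) (u : chart R M) z :
  slice_chart V u -> cimg u z -> V (cinv u z) <-> z 0 ord_max = 0.
Proof.
move=> [au sV] [x ux <-]; have [_ _ K _ _] := atlas_chart au.
by rewrite K //; exact: sV.
Qed.

(** Consequences of tracefreeness, for the components of the Weyl tensor that
    occur in d omega_1^3 and d omega_1^2 along a lightlike hypersurface. *)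
Lemma weyl_components (C : tensor4 R) y : weyl_symmetries C y ->
  let L := lower C y in
  [/\ L i1 i2 i1 i3 = 0, L i1 i2 i2 i3 = - L i1 i2 i1 i4,
      L i1 i3 i1 i2 = 0 & L i1 i3 i2 i3 = L i1 i3 i1 i4].
Proof.
move=> wC L.
have S1 i j k l : tg i -> tg j -> tg k -> tg l -> L j i k l = - L i j k l.
  by move=> ti tj tk tl; have [] := wC i j k l ti tj tk tl.
have S2 i j k l : tg i -> tg j -> tg k -> tg l -> L i j l k = - L i j k l.
  by move=> ti tj tk tl; have [] := wC i j k l ti tj tk tl.
have S3 i j k l : tg i -> tg j -> tg k -> tg l -> L k l i j = L i j k l.
  by move=> ti tj tk tl; have [] := wC i j k l ti tj tk tl.
have T j k : tg j -> tg k -> - L i4 j k i1 + L i3 j k i2 + L i2 j k i3 - L i1 j k i4 = 0.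
  move=> tj tk; have [_ _ _ _] := wC j j k k tj tj tk tk; rewrite sum_tg.
  rewrite /L; have [_ _ _ ->] := lowerE C y j k i1; have [_ _ -> _] := lowerE C y j k i2.
  by have [_ -> _ _] := lowerE C y j k i3; have [-> _ _ _] := lowerE C y j k i4; lra.
have t11 := T i1 i1 isT isT; have t21 := T i2 i1 isT isT; have t31 := T i3 i1 isT isT.
have a1 := S2 i4 i1 i1 i1 isT isT isT isT.
have a2 := S1 i1 i1 i1 i4 isT isT isT isT.
have a3 := S1 i1 i3 i1 i2 isT isT isT isT.
have a4 := S1 i1 i2 i1 i3 isT isT isT isT.
have a5 := S3 i1 i2 i1 i3 isT isT isT isT.
have a6 := S2 i4 i2 i1 i1 isT isT isT isT.
have a7 := S1 i2 i2 i1 i3 isT isT isT isT.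
have a8 := S1 i2 i3 i1 i2 isT isT isT isT.
have a9 := S3 i2 i3 i1 i2 isT isT isT isT.
have c1 := S2 i4 i3 i1 i1 isT isT isT isT.
have c2 := S1 i3 i3 i1 i2 isT isT isT isT.
have c3 := S3 i2 i3 i1 i3 isT isT isT isT.
by split; lra.
Qed.

(** Cartan's lemma for the two relations
    theta2 /\ omega^2 + phi2 /\ omega^3 = 0 and
    theta3 /\ omega^3 + phi3 /\ omega^2 = 0, where phi2 and phi3 both involve
    omega_1^0; the three vectors are dual to omega^1, omega^2, omega^3. *)
Lemma cartan_lemma (T : W -> Prop) (o : W -> 'I_6 -> 'I_6 -> R) (x z : W -> R)
    (h k a0 a1 b0 b1 : R) (f1 f2 f3 : W) :
  [/\ T f1, T f2 & T f3] ->
  [/\ o f1 i0 i1 = 1, o f1 i0 i2 = 0 & o f1 i0 i3 = 0] ->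
  [/\ o f2 i0 i1 = 0, o f2 i0 i2 = 1 & o f2 i0 i3 = 0] ->
  [/\ o f3 i0 i1 = 0, o f3 i0 i2 = 0 & o f3 i0 i3 = 1] ->
  (forall v t, T v -> T t ->
    let phi l v := h * k * o v i0 i1 - o v i1 i0 - l v in
    let th2 v := x v + 2 * a0 * o v i0 i1 in
    let th3 v := z v + 2 * b0 * o v i0 i1 in
    let ph2 := phi (fun v => 2 * a1 * o v i0 i2) in
    let ph3 := phi (fun v => 2 * b1 * o v i0 i3) in
    th2 v * o t i0 i2 - th2 t * o v i0 i2 + (ph2 v * o t i0 i3 - ph2 t * o v i0 i3) = 0 /\
    th3 v * o t i0 i3 - th3 t * o v i0 i3 + (ph3 v * o t i0 i2 - ph3 t * o v i0 i2) = 0) ->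
  (forall v, T v ->
    [/\ x v = o v i0 i1 * x f1 + o v i0 i2 * x f2 + o v i0 i3 * x f3,
        z v = o v i0 i1 * z f1 + o v i0 i2 * z f2 + o v i0 i3 * z f3 &
        o v i1 i0 = o v i0 i1 * o f1 i1 i0 + o v i0 i2 * o f2 i1 i0
                    + o v i0 i3 * o f3 i1 i0]) ->
  [/\ x f1 = - (2 * a0), z f1 = - (2 * b0) & forall v, T v ->
    [/\ x v + 2 * a0 * o v i0 i1 = x f2 * o v i0 i2 + x f3 * o v i0 i3,
        o v i1 i0 = h * k * o v i0 i1 - (x f3 + 2 * a1) * o v i0 i2
                    - (z f2 + 2 * b1) * o v i0 i3 &
        z v + 2 * b0 * o v i0 i1 = z f2 * o v i0 i2 + z f3 * o v i0 i3]].
Proof.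
move=> [t1 t2 t3] [d11 d12 d13] [d21 d22 d23] [d31 d32 d33] E ex.
have [E1 E2] := E _ _ t1 t2; have [E3 E4] := E _ _ t1 t3; have [E5 E6] := E _ _ t2 t3.
rewrite /= d11 d12 d13 d21 d22 d23 d31 d32 d33 in E1 E2 E3 E4 E5 E6.
have xf1 : x f1 = - (2 * a0) by lra.
have zf1 : z f1 = - (2 * b0) by lra.
have of1 : o f1 i1 i0 = h * k by lra.
have of2 : o f2 i1 i0 = - (x f3 + 2 * a1) by lra.
have of3 : o f3 i1 i0 = - (z f2 + 2 * b1) by lra.
split=> // v /ex [-> -> ->]; rewrite xf1 zf1 of1 of2 of3.
by split; ring.
Qed.

Section AtAPoint.
Variables (M : manifold4 R) (c : set (tensor2 M)) (V : set M) (u : chart R M).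
Variables (O : set W) (w : forms R) (s : frame_field R).
Hypotheses (hc : conformal_structure22 c) (sV : slice_chart V u).
Hypotheses (rf : reference_frame c u O w) (so : second_order_frame_field V u O w s).
Local Notation om := (frame_forms w s).
Local Notation D := (ff_dom s).

Lemma second_order_connection_forms : connection_forms D om.
Proof.
have [[[oD sD] sm iG _] _ _ _ _] := so.
apply: connection_forms_gauge => //.
exact: connection_forms_sub oD sD (reference_connection_forms hc sV.1 rf).
Qed.

Lemma second_order_trace y : D y -> y 0 ord_max = 0 -> V (cinv u y).
Proof.
have [[[oD sD] _ _ _] _ _ _ _] := so; have [[_ sO _ _] _ _ _] := rf.
by move=> Dy y0; apply/(slice_trace sV) => //; apply: sO; apply: sD.
Qed.

(** On the hypersurface omega^4 = 0; together with skewness this determines the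
    shape of the connection forms. *)
Lemma second_order_forms y v : D y -> y 0 ord_max = 0 -> tangentV v ->
  let o := om y v in
  [/\ o i0 i4 = 0, o i1 i4 = 0, o i1 i5 = 0, o i2 i3 = 0 & o i3 i2 = 0] /\
  [/\ o i3 i3 = - o i2 i2, o i1 i3 = ff_h22 s y * o i0 i2,
      o i1 i2 = ff_h33 s y * o i0 i3, o i2 i4 = o i1 i3 & o i3 i4 = o i1 i2].
Proof.
move=> Dy y0 v0 o; have Vy := second_order_trace Dy y0.
have [[_ _ _ fo] _ _ _ h] := so; have [f4 _ _] := fo y Dy Vy.
have o4 : o i0 i4 = 0 by exact: f4.
have [e13 e12] := h y v Dy Vy v0.
have [[_ o14 o23 o32] [_ _ o15 _ _] [_ _ o24 o34 _] [z33 _ _ _] _] :=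
  skewE (cf_skew second_order_connection_forms v Dy).
by rewrite o15 -/o o4 oppr0.
Qed.

Lemma second_order_tangent_dual y : D y -> y 0 ord_max = 0 ->
  let f i := dualv om y i in
  [/\ tangentV (f j1), tangentV (f j2) & tangentV (f j3)] /\
  forall v, tangentV v ->
    v = om y v i0 i1 *: f j1 + om y v i0 i2 *: f j2 + om y v i0 i3 *: f j3.
Proof.
move=> Dy y0 f; have cf := second_order_connection_forms.
have t4 v : tangentV v -> om y v i0 i4 = 0.
  by move=> v0; have [[]] := second_order_forms Dy y0 v0.
have [e1 e2 e3 e4] := tgiE.
split; last first.
  by move=> v v0; rewrite {1}(coframe_expand cf v Dy) t4 // scale0r addr0.
by split; apply: (tangent_dualv cf Dy t4); rewrite -e4 (dualvE cf _ _ Dy).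
Qed.

(** The forms d h_22 + ... and d h_33 + ... of the identities that define the
    third-order quantities, without their curvature terms. *)
Definition theta22 y v : R := 'D_v (ff_h22 s : _ -> R^o) y
  + ff_h22 s y * (om y v i0 i0 - 2 * om y v i2 i2 - om y v i1 i1).

Definition theta33 y v : R := 'D_v (ff_h33 s : _ -> R^o) y
  + ff_h33 s y * (om y v i0 i0 + 2 * om y v i2 i2 - om y v i1 i1).

(** The exterior derivatives of omega_1^3 = h_22 omega^2 and
    omega_1^2 = h_33 omega^3 along the hypersurface, computed with the structure
    equations. *)
Lemma exterior_second_order y v t : D y -> y 0 ord_max = 0 ->
  tangentV v -> tangentV t ->
  let o v a b := om y v a b in
  let phi k v := ff_h22 s y * ff_h33 s y * o v i0 i1 - o v i1 i0 - k v in
  let th2 v := theta22 y v + 2 * ca0 s y * o v i0 i1 in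
  let th3 v := theta33 y v + 2 * cb0 s y * o v i0 i1 in
  let ph2 := phi (fun v => 2 * ca1 s y * o v i0 i2) in
  let ph3 := phi (fun v => 2 * cb1 s y * o v i0 i3) in
  th2 v * o t i0 i2 - th2 t * o v i0 i2 + (ph2 v * o t i0 i3 - ph2 t * o v i0 i3) = 0 /\
  th3 v * o t i0 i3 - th3 t * o v i0 i3 + (ph3 v * o t i0 i2 - ph3 t * o v i0 i2) = 0.
Proof.
move=> Dy y0 v0 t0.
have cf := second_order_connection_forms.
have [_ [wC [C3 _ se]] s22 s33 _] := so.
have dsm r a b := smooth_differentiable (cf_smooth cf r a b) Dy.
have d22 := smooth_differentiable s22 Dy; have d33 := smooth_differentiable s33 Dy.
have dE (h : W -> R) a b a' b' r q : tangentV r -> differentiable (h : W -> R^o) y ->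
    (forall z, D z -> z 0 ord_max = 0 -> om z q a b = h z * om z q a' b') ->
    'D_r (fun z => om z q a b : R^o) y =
    'D_r (h : W -> R^o) y * om y q a' b' + h y * 'D_r (fun z => om z q a' b' : R^o) y.
  move=> r0 dh H; rewrite (derive_tangent (cf_open cf) Dy y0 r0 H).
  exact: derive_mul.
have e13 q r : tangentV q -> tangentV r -> 'D_r (fun z => om z q i1 i3 : R^o) y =
    'D_r (ff_h22 s : W -> R^o) y * om y q i0 i2
    + ff_h22 s y * 'D_r (fun z => om z q i0 i2 : R^o) y.
  move=> q0 r0; apply: (dE (ff_h22 s)) => // z Dz z0.
  by have [_ []] := second_order_forms Dz z0 q0.
have e12 q r : tangentV q -> tangentV r -> 'D_r (fun z => om z q i1 i2 : R^o) y =
    'D_r (ff_h33 s : W -> R^o) y * om y q i0 i3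
    + ff_h33 s y * 'D_r (fun z => om z q i0 i3 : R^o) y.
  move=> q0 r0; apply: (dE (ff_h33 s)) => // z Dz z0.
  by have [_ []] := second_order_forms Dz z0 q0.
have [s1 _ s3 _] := se y v t Dy.
have m2 := s1 i2 isT; have m3 := s1 i3 isT.
have m13 := s3 i3 i1 isT isT; have m12 := s3 i2 i1 isT isT.
move: m2 m3 m13 m12; rewrite !sum_tg /dform.
have l3 k l : ff_C s y i3 i1 k l = lower (ff_C s) y i2 i1 k l.
  by have [_ -> _ _] := lowerE (ff_C s) y i1 k l.
have l2 k l : ff_C s y i2 i1 k l = lower (ff_C s) y i3 i1 k l.
  by have [_ _ -> _] := lowerE (ff_C s) y i1 k l.
have S1 i j k l : tg i -> tg j -> tg k -> tg l ->
    lower (ff_C s) y j i k l = - lower (ff_C s) y i j k l.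
  by move=> ti tj tk tl; have [] := wC y Dy i j k l ti tj tk tl.
have S2 i j k l : tg i -> tg j -> tg k -> tg l ->
    lower (ff_C s) y i j l k = - lower (ff_C s) y i j k l.
  by move=> ti tj tk tl; have [] := wC y Dy i j k l ti tj tk tl.
have S0 i j k : tg i -> tg j -> tg k -> lower (ff_C s) y i j k k = 0.
  by move=> ti tj tk; have := S2 i j k k ti tj tk tk; lra.
have [w1 w2 w3 w4] := weyl_components (wC y Dy).
rewrite !(l2, l3) !(S1 i1 i2, S1 i1 i3) // !S0 //.
rewrite !(S2 i1 i2 i1 i2, S2 i1 i2 i1 i3, S2 i1 i2 i2 i3) //.
rewrite !(S2 i1 i3 i1 i2, S2 i1 i3 i1 i3, S2 i1 i3 i2 i3) //.
rewrite w1 w2 w3 w4 -/(ca0 s y) -/(ca1 s y) -/(cb0 s y) -/(cb1 s y).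
have [[v4 v14 v15 v23 v32] [v33 v13 v12 v24 v34]] := second_order_forms Dy y0 v0.
have [[t4 t14 t15 t23 t32] [t33 t13 t12 t24 t34]] := second_order_forms Dy y0 t0.
rewrite (e13 t v t0 v0) (e13 v t v0 t0) (e12 t v t0 v0) (e12 v t v0 t0).
rewrite /theta22 /theta33 /wedge; move: v4 v14 v15 v23 v32 v33 v13 v12 v24 v34.
move: t4 t14 t15 t23 t32 t33 t13 t12 t24 t34.
set X2 := 'D_v (fun z => om z t i0 i2 : R^o) y; set Y2 := 'D_t (fun z => om z v i0 i2 : R^o) y.
set X3 := 'D_v (fun z => om z t i0 i3 : R^o) y; set Y3 := 'D_t (fun z => om z v i0 i3 : R^o) y.
move: (X2 : R) (Y2 : R) (X3 : R) (Y3 : R) ('D_v (ff_h22 s : W -> R^o) y : R) ('D_t (ff_h22 s : W -> R^o) y : R)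
   ('D_v (ff_h33 s : W -> R^o) y : R) ('D_t (ff_h33 s : W -> R^o) y : R).
move: (om y v) (om y t) (ff_h22 s y) (ff_h33 s y) (ca0 s y) (ca1 s y) (cb0 s y) (cb1 s y).
move=> a b h k p0 p1 q0 q1 {}X2 {}Y2 {}X3 {}Y3 hv ht kv kt.
move=> t4 t14 t15 t23 t32 t33 t13 t12 t24 t34 v4 v14 v15 v23 v32 v33 v13 v12 v24 v34.
rewrite t4 t14 t15 t23 t32 t33 v4 v14 v15 v23 v32 v33 ?t24 ?t34 ?v24 ?v34 t13 t12 v13 v12.
move=> m2 m3 m13 m12.
have m2' := congr1 ( *%R h) m2; have m3' := congr1 ( *%R k) m3.
by split; lra.
Qed.

Lemma third_order_exists y : D y -> y 0 ord_max = 0 ->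
  let f i := dualv om y i in
  [/\ theta22 y (f j1) = - (2 * ca0 s y), theta33 y (f j1) = - (2 * cb0 s y) &
      third_order_quantities w s y (theta22 y (f j2)) (theta22 y (f j3))
                                   (theta33 y (f j2)) (theta33 y (f j3))].
Proof.
move=> Dy y0 f; have cf := second_order_connection_forms.
have [[t1 t2 t3] ex] := second_order_tangent_dual Dy y0.
have [_ _ s22 s33 _] := so.
have th_lin (th : W -> R) : linear (th : W -> R^o) -> forall v, tangentV v ->
    th v = om y v i0 i1 * th (f j1) + om y v i0 i2 * th (f j2) + om y v i0 i3 * th (f j3).
  move=> lth v v0; have eD p q : th (p + q) = th p + th q.
    by have := lth 1 p q; rewrite !scale1r.
  have th0 : th 0 = 0 by have := eD 0 0; rewrite addr0 => /eqP; rewrite eq_sym -subr_eq0 addrK => /eqP.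
  have eZ r p : th (r *: p) = r * th p by have := lth r p 0; rewrite th0 !addr0.
  by rewrite {1}(ex v v0) !eD !eZ.
have lo r p q a b : om y (r *: p + q) a b = r * om y p a b + om y q a b.
  by rewrite (cf_linear cf Dy) mxE mxE.
have l22 : linear (theta22 y : W -> R^o).
  move=> r p q; rewrite /theta22 (derive_linear _ _ _ (smooth_differentiable s22 Dy)).
  rewrite (lo r p q i0 i0) (lo r p q i2 i2) (lo r p q i1 i1).
  move: (om y p) (om y q) ('D_p _ _) ('D_q _ _) (ff_h22 s y) => A B d d' k.
  rewrite -[_ *: _]/(r * _); ring.
have l33 : linear (theta33 y : W -> R^o).
  move=> r p q; rewrite /theta33 (derive_linear _ _ _ (smooth_differentiable s33 Dy)).
  rewrite (lo r p q i0 i0) (lo r p q i2 i2) (lo r p q i1 i1).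
  move: (om y p) (om y q) ('D_p _ _) ('D_q _ _) (ff_h33 s y) => A B d d' k.
  rewrite -[_ *: _]/(r * _); ring.
have l10 : linear ((fun v => om y v i1 i0) : W -> R^o) by move=> r p q; exact: lo.
have [D1 D2 D3] := dual_values cf Dy.
apply: (@cartan_lemma tangentV (fun v a b => om y v a b) (theta22 y) (theta33 y)
  (ff_h22 s y) (ff_h33 s y) (ca0 s y) (ca1 s y) (cb0 s y) (cb1 s y)
  (f j1) (f j2) (f j3) (And3 t1 t2 t3) D1 D2 D3).
  by move=> v t v0 t0; exact: (exterior_second_order Dy y0 v0 t0).
by move=> v v0; split; [exact: th_lin | exact: th_lin | exact: (th_lin _ l10)].
Qed.

(** The values on the vectors dual to omega^2 and omega^3 give the coefficients. *)
Lemma third_order_unique y k222 k223 k233 k333 : D y -> y 0 ord_max = 0 ->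
  third_order_quantities w s y k222 k223 k233 k333 ->
  let f i := dualv om y i in
  [/\ k222 = theta22 y (f j2), k223 = theta22 y (f j3),
      k233 = theta33 y (f j2) & k333 = theta33 y (f j3)].
Proof.
move=> Dy y0 tq f; have cf := second_order_connection_forms.
have [[t1 t2 t3] _] := second_order_tangent_dual Dy y0.
have [_ D2 D3] := dual_values cf Dy.
have [q2 _ q2'] := tq _ t2; have [q3 _ q3'] := tq _ t3.
have [-> -> ->] : [/\ k222 = theta22 y (f j2), k233 = theta33 y (f j2) & k223 = theta22 y (f j3)].
  move: q2 q2' q3; rewrite -/f -/(f j2) -/(f j3).
  rewrite -!/(theta22 y _) -!/(theta33 y _).
  have [-> -> ->] := D2; have [-> -> ->] := D3.
  by rewrite !(mulr0, mulr1, addr0, add0r) => -> -> ->.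
split=> //; move: q3'; rewrite -/(f j3) -/(theta33 y _).
by have [-> -> ->] := D3; rewrite !(mulr0, mulr1, addr0, add0r) => ->.
Qed.

Lemma smooth_theta22 i : smooth_on D (fun y => theta22 y (dualv om y i)).
Proof.
have cf := second_order_connection_forms; have oD := cf_open cf.
have [_ _ s22 _ _] := so; have sf := smooth_dualv cf i.
have so' a b := smooth_contract cf sf a b.
apply: (smoothD oD (smooth_derive_along cf s22 sf)).
apply: (smoothM oD s22); apply: (smoothB oD _ (so' _ _)).
apply: (smoothB oD (so' _ _)); exact: (smoothM oD (smooth_cst _ _) (so' _ _)).
Qed.

Lemma smooth_theta33 i : smooth_on D (fun y => theta33 y (dualv om y i)).
Proof.
have cf := second_order_connection_forms; have oD := cf_open cf.
have [_ _ _ s33 _] := so; have sf := smooth_dualv cf i.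
have so' a b := smooth_contract cf sf a b.
apply: (smoothD oD (smooth_derive_along cf s33 sf)).
apply: (smoothM oD s33); apply: (smoothB oD _ (so' _ _)).
apply: (smoothD oD (so' _ _)); exact: (smoothM oD (smooth_cst _ _) (so' _ _)).
Qed.

End AtAPoint.
End Cartan.

(** * Change of adapted frame *)

Section ChangeAlgebra.
Variable R : realType.
Implicit Types (T N F : 'M[R]_6).

(** The shape of the matrix relating two first-order frames at a point. *)
Definition adapted T : Prop :=
  isotropic_frame T /\ [/\ T i1 i2 = 0, T i1 i3 = 0 & T i1 i4 = 0] /\
  [/\ T i2 i3 = 0, T i2 i4 = 0, T i3 i2 = 0 & T i3 i4 = 0].

Lemma gram_form F a b : (F *m gram R *m F^T) a b =
  - (F a i0 * F b i5) - F a i1 * F b i4 + F a i2 * F b i3 + F a i3 * F b i2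
  - F a i4 * F b i1 - F a i5 * F b i0.
Proof.
rewrite -mulmxA mxE sum6; have [[-> -> ->] -> -> ->] := gram_mul F^T b.
by rewrite !mxE; ring.
Qed.

Lemma orthogonal_entry F a b : F *m gram R *m F^T = gram R ->
  - (F a i0 * F b i5) - F a i1 * F b i4 + F a i2 * F b i3 + F a i3 * F b i2
  - F a i4 * F b i1 - F a i5 * F b i0 = gram R a b.
Proof. by move=> <-; rewrite gram_form. Qed.

Lemma gramE : [/\ gram R i0 i5 = -1, gram R i1 i4 = -1, gram R i2 i3 = 1 & gram R i1 i2 = 0] /\
  [/\ gram R i0 i4 = 0, gram R i1 i3 = 0, gram R i3 i4 = 0, gram R i1 i5 = 0 & gram R i3 i5 = 0].
Proof. by split; split; rewrite mxE. Qed.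

Lemma adapted_entries T : adapted T ->
  [/\ T i0 i0 != 0, T i1 i1 != 0, T i2 i2 != 0 & T i3 i3 != 0] /\
  [/\ T i0 i0 * T i5 i5 = 1, T i1 i1 * T i4 i4 = 1 & T i2 i2 * T i3 i3 = 1] /\
  [/\ T i4 i5 = 0, T i3 i3 * T i4 i2 = T i3 i1 * T i4 i4,
      T i1 i0 = 0 -> T i5 i4 = 0 &
      T i1 i0 = 0 -> T i3 i3 * T i5 i2 = T i3 i0 * T i5 i5].
Proof.
move=> [iT [[e12 e13 e14] [e23 e24 e32 e34]]].
have [n0 t5 e05] := isotropic_frame_tg iT; have [oT _] := iT.
have [e15 e25 e35 e45] := And4 (t5 i1 isT) (t5 i2 isT) (t5 i3 isT) (t5 i4 isT).
have [[g05 g14 g23 _] [_ _ g34 g15 g35]] := gramE.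
have p14 := orthogonal_entry i1 i4 oT; have p23 := orthogonal_entry i2 i3 oT.
have p34 := orthogonal_entry i3 i4 oT; have p15 := orthogonal_entry i1 i5 oT.
have p35 := orthogonal_entry i3 i5 oT.
rewrite g14 e12 e13 e14 e15 e45 in p14; rewrite g23 e23 e24 e25 e32 e34 e35 in p23.
rewrite g34 e32 e34 e35 e45 in p34; rewrite g15 e12 e13 e14 e15 in p15.
rewrite g35 e32 e34 e35 in p35.
have e11 : T i1 i1 * T i4 i4 = 1 by lra.
have e22 : T i2 i2 * T i3 i3 = 1 by lra.
have nz (a b : R) : a * b = 1 -> a != 0 /\ b != 0.
  by move=> ab; split; apply/eqP => h; move: ab; rewrite h ?mul0r ?mulr0 => /eqP; rewrite eq_sym oner_eq0.
have [n1 n4] := nz _ _ e11; have [n2 n3] := nz _ _ e22.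
do 2!split => //; split => //; first by lra.
  by move=> e10; apply: (mulfI n1); rewrite e10 in p15; lra.
move=> e10; have e54 : T i5 i4 = 0 by apply: (mulfI n1); rewrite e10 in p15; lra.
by rewrite e54 in p35; lra.
Qed.

(** Two isotropic planes through the same isotropic line and of the same family
    coincide: [l1 : l2] and [l1' : l2'] are the parameters of the two
    generators, [a] spans the line, [b] lies in the first plane, and
    [p b + q d] in the second one, [d] being transversal to [b]. *)
Lemma isotropic_plane_unique (l1 l2 l1' l2' a1 a2 a3 a4 b1 b2 b3 b4 d1 d2 d3 d4
    e1 e2 e3 e4 p q : R) :
  (l1, l2) != (0, 0) -> (l1', l2') != (0, 0) ->
  l1 * a1 + l2 * a3 = 0 -> l1 * a2 + l2 * a4 = 0 ->
  l1 * b1 + l2 * b3 = 0 -> l1 * b2 + l2 * b4 = 0 ->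
  l1' * a1 + l2' * a3 = 0 -> l1' * a2 + l2' * a4 = 0 ->
  p * (l1' * b1 + l2' * b3) + q * (l1' * d1 + l2' * d3) = 0 ->
  p * (l1' * b2 + l2' * b4) + q * (l1' * d2 + l2' * d4) = 0 ->
  a2 * e3 + a3 * e2 - a1 * e4 - a4 * e1 = -1 ->
  b2 * d3 + b3 * d2 - b1 * d4 - b4 * d1 = 1 -> q = 0.
Proof.
move=> l0 l0' la1 la2 lb1 lb2 la1' la2' q1 q2 ae bd.
have nzp (x y z : R) : (x, y) != (0, 0) -> x * z = 0 -> y * z = 0 -> z = 0.
  rewrite xpair_eqE negb_and => /orP[] n0 xz yz; exact: (mulfI n0 (etrans _ (esym (mulr0 _)))).
pose D := l1 * l2' - l2 * l1'.
have D1 : D * a1 = l2' * (l1 * a1 + l2 * a3) - l2 * (l1' * a1 + l2' * a3) by rewrite /D; ring.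
have D2 : D * a2 = l2' * (l1 * a2 + l2 * a4) - l2 * (l1' * a2 + l2' * a4) by rewrite /D; ring.
have D3 : D * a3 = l1 * (l1' * a1 + l2' * a3) - l1' * (l1 * a1 + l2 * a3) by rewrite /D; ring.
have D4 : D * a4 = l1 * (l1' * a2 + l2' * a4) - l1' * (l1 * a2 + l2 * a4) by rewrite /D; ring.
rewrite la1 la2 la1' la2' !mulr0 subrr in D1 D2 D3 D4.
have D0 : D = 0.
  have : D * (a2 * e3 + a3 * e2 - a1 * e4 - a4 * e1)
    = (D * a2) * e3 + (D * a3) * e2 - (D * a1) * e4 - (D * a4) * e1 by ring.
  by rewrite ae D1 D2 D3 D4; lra.
have B1 : l1' * b1 + l2' * b3 = 0.
  apply: (nzp _ _ _ l0).
    have -> : l1 * (l1' * b1 + l2' * b3) = l1' * (l1 * b1 + l2 * b3) + b3 * D by rewrite /D; ring.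
    by rewrite lb1 D0 !mulr0 addr0.
  have -> : l2 * (l1' * b1 + l2' * b3) = l2' * (l1 * b1 + l2 * b3) - b1 * D by rewrite /D; ring.
  by rewrite lb1 D0 !mulr0 subr0.
have B2 : l1' * b2 + l2' * b4 = 0.
  apply: (nzp _ _ _ l0).
    have -> : l1 * (l1' * b2 + l2' * b4) = l1' * (l1 * b2 + l2 * b4) + b4 * D by rewrite /D; ring.
    by rewrite lb2 D0 !mulr0 addr0.
  have -> : l2 * (l1' * b2 + l2' * b4) = l2' * (l1 * b2 + l2 * b4) - b2 * D by rewrite /D; ring.
  by rewrite lb2 D0 !mulr0 subr0.
rewrite B1 mulr0 add0r in q1; rewrite B2 mulr0 add0r in q2.
apply: (nzp _ _ _ l0').
  have : q * (l1' * (b2 * d3 + b3 * d2 - b1 * d4 - b4 * d1)) =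
    q * d3 * (l1' * b2 + l2' * b4) - q * d4 * (l1' * b1 + l2' * b3)
    + b3 * (q * (l1' * d2 + l2' * d4)) - b4 * (q * (l1' * d1 + l2' * d3)) by ring.
  by rewrite bd B1 B2 q1 q2; lra.
have : q * (l2' * (b2 * d3 + b3 * d2 - b1 * d4 - b4 * d1)) =
  q * d2 * (l1' * b1 + l2' * b3) - q * d1 * (l1' * b2 + l2' * b4)
  + b2 * (q * (l1' * d1 + l2' * d3)) - b1 * (q * (l1' * d2 + l2' * d4)) by ring.
by rewrite bd B1 B2 q1 q2; lra.
Qed.

Lemma tg_mul T F a b : isotropic_frame F -> tg b ->
  (T *m F) a b = T a i1 * F i1 b + T a i2 * F i2 b + T a i3 * F i3 b
               + T a i4 * F i4 b + T a i5 * F i5 b.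
Proof.
move=> [_ F0] tb; rewrite mxE sum6 F0 ?mulr0 ?add0r ?addrA //.
by move: tb; apply: contraL => /eqP ->.
Qed.

Lemma alpha_plane_mul T F : isotropic_frame F -> adapted T ->
  alpha_plane F -> alpha_plane (T *m F).
Proof.
move=> iF [iT [[e12 e13 e14] [e23 e24 _ _]]] [l l0 la]; exists l => // a.
have [_ t5 _] := isotropic_frame_tg iT.
have [a1 a2] := la i1 isT; have [b1 b2] := la i2 isT.
rewrite !inE => /orP[] /eqP ->; rewrite !(tg_mul _ _ iF) //.
  rewrite e12 e13 e14 (t5 i1) //.
  split; [transitivity (T i1 i1 * (l.1 * F i1 i1 + l.2 * F i1 i3)) |
    transitivity (T i1 i1 * (l.1 * F i1 i2 + l.2 * F i1 i4))]; try ring;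
    by rewrite (a1, a2) mulr0.
rewrite e23 e24 (t5 i2) //.
split; [transitivity (T i2 i1 * (l.1 * F i1 i1 + l.2 * F i1 i3)
                     + T i2 i2 * (l.1 * F i2 i1 + l.2 * F i2 i3)) |
  transitivity (T i2 i1 * (l.1 * F i1 i2 + l.2 * F i1 i4)
                     + T i2 i2 * (l.1 * F i2 i2 + l.2 * F i2 i4))]; try ring;
  by rewrite ?(a1, a2) ?(b1, b2) !mulr0 addr0.
Qed.

Lemma beta_plane_mul T F : isotropic_frame F -> adapted T ->
  beta_plane F -> beta_plane (T *m F).
Proof.
move=> iF [iT [[e12 e13 e14] [_ _ e32 e34]]] [l l0 la]; exists l => // a.
have [_ t5 _] := isotropic_frame_tg iT.
have [a1 a2] := la i1 isT; have [b1 b2] := la i3 isT.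
rewrite !inE => /orP[] /eqP ->; rewrite !(tg_mul _ _ iF) //.
  rewrite e12 e13 e14 (t5 i1) //.
  split; [transitivity (T i1 i1 * (l.1 * F i1 i1 + l.2 * F i1 i2)) |
    transitivity (T i1 i1 * (l.1 * F i1 i3 + l.2 * F i1 i4))]; try ring;
    by rewrite (a1, a2) mulr0.
rewrite e32 e34 (t5 i3) //.
split; [transitivity (T i3 i1 * (l.1 * F i1 i1 + l.2 * F i1 i2)
                     + T i3 i3 * (l.1 * F i3 i1 + l.2 * F i3 i2)) |
  transitivity (T i3 i1 * (l.1 * F i1 i3 + l.2 * F i1 i4)
                     + T i3 i3 * (l.1 * F i3 i3 + l.2 * F i3 i4))]; try ring;
  by rewrite ?(a1, a2) ?(b1, b2) !mulr0 addr0.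
Qed.

(** Two frames at a point with proportional vertices A_1 modulo A_0 and adapted
    planes are related by an adapted matrix: the missing entries vanish because
    the scalar products do, and because the two planes are unique. *)
Lemma adapted_of_planes T F : isotropic_frame F -> isotropic_frame T ->
  [/\ T i1 i2 = 0, T i1 i3 = 0 & T i1 i4 = 0] ->
  alpha_plane F -> beta_plane F -> alpha_plane (T *m F) -> beta_plane (T *m F) ->
  adapted T.
Proof.
move=> iF iT [e12 e13 e14] al be al' be'.
have [_ t5 _] := isotropic_frame_tg iT; have [oT _] := iT.
have [e15 e25 e35 e45] := And4 (t5 i1 isT) (t5 i2 isT) (t5 i3 isT) (t5 i4 isT).
have [[_ g14 g23 g12] [_ g13 _ _ _]] := gramE.
have n1 : T i1 i1 != 0.
  have := orthogonal_entry i1 i4 oT; rewrite g14 e12 e13 e14 e15 e45 => h.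
  by apply/eqP => T0; move: h; rewrite T0; lra.
have e24 : T i2 i4 = 0.
  have := orthogonal_entry i1 i2 oT; rewrite g12 e12 e13 e14 e15 e25 => h.
  by apply: (mulfI n1); clear -h; lra.
have e34 : T i3 i4 = 0.
  have := orthogonal_entry i1 i3 oT; rewrite g13 e12 e13 e14 e15 e35 => h.
  by apply: (mulfI n1); clear -h; lra.
have [oF _] := iF; have [_ f5 _] := isotropic_frame_tg iF.
have q14 : F i1 i2 * F i4 i3 + F i1 i3 * F i4 i2 - F i1 i1 * F i4 i4 - F i1 i4 * F i4 i1 = -1.
  by have := orthogonal_entry i1 i4 oF; rewrite g14 (f5 i1) // (f5 i4) // => h; clear -h; lra.
have q23 : F i2 i2 * F i3 i3 + F i2 i3 * F i3 i2 - F i2 i1 * F i3 i4 - F i2 i4 * F i3 i1 = 1.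
  by have := orthogonal_entry i2 i3 oF; rewrite g23 (f5 i2) // (f5 i3) // => h; clear -h; lra.
do 2!split => //; split => //.
- have [[l1 l2] l0 la] := al; have [[l1' l2'] l0' la'] := al'.
  have [a1 a2] := la i1 isT; have [b1 b2] := la i2 isT.
  have [a1' a2'] := la' i1 isT; have [b1' b2'] := la' i2 isT.
  rewrite /= !(tg_mul _ _ iF) // e12 e13 e14 e15 in a1' a2'.
  rewrite /= !(tg_mul _ _ iF) // e24 e25 in b1' b2'.
  rewrite /= in a1 a2 b1 b2.
  have c1 : l1' * F i1 i1 + l2' * F i1 i3 = 0 by apply: (mulfI n1); clear -a1'; lra.
  have c2 : l1' * F i1 i2 + l2' * F i1 i4 = 0 by apply: (mulfI n1); clear -a2'; lra.
  have d1 := congr1 ( *%R (T i2 i1)) c1; have d2 := congr1 ( *%R (T i2 i1)) c2.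
  by apply: (isotropic_plane_unique (p := T i2 i2) l0 l0' a1 a2 b1 b2 c1 c2 _ _ q14 q23);
    [clear -b1' d1; lra | clear -b2' d2; lra].
- (* Exchanging the coordinates 2 and 3 turns beta-planes into alpha-planes. *)
  have [[l1 l2] l0 la] := be; have [[l1' l2'] l0' la'] := be'.
  have [a1 a2] := la i1 isT; have [b1 b2] := la i3 isT.
  have [a1' a2'] := la' i1 isT; have [b1' b2'] := la' i3 isT.
  rewrite /= !(tg_mul _ _ iF) // e12 e13 e14 e15 in a1' a2'.
  rewrite /= !(tg_mul _ _ iF) // e34 e35 in b1' b2'.
  rewrite /= in a1 a2 b1 b2.
  have c1 : l1' * F i1 i1 + l2' * F i1 i2 = 0 by apply: (mulfI n1); clear -a1'; lra.
  have c2 : l1' * F i1 i3 + l2' * F i1 i4 = 0 by apply: (mulfI n1); clear -a2'; lra.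
  have d1 := congr1 ( *%R (T i3 i1)) c1; have d2 := congr1 ( *%R (T i3 i1)) c2.
  have r14 : F i1 i3 * F i4 i2 + F i1 i2 * F i4 i3 - F i1 i1 * F i4 i4 - F i1 i4 * F i4 i1 = -1.
    by rewrite -q14; ring.
  have r32 : F i3 i3 * F i2 i2 + F i3 i2 * F i2 i3 - F i3 i1 * F i2 i4 - F i3 i4 * F i2 i1 = 1.
    by rewrite -q23; ring.
  by apply: (isotropic_plane_unique (p := T i3 i3) l0 l0' a1 a2 b1 b2 c1 c2 _ _ r14 r32);
    [clear -b1' d1; lra | clear -b2' d2; lra].
Qed.

(** The equation dA' = (dT + T omega) A, read in the rows of A_0, A_1 and A_2. *)
Lemma change_forms (T dT N N' : 'M[R]_6) : adapted T ->
  [/\ forall b, b != i0 -> dT i0 b = 0,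
      [/\ dT i1 i2 = 0, dT i1 i3 = 0 & dT i1 i4 = 0],
      forall j, tg j -> dT j i5 = 0 & [/\ dT i2 i3 = 0 & dT i2 i4 = 0]] ->
  N' *m T = dT + T *m N -> skew N -> skew N' -> N i0 i4 = 0 ->
  [/\ N' i0 i4 = 0, N' i0 i2 * T i2 i2 = T i0 i0 * N i0 i2,
      N' i0 i3 * T i3 i3 = T i0 i0 * N i0 i3,
      N' i0 i1 * T i1 i1 + N' i0 i2 * T i2 i1 + N' i0 i3 * T i3 i1 = T i0 i0 * N i0 i1 &
      N' i0 i0 * T i0 i0 + N' i0 i1 * T i1 i0 + N' i0 i2 * T i2 i0 + N' i0 i3 * T i3 i0
        = dT i0 i0 + T i0 i0 * N i0 i0] /\
  [/\ N' i1 i2 * T i2 i2 = T i1 i0 * N i0 i2 + T i1 i1 * N i1 i2,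
      N' i1 i3 * T i3 i3 = T i1 i0 * N i0 i3 + T i1 i1 * N i1 i3,
      N' i1 i1 * T i1 i1 + N' i1 i2 * T i2 i1 + N' i1 i3 * T i3 i1
        = dT i1 i1 + T i1 i0 * N i0 i1 + T i1 i1 * N i1 i1 &
      N' i2 i2 * T i2 i2 + N' i1 i3 * T i4 i2 + N' i0 i3 * T i5 i2
        = dT i2 i2 + T i2 i0 * N i0 i2 + T i2 i1 * N i1 i2 + T i2 i2 * N i2 i2].
Proof.
move=> aT [d0 [d12 d13 d14] d5 [d23 d24]] H sN sN' N4.
have [[n0 n1 n2 n3] [[E0 E1 E2] [T45 _ _ _]]] := adapted_entries aT.
have [iT [[e12 e13 e14] [e23 e24 e32 e34]]] := aT.
have [_ t5 _] := isotropic_frame_tg iT; have [_ t0] := iT.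
have [e15 e25 e35 _] := And4 (t5 i1 isT) (t5 i2 isT) (t5 i3 isT) (t5 i4 isT).
have [f1 f2 f3 f4] := And4 (t0 i1 isT) (t0 i2 isT) (t0 i3 isT) (t0 i4 isT).
have f5 := t0 i5 isT.
have [g1 g2 g3 g4] := And4 (d0 i1 isT) (d0 i2 isT) (d0 i3 isT) (d0 i4 isT).
have [[x05 x14 x23 x32] _ _ _ _] := skewE sN.
have [[z05 z14 z23 z32] [_ _ z15 z25 _] [_ _ z24 _ _] _ _] := skewE sN'.
have X a b : \sum_k N' a k * T k b = dT a b + \sum_k T a k * N k b.
  by have := congr1 (fun A : 'M[R]_6 => A a b) H; rewrite /= [LHS]mxE [RHS]mxE [(T *m N) a b]mxE.
have n4 : T i4 i4 != 0 by apply/eqP => h; move: E1; rewrite h mulr0 => /eqP; rewrite eq_sym oner_eq0.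
have X04 := X i0 i4; have X02 := X i0 i2; have X03 := X i0 i3.
have X01 := X i0 i1; have X00 := X i0 i0.
have X12 := X i1 i2; have X13 := X i1 i3; have X11 := X i1 i1; have X22 := X i2 i2.
rewrite !sum6 ?f1 ?f2 ?f3 ?f4 ?f5 ?e12 ?e13 ?e14 ?e15 ?e23 ?e24 ?e25 ?e32 ?e34 ?e35 ?T45
  ?x05 ?x14 ?x23 ?x32 ?z05 ?z14 ?z23 ?z32 ?N4 ?g1 ?g2 ?g3 ?g4 ?d12 ?d13 in X04 X02 X03 X01 X00 X12 X13 X11 X22.
rewrite !(mul0r, mulr0, add0r, addr0) in X04.
have w4 : N' i0 i4 = 0 by apply: (mulIf n4); rewrite mul0r.
rewrite z15 w4 oppr0 in X12 X13 X11.
rewrite w4 in X02 X03 X01 X00; rewrite z24 z25 in X22.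
rewrite !(mul0r, mulr0, add0r, addr0) in X02 X03 X01 X00 X12 X13 X11 X22.
by split; split; rewrite -?addrA.
Qed.

End ChangeAlgebra.

Section ThetaChange.
Variable R : realType.

(** How [theta22] and [theta33] transform, in terms of the entries of the matrix
    of change of frame: t0, t1, t2, t3 are its first four diagonal entries, the
    second vertex becomes q A_0 + p A_1 + t2 A_2, the third one
    t A_0 + r A_1 + t3 A_3. *)
Lemma theta_change (t0 t1 t2 t3 t44 t55 p q r t t42 t52 d0 d1 d2 : R)
    (h k h' k' dh dk dh' dk' : R) (n00 n11 n22 n02 n03 n12 n13 : R)
    (m00 m11 m22 m02 m03 m12 m13 : R) :
  [/\ t0 != 0, t1 != 0, t2 != 0 & t3 != 0] ->
  [/\ t0 * t55 = 1, t1 * t44 = 1 & t2 * t3 = 1] ->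
  t3 * t42 = r * t44 -> t3 * t52 = t * t55 ->
  n13 = h * n02 -> n12 = k * n03 ->
  m02 * t2 = t0 * n02 -> m03 * t3 = t0 * n03 ->
  m00 * t0 + m02 * q + m03 * t = d0 + t0 * n00 ->
  m12 * t2 = t1 * n12 -> m13 * t3 = t1 * n13 ->
  m11 * t1 + m12 * p + m13 * r = d1 + t1 * n11 ->
  m22 * t2 + m13 * t42 + m03 * t52 = d2 + q * n02 + p * n12 + t2 * n22 ->
  h' * t0 = t1 * t2 * t2 * h -> k' * t0 * t2 * t2 = t1 * k ->
  dh' * t0 + h' * d0 = d1 * t2 * t2 * h + t1 * d2 * t2 * h + t1 * t2 * d2 * h
                       + t1 * t2 * t2 * dh ->
  dk' * t0 * t2 * t2 + k' * d0 * t2 * t2 + k' * t0 * d2 * t2 + k' * t0 * t2 * d2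
    = d1 * k + t1 * dk ->
  let P := p * t3 in let Q := q * t3 in let A := r * t2 in let S := t * t2 in
  (dh' + h' * (m00 - 2 * m22 - m11)) * t0 = t1 * t2 ^+ 2 *
    (dh + h * (n00 - 2 * n22 - n11)
     + h * (- 3 * (Q - A * h) * n02 + (S - P * k) * n03)) /\
  (dk' + k' * (m00 + 2 * m22 - m11)) * t0 = t1 * t3 ^+ 2 *
    (dk + k * (n00 + 2 * n22 - n11)
     + k * ((Q - A * h) * n02 - 3 * (S - P * k) * n03)).
Proof.
move=> [z0 z1 z2 z3] [e0 e1 e2] e42 e52 -> -> e02 e03 e00 e12 e13 e11 e22 eh ek edh edk P Q A S.
have d (a b x : R) : b != 0 -> x * b = a -> x = a / b by move=> b0 <-; rewrite mulfK.
have E3 : t3 = t2^-1 by apply: (mulfI z2); rewrite e2 divff.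
have E55 : t55 = t0^-1 by apply: (mulfI z0); rewrite e0 divff.
have E44 : t44 = t1^-1 by apply: (mulfI z1); rewrite e1 divff.
have iz : t2^-1 != 0 by rewrite invr_eq0.
rewrite /P /Q /A /S; clear P Q A S; move: e42 e52 e03 e13; rewrite E3 E55 E44 => e42 e52 e03 e13.
have H42 : t42 = t2 * (r / t1) by rewrite -e42 mulrA divff // mul1r.
have H52 : t52 = t2 * (t / t0) by rewrite -e52 mulrA divff // mul1r.
have H02 := d _ _ _ z2 e02; have H12 := d _ _ _ z2 e12.
have H03 := d _ _ _ iz e03; have H13 := d _ _ _ iz e13.
have Hh := d _ _ _ z0 eh.
have Hk : k' = t1 * k / (t0 * t2 * t2) by apply: d; rewrite ?mulf_neq0 // -ek; ring.
have H00 : m00 = (d0 + t0 * n00 - m02 * q - m03 * t) / t0 by apply: d => //; rewrite -e00; ring.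
have H11 : m11 = (d1 + t1 * n11 - m12 * p - m13 * r) / t1 by apply: d => //; rewrite -e11; ring.
have H22 : m22 = (d2 + q * n02 + p * (k * n03) + t2 * n22 - m13 * t42 - m03 * t52) / t2.
  by apply: d => //; rewrite -e22; ring.
have Hdh : dh' = (d1 * t2 * t2 * h + t1 * d2 * t2 * h + t1 * t2 * d2 * h
                       + t1 * t2 * t2 * dh - h' * d0) / t0.
  by apply: d => //; rewrite -edh; ring.
have Hdk : dk' = (d1 * k + t1 * dk - k' * d0 * t2 * t2 - k' * t0 * d2 * t2 - k' * t0 * t2 * d2)
   / (t0 * t2 * t2).
  by apply: d; rewrite ?mulf_neq0 // -edk; ring.
rewrite Hdh Hdk H00 H11 H22 H02 H03 H12 H13 Hh Hk H42 H52.
by split; field; rewrite z0 z1 z2.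
Qed.

(** Comparison of coefficients along vectors dual to the coframe [n01, n02, n03]
    of the first frame; [m01, m02, m03] is the coframe of the second one. *)
Lemma coefficient_change (T : Type) (th n01 n02 n03 m01 m02 m03 th' : T -> R)
    (f1 f2 f3 : T) (t0 t1 t2 t3 p r a a' u2 u3 u2' u3' c c2 c3 : R) :
  [/\ t0 != 0, t1 != 0, t2 != 0 & t3 != 0] -> t2 * t3 = 1 ->
  [/\ n01 f1 = 1, n02 f1 = 0 & n03 f1 = 0] ->
  [/\ n01 f2 = 0, n02 f2 = 1 & n03 f2 = 0] ->
  [/\ n01 f3 = 0, n02 f3 = 0 & n03 f3 = 1] ->
  (forall v, [\/ v = f1, v = f2 | v = f3] ->
   [/\ m02 v * t2 = t0 * n02 v, m03 v * t3 = t0 * n03 v,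
       m01 v * t1 + m02 v * p + m03 v * r = t0 * n01 v,
       th' v * t0 = c * (th v + (c2 * n02 v + c3 * n03 v)) &
       th' v + 2 * a' * m01 v = u2' * m02 v + u3' * m03 v /\ th v + 2 * a * n01 v = u2 * n02 v + u3 * n03 v]) ->
  u2' * (t0 ^+ 2 * t3) = c * (u2 + c2 - 2 * a * (p * t3)) /\
  u3' * (t0 ^+ 2 * t2) = c * (u3 + c3 - 2 * a * (r * t2)).
Proof.
move=> [z0 z1 z2 z3] e23 [x11 x12 x13] [x21 x22 x23] [x31 x32 x33] H.
have [A2 A3 A1 At [A' A]] := H f1 (Or31 _ _ erefl).
have [B2 B3 B1 Bt [B' B]] := H f2 (Or32 _ _ erefl).
have [C2 C3 C1 Ct [C' C]] := H f3 (Or33 _ _ erefl).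
rewrite x11 x12 x13 x21 x22 x23 x31 x32 x33 !(mulr0, mulr1, addr0, add0r)
  in A2 A3 A1 At A' A B2 B3 B1 Bt B' B C2 C3 C1 Ct C' C.
have d (x y b : R) : b != 0 -> x * b = y -> x = y / b by move=> b0 <-; rewrite mulfK.
have E3 : t3 = t2^-1 by apply: (mulfI z2); rewrite e23 divff.
have z (x b : R) : b != 0 -> x * b = 0 -> x = 0.
  by move=> b0 /eqP; rewrite mulf_eq0 (negbTE b0) orbF => /eqP.
have {}A2 := z _ _ z2 A2; have {}A3 := z _ _ z3 A3; have {}B3 := z _ _ z3 B3.
have {}C2 := z _ _ z2 C2.
rewrite A2 A3 !(mul0r, mulr0, addr0) in A1 A'; rewrite B3 !(mul0r, mulr0, addr0) in B1 B'.
rewrite C2 !(mul0r, mulr0, addr0, add0r) in C1 C'.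
have {}A1 := d _ _ _ z1 A1; have {}B2 := d _ _ _ z2 B2; have {}C3 := d _ _ _ z3 C3.
have {}B1 : m01 f2 = - (m02 f2 * p) / t1 by apply: d => //; lra.
have {}C1 : m01 f3 = - (m03 f3 * r) / t1 by apply: d => //; lra.
have ta : 2 * a' * t0 ^+ 2 = c * (2 * a) * t1.
  have h1 : th' f1 = - (2 * a' * (t0 / t1)) by rewrite -A1; lra.
  have h2 : th f1 = - (2 * a) by lra.
  rewrite h1 h2 in At.
  have : - (2 * a' * t0 ^+ 2) = (c * - (2 * a)) * t1 by rewrite -At; field.
  by lra.
have hB : th' f2 = u2' * (t0 / t2) + 2 * a' * (t0 / t2 * p / t1).
  by move: B'; rewrite B1 B2; set e := t0 / t2; rewrite !mulNr !mulrN mulrA; lra.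
have hC : th' f3 = u3' * (t0 / t3) + 2 * a' * (t0 / t3 * r / t1).
  by move: C'; rewrite C1 C3; set e := t0 / t3; rewrite !mulNr !mulrN mulrA; lra.
have thB : th f2 = u2 by lra.
have thC : th f3 = u3 by lra.
rewrite hB thB in Bt; rewrite hC thC in Ct.
have a'E : a' = c * a * t1 / t0 ^+ 2 by apply: d; rewrite ?expf_neq0 //; lra.
split.
  have -> : c * (u2 + c2 - 2 * a * (p * t3)) = c * (u2 + c2) - c * (2 * a * (p * t3)) by ring.
  by rewrite -Bt a'E E3; field; rewrite z0 z1 z2.
have -> : c * (u3 + c3 - 2 * a * (r * t2)) = c * (u3 + c3) - c * (2 * a * (r * t2)) by ring.
by rewrite -Ct a'E E3; field; rewrite z0 z1 z2.
Qed.

End ThetaChange.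

(** * Comparison of two second-order frame fields *)

Section FrameChange.
Variable R : realType.
Local Notation W := 'rV[R]_4.
Implicit Types (O : set W) (y v t : W) (w : forms R) (G T : W -> 'M[R]_6).

Lemma frame_forms_eq O w G G' y v : open O -> O y ->
  (forall z, O z -> G z = G' z) -> frame_forms w G y v = frame_forms w G' y v.
Proof.
move=> oO Oy GG'; congr (_ *m invmx _); last exact: GG'.
by rewrite !frame_diffE (dmx_eq v oO Oy GG') GG'.
Qed.

Lemma frame_forms_comp O w G T y v : open O -> smooth_mx O G -> smooth_mx O T ->
  O y -> G y \in unitmx -> T y \in unitmx ->
  frame_forms w (fun z => T z *m G z) y v *m T y
    = dmx v T y + T y *m frame_forms w G y v.
Proof.
move=> oO sG sT Oy uG uT; have uTG : T y *m G y \in unitmx by rewrite unitmx_mul uT.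
have L : frame_forms w (fun z => T z *m G z) y v *m (T y *m G y)
   = dmx v (fun z => T z *m G z) y + T y *m G y *m w y v.
  exact: (@frame_forms_mul _ _ (fun z => T z *m G z)).
have N : T y *m (frame_forms w G y v *m G y) = T y *m (dmx v G y + G y *m w y v).
  by congr (_ *m _); exact: frame_forms_mul.
apply: (can_inj (mulmxK uG)); rewrite [LHS](esym (mulmxA _ _ _)) L mulmxDl.
rewrite [X in _ = _ + X](esym (mulmxA _ _ _)) N.
rewrite (dmxM v oO sT sG Oy).
by rewrite mulmxDr !mulmxA addrA.
Qed.

Lemma isotropic_mul (F T : 'M[R]_6) : isotropic_frame F -> isotropic_frame T ->
  isotropic_frame (T *m F).
Proof.
move=> [oF F0] [oT T0]; split.
  by rewrite trmx_mul -!mulmxA (mulmxA (gram R)) (mulmxA F) (mulmxA F (gram R)) oF mulmxA.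
move=> b b0; rewrite mxE big1 // => k _.
by have [->|k0] := eqVneq k i0; [rewrite F0 ?mulr0 | rewrite T0 // mul0r].
Qed.

Lemma isotropic_inv (F : 'M[R]_6) : isotropic_frame F -> isotropic_frame (invmx F).
Proof.
move=> iF; have [oF F0] := iF; have [uF iFE] := orthogonal_inv oF; split.
  by rewrite -[gram R in LHS]oF trmx_inv !mulmxA mulVmx // mul1mx mulmxK // unitmx_tr.
have [_ t5 _] := isotropic_frame_tg iF; have F05 : F i0 i5 = 0 by rewrite F0.
have G a : (gram R *m F^T) i0 a = - F a i5.
  by have [[-> _ _] _ _ _] := gram_mul F^T a; rewrite mxE.
move=> b; rewrite iFE; have [[m0 m1 m2] m3 m4 m5] := mul_gram (gram R *m F^T) i0.
by move: b; elim/ind6 => // _; rewrite ?(m1, m2, m3, m4, m5) G ?opprK ?F05 ?t5 ?oppr0.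
Qed.

(** omega^4 is the scalar product of dA_0 with A_1, up to sign. *)
Lemma coframe4_gauge O w G y v : open O -> smooth_mx O G ->
  (forall z, O z -> isotropic_frame (G z)) -> skew (w y v) -> O y ->
  frame_forms w G y v i0 i4 = G y i0 i0 *
    (w y v i0 i1 * G y i1 i4 - w y v i0 i2 * G y i1 i3
     - w y v i0 i3 * G y i1 i2 + w y v i0 i4 * G y i1 i1).
Proof.
move=> oO sG iG sk Oy; have [oG G0] := iG _ Oy; have [uG eG] := orthogonal_inv oG.
have [_ t5 _] := isotropic_frame_tg (iG _ Oy).
have [[p5 _ _ _] _ _ _ _] := skewE sk.
have -> : frame_forms w G y v = (dmx v G y + G y *m w y v) *m (gram R *m (G y)^T) *m gram R.
  by rewrite /frame_forms eG frame_diffE !mulmxA.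
have [_ _ -> _] := mul_gram ((dmx v G y + G y *m w y v) *m (gram R *m (G y)^T)) i0.
rewrite [((_ + _) *m _) i0 i1]mxE sum6.
have [[-> -> ->] -> -> ->] := gram_mul (G y)^T i1; rewrite ![(G y)^T _ _]mxE.
have N b : b != i0 -> (dmx v G y + G y *m w y v) i0 b = G y i0 i0 * w y v i0 b.
  move=> b0; rewrite mxE mxE (@near_eq_derive _ _ _ _ (cst 0)); last first.
    by apply: (near_open oO Oy) => z /iG[_]; apply.
  rewrite derive_cst add0r mxE (bigD1 i0) //= big1 ?addr0 // => a a0.
  by rewrite G0 // mul0r.
rewrite (N i1) // (N i2) // (N i3) // (N i4) // (N i5) // p5 t5 //.
by ring.
Qed.

Lemma adapted_pattern O1 T y v : open O1 ->
  (forall z, O1 z -> isotropic_frame (T z)) ->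
  (forall z, O1 z -> z 0 ord_max = 0 -> adapted (T z)) -> O1 y ->
  y 0 ord_max = 0 -> tangentV v ->
  let dT := dmx v T y in
  [/\ forall b, b != i0 -> dT i0 b = 0,
      [/\ dT i1 i2 = 0, dT i1 i3 = 0 & dT i1 i4 = 0],
      forall j, tg j -> dT j i5 = 0 & [/\ dT i2 i3 = 0 & dT i2 i4 = 0]].
Proof.
move=> oO iT aT Oy y0 v0 dT.
have Z a b : (forall z, O1 z -> z 0 ord_max = 0 -> T z a b = 0) -> dT a b = 0.
  move=> H; rewrite mxE (@derive_tangent _ O1 _ (cst 0) _ _ oO Oy y0 v0).
    exact: derive_cst.
  exact: H.
split.
- by move=> b b0; apply: Z => z Oz _; have [_] := iT _ Oz; apply.
- by split; apply: Z => z Oz z0; have [_ [[]]] := aT _ Oz z0.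
- by move=> j tj; apply: Z => z Oz _; have [_ t5 _] := isotropic_frame_tg (iT _ Oz); apply: t5.
- by split; apply: Z => z Oz z0; have [_ [_ []]] := aT _ Oz z0.
Qed.

End FrameChange.

Section Compare.
Variable R : realType.
Local Notation W := 'rV[R]_4.
Variables (M : manifold4 R) (c : set (tensor2 M)) (V : set M) (u : chart R M).
Variables (O : set W) (w : forms R) (s s' : frame_field R).
Hypotheses (hc : conformal_structure22 c) (sV : slice_chart V u).
Hypotheses (rf : reference_frame c u O w).
Hypotheses (so : second_order_frame_field V u O w s).
Hypotheses (so' : second_order_frame_field V u O w s').
Local Notation om := (frame_forms w s).
Local Notation om' := (frame_forms w s').
Local Notation E := (ff_dom s `&` ff_dom s').
Implicit Types (y v : W).

Definition change y : 'M[R]_6 := s' y *m invmx (s y).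

Lemma compare_open : open E.
Proof.
apply: openI; first exact: cf_open (second_order_connection_forms hc sV rf so).
exact: cf_open (second_order_connection_forms hc sV rf so').
Qed.

Lemma field_orthogonal (a : frame_field R) y : second_order_frame_field V u O w a ->
  ff_dom a y -> [/\ isotropic_frame (a y), a y \in unitmx &
    invmx (a y) = gram R *m (a y)^T *m gram R].
Proof.
move=> [[_ _ ia _] _ _ _ _] /ia ay; have [oa _] := ay.
by have [] := orthogonal_inv oa.
Qed.

Lemma change_mul y : E y -> change y *m s y = s' y.
Proof.
by move=> [Dy _]; have [_ us _] := field_orthogonal so Dy; rewrite /change mulmxKV.
Qed.

Lemma smooth_change : smooth_mx E change.
Proof.
have [[_ sm _ _] _ _ _ _] := so; have [[_ sm' _ _] _ _ _ _] := so'.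
have oE := compare_open.
apply: smooth_mxM => //; first by apply: smooth_mx_sub sm' => z [].
apply: smooth_invmx => //; first by apply: smooth_mx_sub sm => z [].
by move=> z [Dz _]; have [] := field_orthogonal so Dz.
Qed.

Lemma isotropic_change y : E y -> isotropic_frame (change y).
Proof.
move=> [Dy Dy']; have [iF _ _] := field_orthogonal so Dy.
have [iF' _ _] := field_orthogonal so' Dy'.
exact: isotropic_mul (isotropic_inv iF) iF'.
Qed.

Lemma change_gauge y v : E y ->
  om' y v *m change y = dmx v change y + change y *m om y v.
Proof.
move=> Ey; have [Dy Dy'] := Ey; have [_ us _] := field_orthogonal so Dy.
have [_ us' _] := field_orthogonal so' Dy'.
have [[_ sm _ _] _ _ _ _] := so; have oE := compare_open.
have smE : smooth_mx E s by apply: smooth_mx_sub sm => z [].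
have uT : change y \in unitmx by rewrite unitmx_mul us' unitmx_inv.
rewrite (frame_forms_eq _ _ oE Ey (fun z Ez => esym (change_mul Ez))).
exact: (frame_forms_comp _ _ oE smE smooth_change).
Qed.

Lemma adapted_change y : E y -> y 0 ord_max = 0 -> adapted (change y).
Proof.
move=> Ey y0; have [Dy Dy'] := Ey.
have iT := isotropic_change Ey; have [oT T0] := iT.
have [n0 _ _] := isotropic_frame_tg iT.
have [iF _ _] := field_orthogonal so Dy.
have Vy := second_order_trace sV rf so Dy y0.
have [[_ _ _ fo] _ _ _ _] := so; have [_ al be] := fo y Dy Vy.
have [[_ _ _ fo'] _ _ _ _] := so'; have [_ al' be'] := fo' y Dy' Vy.
have cf := second_order_connection_forms hc sV rf so.
have [[t1 t2 t3] _] := second_order_tangent_dual hc sV rf so Dy y0.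
rewrite -(change_mul Ey) in al' be'; set T := change y in iT oT T0 n0 al' be' *.
have [D1 D2 D3] := dual_values cf Dy.
(* omega'^4 = 0 reads (dA_0, A'_1) = 0, so that A'_1 is orthogonal to T(V). *)
have ort v : tangentV v ->
    - om y v i0 i1 * T i1 i4 + om y v i0 i2 * T i1 i3 + om y v i0 i3 * T i1 i2 = 0.
  move=> v0; have [[q4 _ _ _ _] _] := second_order_forms hc sV rf so' Dy' y0 v0.
  have [[p4 _ _ _ _] _] := second_order_forms hc sV rf so Dy y0 v0.
  have [uT _] := orthogonal_inv oT.
  have H : om' y v = frame_forms om change y v.
    rewrite -[RHS]/((dmx v change y + change y *m om y v) *m invmx (change y)).
    by rewrite -(change_gauge v Ey) mulmxK.
  move: q4; rewrite H (coframe4_gauge compare_open smooth_change isotropic_change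
    (cf_skew cf v Dy) Ey) p4 -/T => /eqP.
  by rewrite mulf_eq0 (negbTE n0) /= => /eqP h; lra.
apply: (adapted_of_planes iF iT _ al be al' be'); split.
- by have := ort _ t3; have [-> -> ->] := D3; rewrite oppr0 !mul0r mul1r !add0r.
- by have := ort _ t2; have [-> -> ->] := D2; rewrite oppr0 !mul0r mul1r add0r addr0.
- have := ort _ t1; have [-> -> ->] := D1; rewrite !mul0r !addr0 mulN1r.
  by move=> /eqP; rewrite oppr_eq0 => /eqP.
Qed.

End Compare.

Section ThirdOrderChange.
Variable R : realType.
Local Notation W := 'rV[R]_4.
Variables (M : manifold4 R) (c : set (tensor2 M)) (V : set M) (u : chart R M).
Variables (O : set W) (w : forms R) (s s' : frame_field R).
Hypotheses (hc : conformal_structure22 c) (sV : slice_chart V u).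
Hypotheses (rf : reference_frame c u O w).
Hypotheses (so : second_order_frame_field V u O w s).
Hypotheses (so' : second_order_frame_field V u O w s').
Local Notation om := (frame_forms w s).
Local Notation om' := (frame_forms w s').
Local Notation E := (ff_dom s `&` ff_dom s').
Implicit Types (y v : W).

Local Notation change := (change s s').

Lemma compare_forms y v : E y -> y 0 ord_max = 0 -> tangentV v ->
  let T := change y in let dT := dmx v change y in
  let N := om y v in let N' := om' y v in
  [/\ N' i0 i2 * T i2 i2 = T i0 i0 * N i0 i2,
      N' i0 i3 * T i3 i3 = T i0 i0 * N i0 i3,
      N' i0 i1 * T i1 i1 + N' i0 i2 * T i2 i1 + N' i0 i3 * T i3 i1 = T i0 i0 * N i0 i1 &
      N' i0 i0 * T i0 i0 + N' i0 i1 * T i1 i0 + N' i0 i2 * T i2 i0 + N' i0 i3 * T i3 i0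
        = dT i0 i0 + T i0 i0 * N i0 i0] /\
  [/\ N' i1 i2 * T i2 i2 = T i1 i0 * N i0 i2 + T i1 i1 * N i1 i2,
      N' i1 i3 * T i3 i3 = T i1 i0 * N i0 i3 + T i1 i1 * N i1 i3,
      N' i1 i1 * T i1 i1 + N' i1 i2 * T i2 i1 + N' i1 i3 * T i3 i1
        = dT i1 i1 + T i1 i0 * N i0 i1 + T i1 i1 * N i1 i1 &
      N' i2 i2 * T i2 i2 + N' i1 i3 * T i4 i2 + N' i0 i3 * T i5 i2
        = dT i2 i2 + T i2 i0 * N i0 i2 + T i2 i1 * N i1 i2 + T i2 i2 * N i2 i2].
Proof.
move=> Ey y0 v0 T dT N N'; have [Dy Dy'] := Ey.
have [[p4 _ _ _ _] _] := second_order_forms hc sV rf so Dy y0 v0.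
have [[_ H1 H2 H3 H4] H] := change_forms (adapted_change hc sV rf so so' Ey y0) (adapted_pattern (compare_open hc sV rf so so') (isotropic_change so so')
    (adapted_change hc sV rf so so') Ey y0 v0)
  (change_gauge hc sV rf so so' v Ey) (cf_skew (second_order_connection_forms hc sV rf so) v Dy)
  (cf_skew (second_order_connection_forms hc sV rf so') v Dy') p4.
by split.
Qed.

(** The point H = A_1 is the same for all second-order frames: moving A_1 along
    the line A_0 A_1 would add a multiple of omega^3 to omega_1^3. *)
Lemma change_H y : E y -> y 0 ord_max = 0 -> change y i1 i0 = 0.
Proof.
move=> Ey y0; have [Dy Dy'] := Ey.
have [_ _ [_ q2 q3]] := dual_values (second_order_connection_forms hc sV rf so) Dy.
have [[_ _ t3] _] := second_order_tangent_dual hc sV rf so Dy y0.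
have [[_ _ _ _ _] [_ p13 _ _ _]] := second_order_forms hc sV rf so Dy y0 t3.
have [[_ _ _ _ _] [_ p13' _ _ _]] := second_order_forms hc sV rf so' Dy' y0 t3.
have [[_ _ n2 _] _] := adapted_entries (adapted_change hc sV rf so so' Ey y0).
have [[H2 _ _ _] [_ H13 _ _]] := compare_forms Ey y0 t3.
have m2 : om' y (dualv om y j3) i0 i2 = 0 by apply: (mulIf n2); rewrite H2 q2 mulr0 mul0r.
by move: H13; rewrite p13' p13 m2 q2 q3 !mulr0 mul0r mulr1 addr0.
Qed.

(** Obtained from omega_1^3 = h_22 omega^2 and omega_1^2 = h_33 omega^3, written in
    both frames and evaluated on the vectors dual to omega^2 and omega^3. *)
Lemma change_h y : E y -> y 0 ord_max = 0 ->
  let T := change y in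
  ff_h22 s' y * T i0 i0 = T i1 i1 * T i2 i2 * T i2 i2 * ff_h22 s y /\
  ff_h33 s' y * T i0 i0 * T i2 i2 * T i2 i2 = T i1 i1 * ff_h33 s y.
Proof.
move=> Ey y0 T; have [Dy Dy'] := Ey.
have [_ [_ q22 q23] [_ q32 q33]] := dual_values (second_order_connection_forms hc sV rf so) Dy.
have [[_ t2 t3] _] := second_order_tangent_dual hc sV rf so Dy y0.
have [[_ n1 n2 n3] [[_ _ e23] _]] := adapted_entries (adapted_change hc sV rf so so' Ey y0).
rewrite -/T in n1 n2 n3 e23; have T10 := change_H Ey y0; rewrite -/T in T10.
have [_ [_ p13 _ _ _]] := second_order_forms hc sV rf so Dy y0 t2.
have [_ [_ p13' _ _ _]] := second_order_forms hc sV rf so' Dy' y0 t2.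
have [_ [_ _ p12 _ _]] := second_order_forms hc sV rf so Dy y0 t3.
have [_ [_ _ p12' _ _]] := second_order_forms hc sV rf so' Dy' y0 t3.
have [[H2 _ _ _] [_ H13 _ _]] := compare_forms Ey y0 t2.
have [[_ H3 _ _] [H12 _ _ _]] := compare_forms Ey y0 t3.
rewrite -/T in H2 H13 H3 H12.
move: H2 H13 H3 H12; rewrite p13' p13 p12' p12 T10 q22 q33 !(mulr1, mul0r, add0r).
move: (om' y (dualv om y j2) i0 i2) (om' y (dualv om y j3) i0 i3) => a b H2 H13 H3 H12.
split.
  have -> : T i1 i1 * T i2 i2 * T i2 i2 * ff_h22 s y
          = T i1 i1 * ff_h22 s y * (T i2 i2 * T i2 i2) by ring.
  rewrite -H13 -H2.
  have -> : ff_h22 s' y * a * T i3 i3 * (T i2 i2 * T i2 i2)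
          = ff_h22 s' y * (a * T i2 i2) * (T i2 i2 * T i3 i3) by ring.
  by rewrite e23 mulr1.
rewrite -H12 -H3.
have -> : ff_h33 s' y * (b * T i3 i3) * T i2 i2 * T i2 i2
  = ff_h33 s' y * b * T i2 i2 * (T i2 i2 * T i3 i3) by ring.
by rewrite e23 mulr1.
Qed.

(** The third-order quantities change by an affine law.  Its parameters P, Q, A, S
    are the components of the displacements of A_2 and A_3 in the directions of
    A_1 and A_0, normalized by the diagonal entries.  The law follows by
    differentiating [change_h] along the hypersurface and comparing with the
    identities of [third_order_exists] in both frames; the transformation of the
    curvature components a_0 and b_0 is the coefficient of omega^1. *)
Lemma third_order_change y : E y -> y 0 ord_max = 0 ->
  let T := change y in
  let k22 i := theta22 w s y (dualv om y i) in
  let k33 i := theta33 w s y (dualv om y i) in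
  let k22' i := theta22 w s' y (dualv om' y i) in
  let k33' i := theta33 w s' y (dualv om' y i) in
  let h := ff_h22 s y in let k := ff_h33 s y in
  let P := T i2 i1 * T i3 i3 in let Q := T i2 i0 * T i3 i3 in
  let A := T i3 i1 * T i2 i2 in let S := T i3 i0 * T i2 i2 in
  (k22' j2 * (T i0 i0 ^+ 2 * T i3 i3) = T i1 i1 * T i2 i2 ^+ 2 *
     (k22 j2 + - 3 * h * (Q - A * h) - 2 * ca0 s y * P) /\
   k22' j3 * (T i0 i0 ^+ 2 * T i2 i2) = T i1 i1 * T i2 i2 ^+ 2 *
     (k22 j3 + h * (S - P * k) - 2 * ca0 s y * A)) /\
  (k33' j2 * (T i0 i0 ^+ 2 * T i3 i3) = T i1 i1 * T i3 i3 ^+ 2 *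
     (k33 j2 + k * (Q - A * h) - 2 * cb0 s y * P) /\
   k33' j3 * (T i0 i0 ^+ 2 * T i2 i2) = T i1 i1 * T i3 i3 ^+ 2 *
     (k33 j3 + - 3 * k * (S - P * k) - 2 * cb0 s y * A)).
Proof.
move=> Ey y0 T k22 k33 k22' k33' h k P Q A S; have [Dy Dy'] := Ey.
have oE := (compare_open hc sV rf so so').
have [q1 q2 q3] := dual_values (second_order_connection_forms hc sV rf so) Dy.
have [[t1 t2 t3] _] := second_order_tangent_dual hc sV rf so Dy y0.
have T10 := change_H Ey y0.
have [nz [e23 [_ e42 _ e52]]] := adapted_entries (adapted_change hc sV rf so so' Ey y0).
have {}e52 := e52 T10.
have [_ _ tq] := third_order_exists hc sV rf so Dy y0.
have [_ _ tq'] := third_order_exists hc sV rf so' Dy' y0.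
have dsm a b := smooth_differentiable (smooth_change hc sV rf so so' a b) Ey.
have [_ _ s22 s33 _] := so; have [_ _ s22' s33' _] := so'.
have d22 := smooth_differentiable s22 Dy; have d33 := smooth_differentiable s33 Dy.
have d22' := smooth_differentiable s22' Dy'; have d33' := smooth_differentiable s33' Dy'.
have law v : tangentV v ->
  theta22 w s' y v * T i0 i0 = T i1 i1 * T i2 i2 ^+ 2 * (theta22 w s y v +
     (- 3 * h * (Q - A * h) * om y v i0 i2 + h * (S - P * k) * om y v i0 i3)) /\
  theta33 w s' y v * T i0 i0 = T i1 i1 * T i3 i3 ^+ 2 * (theta33 w s y v +
     (k * (Q - A * h) * om y v i0 i2 + - 3 * k * (S - P * k) * om y v i0 i3)).
  move=> v0.
  have [_ [_ p13 p12 _ _]] := second_order_forms hc sV rf so Dy y0 v0.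
  have [[H2 H3 _ H0] [H12 H13 H11 H22]] := compare_forms Ey y0 v0.
  rewrite T10 mulr0 addr0 in H0; rewrite T10 !mul0r !add0r in H12 H13; rewrite T10 mul0r addr0 in H11.
  have [eh ek] := change_h Ey y0.
  have h22E z : E z -> z 0 ord_max = 0 ->
      ff_h22 s' z * change z i0 i0 = change z i1 i1 * change z i2 i2 * change z i2 i2 * ff_h22 s z.
    by move=> Ez z0; have [] := change_h Ez z0.
  have h33E z : E z -> z 0 ord_max = 0 ->
      ff_h33 s' z * change z i0 i0 * change z i2 i2 * change z i2 i2 = change z i1 i1 * ff_h33 s z.
    by move=> Ez z0; have [] := change_h Ez z0.
  have D a b : 'D_v (fun z => change z a b : R^o) y = dmx v change y a b by rewrite mxE.
  have dM f g := @derive_mul R W f g y v.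
  have difM (f g : W -> R^o) : differentiable f y -> differentiable g y ->
     differentiable (fun z => f z * g z : R^o) y by exact: differentiableM.
  have d1 := difM _ _ (dsm i1 i1) (dsm i2 i2).
  have d2 := difM _ _ d1 (dsm i2 i2).
  have c1 := difM _ _ d33' (dsm i0 i0).
  have c2 := difM _ _ c1 (dsm i2 i2).
  have := derive_tangent oE Ey y0 v0 h22E.
  rewrite (dM _ _ d22' (dsm i0 i0)) (dM _ _ d2 d22) (dM _ _ d1 (dsm i2 i2)).
  rewrite (dM _ _ (dsm i1 i1) (dsm i2 i2)) !D => edh.
  have := derive_tangent oE Ey y0 v0 h33E.
  rewrite (dM _ _ c2 (dsm i2 i2)) (dM _ _ c1 (dsm i2 i2)) (dM _ _ d33' (dsm i0 i0)).
  rewrite (dM _ _ (dsm i1 i1) d33) !D => edk.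
  have edh' : 'D_v (ff_h22 s' : W -> R^o) y * T i0 i0 + ff_h22 s' y * dmx v change y i0 i0
    = dmx v change y i1 i1 * T i2 i2 * T i2 i2 * h + T i1 i1 * dmx v change y i2 i2 * T i2 i2 * h
      + T i1 i1 * T i2 i2 * dmx v change y i2 i2 * h + T i1 i1 * T i2 i2 * T i2 i2 * 'D_v (ff_h22 s : W -> R^o) y.
    by rewrite edh !mulrDl.
  have edk' : 'D_v (ff_h33 s' : W -> R^o) y * T i0 i0 * T i2 i2 * T i2 i2
      + ff_h33 s' y * dmx v change y i0 i0 * T i2 i2 * T i2 i2
      + ff_h33 s' y * T i0 i0 * dmx v change y i2 i2 * T i2 i2
      + ff_h33 s' y * T i0 i0 * T i2 i2 * dmx v change y i2 i2
    = dmx v change y i1 i1 * k + T i1 i1 * 'D_v (ff_h33 s : W -> R^o) y.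
    by rewrite -edk !mulrDl.
  have [L1 L2] := theta_change nz e23 e42 e52 p13 p12 H2 H3 H0 H12 H13 H11 H22 eh ek edh' edk'.
  split; [rewrite [LHS]L1 | rewrite [LHS]L2]; congr (_ * (_ + _)); rewrite /h /k /Q /A /S /P; ring.
have [_ _ e22] := e23.
have in_dual v : [\/ v = dualv om y j1, v = dualv om y j2 | v = dualv om y j3] -> tangentV v.
  by case=> ->.
split.
  apply: (@coefficient_change R W (theta22 w s y) (fun v => om y v i0 i1) (fun v => om y v i0 i2)
    (fun v => om y v i0 i3) (fun v => om' y v i0 i1) (fun v => om' y v i0 i2)
    (fun v => om' y v i0 i3) (theta22 w s' y) _ _ _ _ (T i1 i1) _ _ _ _ (ca0 s y) (ca0 s' y) (k22 j2) (k22 j3)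
    _ _ _ _ _ nz e22 q1 q2 q3) => v /in_dual v0.
  have [H1 H2 H3 _] := (compare_forms Ey y0 v0).1.
  have [E1 _ _] := tq v v0; have [E1' _ _] := tq' v v0.
  by have [l _] := law v v0; split.
apply: (@coefficient_change R W (theta33 w s y) (fun v => om y v i0 i1) (fun v => om y v i0 i2)
  (fun v => om y v i0 i3) (fun v => om' y v i0 i1) (fun v => om' y v i0 i2)
  (fun v => om' y v i0 i3) (theta33 w s' y) _ _ _ _ (T i1 i1) _ _ _ _ (cb0 s y) (cb0 s' y) (k33 j2) (k33 j3)
  _ _ _ _ _ nz e22 q1 q2 q3) => v /in_dual v0.
have [H1 H2 H3 _] := (compare_forms Ey y0 v0).1.
have [_ _ E1] := tq v v0; have [_ _ E1'] := tq' v v0.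
by have [_ l] := law v v0; split.
Qed.

End ThirdOrderChange.

(** * Construction of adapted frame fields *)

Section FirstOrder.
Variable R : realType.
Local Notation W := 'rV[R]_4.
Implicit Types (O : set W) (y v t : W) (w : forms R) (G T : W -> 'M[R]_6).

Section Frame.
Variables (M : manifold4 R) (c : set (tensor2 M)) (V : set M) (u : chart R M).
Variables (O : set W) (w : forms R).
Hypotheses (hc : conformal_structure22 c) (hV : lightlike_hypersurface c V).
Hypotheses (sV : slice_chart V u) (rf : reference_frame c u O w).

Lemma first_order_mul O1 G T : first_order_frame_field V u O w O1 G ->
  smooth_mx O1 T -> (forall z, O1 z -> isotropic_frame (T z)) ->
  (forall z, O1 z -> z 0 ord_max = 0 -> adapted (T z)) ->
  first_order_frame_field V u O w O1 (fun z => T z *m G z) /\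
  forall y v, O1 y -> y 0 ord_max = 0 -> tangentV v ->
  let N := frame_forms w G y v in
  let N' := frame_forms w (fun z => T z *m G z) y v in
  [/\ N' i0 i2 * T y i2 i2 = T y i0 i0 * N i0 i2, N' i0 i3 * T y i3 i3 = T y i0 i0 * N i0 i3,
      N' i1 i2 * T y i2 i2 = T y i1 i0 * N i0 i2 + T y i1 i1 * N i1 i2 &
      N' i1 i3 * T y i3 i3 = T y i1 i0 * N i0 i3 + T y i1 i1 * N i1 i3].
Proof.
move=> [[oO sO] sG iG fo] sT iT aT.
have [[_ sI _ _] _ _ _] := rf.
have cw := connection_forms_sub oO sO (reference_connection_forms hc sV.1 rf).
have uF (F : 'M[R]_6) : isotropic_frame F -> F \in unitmx by move=> [/orthogonal_inv[]].
have sTG : smooth_mx O1 (fun z => T z *m G z) by exact: smooth_mxM.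
have iTG z : O1 z -> isotropic_frame (T z *m G z).
  by move=> Oz; apply: isotropic_mul; [exact: iG | exact: iT].
have cG := connection_forms_gauge cw sG iG.
have cTG := connection_forms_gauge cw sTG iTG.
have trace z : O1 z -> V (cinv u z) <-> z 0 ord_max = 0.
  by move=> Oz; apply: (slice_trace sV); apply: sI; exact: sO.
have f4 y v : O1 y -> y 0 ord_max = 0 -> tangentV v -> frame_forms w G y v i0 i4 = 0.
  by move=> Oy y0 v0; have [f4 _ _] := fo _ Oy ((trace _ Oy).2 y0); exact: f4.
have H y v (Oy : O1 y) (y0 : y 0 ord_max = 0) (v0 : tangentV v) :=
  change_forms (aT _ Oy y0) (adapted_pattern oO iT aT Oy y0 v0)
    (frame_forms_comp w v oO sG sT Oy (uF _ (iG _ Oy)) (uF _ (iT _ Oy)))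
    (cf_skew cG v Oy) (cf_skew cTG v Oy) (f4 y v Oy y0 v0).
split; last first.
  by move=> y v Oy y0 v0; have [[_ ? ? _ _] [? ? _ _]] := H y v Oy y0 v0.
split => //.
move=> y Oy Vy; have y0 := (trace _ Oy).1 Vy; have [_ al be] := fo _ Oy Vy.
split.
- by move=> v v0; have [[]] := H y v Oy y0 v0.
- exact: alpha_plane_mul (iG _ Oy) (aT _ Oy y0) al.
- exact: beta_plane_mul (iG _ Oy) (aT _ Oy y0) be.
Qed.

(** X is dual, for the metric, to the differential of the last coordinate, whose
    kernel is tangent to the hypersurface.  Along the hypersurface it is therefore
    proportional to the isotropic vector orthogonal to the tangent space. *)
Lemma isotropic_direction : exists X : W -> 'I_6 -> R,
  [/\ forall i, smooth_on O (X ^~ i),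
      forall z v, O z -> w z v i0 i2 * X z i3 + w z v i0 i3 * X z i2
        - w z v i0 i1 * X z i4 - w z v i0 i4 * X z i1 = v 0 ord_max,
      forall z, O z -> [exists i, tg i && (X z i != 0)] &
      forall z, O z -> z 0 ord_max = 0 -> X z i2 * X z i3 = X z i1 * X z i4].
Proof.
have cw := reference_connection_forms hc sV.1 rf.
have oO := cf_open cw.
pose k z j := invmx (coframe w z) j ord_max.
pose X z (i : 'I_6) : R := if i == i1 then - k z j4 else if i == i2 then k z j3
  else if i == i3 then k z j2 else - k z j1.
have sk j : smooth_on O (k ^~ j).
  have sc : smooth_mx O (coframe w).
    move=> a b; apply: (smooth_eq oO _ (cf_smooth cw (delta_mx 0 a) i0 (tgi b))).
    by move=> z _; rewrite mxE.
  exact: smooth_invmx oO sc (coframe_unit cw) j ord_max.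
have [e1 e2 e3 e4] := tgiE.
have XE z v : O z -> w z v i0 i2 * X z i3 + w z v i0 i3 * X z i2
        - w z v i0 i1 * X z i4 - w z v i0 i4 * X z i1 = v 0 ord_max.
  move=> Oz; have -> : v 0 ord_max = (v *m coframe w z *m invmx (coframe w z)) 0 ord_max.
    by rewrite mulmxK // (coframe_unit cw Oz).
  rewrite (mul_coframe v (cf_linear cw Oz)).
  rewrite mxE sum4 !mxE e1 e2 e3 e4 /X /= -/(k z j1) -/(k z j2) -/(k z j3) -/(k z j4).
  by ring.
exists X; split => //.
- move=> i; rewrite /X; case: (i == i1); first exact: (smoothN oO (sk j4)).
  case: (i == i2); first exact: sk.
  by case: (i == i3); [exact: sk | exact: (smoothN oO (sk j1))].
- move=> z Oz; apply/existsP; apply: contrapT => H.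
  have X0 i : tg i -> X z i = 0.
    by move=> ti; apply/eqP; apply/negPn/negP => Xi; apply: H; exists i; rewrite ti.
  have := XE z (delta_mx 0 ord_max) Oz; rewrite !X0 // !mulr0 !subr0 addr0 mxE !eqxx.
  by move/eqP; rewrite eq_sym oner_eq0.
move=> z Oz z0; have [[_ sI _ _] _ gc _] := rf.
have Vz : V (cinv u z) by apply/(slice_trace sV) => //; exact: sI.
have [x' ux' zx'] := sI z Oz; have [_ _ K _ _] := atlas_chart sV.1.
have [g cg _] := conformal_structure_inhabited hc.
have Vx' : V x' by rewrite -(K x' ux') zx'.
have [xi [xi0 xixi tan]] := hV.2 x' u g Vx' sV ux' cg.
rewrite zx' in xixi tan.
have [s s0 sE] := gc g z cg Oz.
have bl v t (r : R) : bilin (g u z) v (r *: t) = r * bilin (g u z) v t.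
  by rewrite /bilin linearZ /= -scalemxAr mxE.
have bD v t t' : bilin (g u z) v (t + t') = bilin (g u z) v t + bilin (g u z) v t'.
  by rewrite /bilin linearD /= mulmxDr mxE.
set e := delta_mx 0 ord_max : W.
have em : e 0 ord_max = 1 by rewrite mxE !eqxx.
pose kap := s * bilin (g u z) xi e.
have kE v : s * bilin (g u z) xi v = kap * v 0 ord_max.
  have tv : tangentV (v + (- v 0 ord_max) *: e).
    by rewrite /tangentV /= mxE [X in _ + X]mxE em mulr1 subrr.
  have := (tan _).1 tv; rewrite bD bl /kap => h.
  have -> : bilin (g u z) xi v = v 0 ord_max * bilin (g u z) xi e by lra.
  by ring.
have kap0 : kap != 0.
  apply: mulf_neq0; [by rewrite gt_eqF | apply/eqP => be].
  by have := (tan e).2 be; rewrite /tangentV /= em => /eqP; rewrite oner_eq0.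
have dl i j : w z (dualv w z i) i0 (tgi j) = (i == j)%:R by exact: (dualvE cw i j Oz).
have C i := sE xi (dualv w z i); have Xc i := XE z (dualv w z i) Oz.
have [C1 C2] := (C j1, C j2); have [C3 C4] := (C j3, C j4).
have [X1 X2] := (Xc j1, Xc j2); have [X3 X4] := (Xc j3, Xc j4).
rewrite !kE in C1 C2 C3 C4.
rewrite -e1 -e2 -e3 -e4 !dl /= e1 e2 e3 e4 in C1 C2 C3 C4 X1 X2 X3 X4.
have q1 : w z xi i0 i4 = kap * X z i4 by rewrite -X1 in C1; lra.
have q2 : w z xi i0 i3 = kap * X z i3 by rewrite -X2 in C2; lra.
have q3 : w z xi i0 i2 = kap * X z i2 by rewrite -X3 in C3; lra.
have q4 : w z xi i0 i1 = kap * X z i1 by rewrite -X4 in C4; lra.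
have := sE xi xi; rewrite xixi mulr0 q1 q2 q3 q4 => h.
apply: (mulfI kap0); apply: (mulfI kap0); lra.
Qed.

End Frame.
End FirstOrder.

Section ExplicitFrames.
Variable R : realType.
Local Notation W := 'rV[R]_4.
Implicit Types (O : set W) (F : 'M[R]_6).

Lemma smooth_matrix O (f : W -> 'I_6 -> 'I_6 -> R) :
  open O -> (forall i j, smooth_on O (fun z => f z i j)) ->
  smooth_mx O (fun z => \matrix_(i, j) f z i j).
Proof.
by move=> oO sf i j; apply: (smooth_eq oO _ (sf i j)) => z _; rewrite mxE.
Qed.

(** The tangential part of a frame as a pair of bases of the two spaces of
    spinors: a tangent vector is a 2 x 2 matrix, isotropic when it has rank one,
    and A_1, A_2, A_3, A_4 are the products of the vectors of the two bases. *)
Definition tensor_entry (l r : bool -> bool -> R) (i j : 'I_6) : R :=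
  if tg i && tg j then l (2 < i)%N (2 < j)%N * r (~~ odd i) (~~ odd j)
  else (i == j)%:R.

Lemma tensor_frame_isotropic (l r : bool -> bool -> R) :
  l false false * l true true - l false true * l true false = 1 ->
  r false false * r true true - r false true * r true false = 1 ->
  isotropic_frame (\matrix_(i, j) tensor_entry l r i j).
Proof.
move=> el er; split; last first.
  by move=> b b0; rewrite mxE /tensor_entry /= eq_sym (negbTE b0).
have e := congr2 *%R el er; rewrite mulr1 in e; move: e.
apply: (fun H => H) => e; clear el er.
apply/matrixP; elim/ind6; elim/ind6; rewrite gram_form !mxE /tensor_entry /=; lra.
Qed.

(** Moves A_1 along the line A_0 A_1. *)
Definition shift_entry (k : R) (i j : 'I_6) : R :=
  if (i == i1) && (j == i0) then k else if (i == i5) && (j == i4) then - k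
  else (i == j)%:R.

Lemma shift_adapted k : adapted (\matrix_(i, j) shift_entry k i j).
Proof.
split; last by split; split; rewrite mxE.
split; last by move=> b b0; rewrite mxE /shift_entry /= eq_sym (negbTE b0).
by apply/matrixP; elim/ind6; elim/ind6; rewrite gram_form !mxE /shift_entry /=; ring.
Qed.

(** Moves A_2 and A_3 in the planes A_0 A_1 A_2 and A_0 A_1 A_3; the last two
    rows are forced by the scalar products, up to the choice of the
    coefficient of A_0 in A_4. *)
Definition unipotent_entry (p q r t : R) (i j : 'I_6) : R :=
  match nat_of_ord i, nat_of_ord j with
  | 2, 1 => p | 2, 0 => q | 3, 1 => r | 3, 0 => t
  | 4, 1 => r * p | 4, 2 => r | 4, 3 => p
  | 5, 0 => t * q | 5, 1 => r * q + p * t | 5, 2 => t | 5, 3 => q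
  | _, _ => (i == j)%:R
  end.

Lemma unipotent_adapted p q r t : adapted (\matrix_(i, j) unipotent_entry p q r t i j).
Proof.
split; last by split; split; rewrite mxE.
split; last by elim/ind6 => //= _; rewrite mxE.
by apply/matrixP; elim/ind6; elim/ind6; rewrite gram_form !mxE /unipotent_entry /=; ring.
Qed.

End ExplicitFrames.

Section Existence.
Variable R : realType.
Local Notation W := 'rV[R]_4.
Implicit Types (y v t : W).
Variables (M : manifold4 R) (c : set (tensor2 M)) (V : set M) (u : chart R M).
Variables (O : set W) (w : forms R).
Hypotheses (hc : conformal_structure22 c) (hV : lightlike_hypersurface c V).
Hypotheses (sV : slice_chart V u) (rf : reference_frame c u O w).

(** The vertex A_1 must be X, a 2 x 2 matrix of rank one along the hypersurface.
    Its column and row factors are obtained rationally, by contracting X with two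
    fixed vectors [be] and [al]; the other vector of each basis can be constant,
    and the products of the two bases form an isotropic frame even at the points
    where X has rank two. *)
Lemma first_order_exists y0 : O y0 -> exists O1 G,
  O1 y0 /\ first_order_frame_field V u O w O1 G.
Proof.
move=> Oy0; have cw := reference_connection_forms hc sV.1 rf; have oO := cf_open cw.
have [[_ sI _ _] _ _ _] := rf.
have [X [sX XE Xn X0]] := isotropic_direction hc hV sV rf.
pose m al be z : R := al true * (X z i1 * be true + X z i2 * be false)
                     + al false * (X z i3 * be true + X z i4 * be false).
have [al [be m0]] : exists al be, m al be y0 != 0.
  have /existsP[i /andP[ti Xi]] := Xn y0 Oy0.
  exists (fun b => ((i < 3)%N == b)%:R), (fun b => (odd i == b)%:R).
  by move: i ti Xi; elim/ind6 => // _; rewrite /m /= ?(mul0r, mulr0, mul1r, mulr1, add0r, addr0).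
have sm : smooth_on O (m al be).
  by rewrite /m; do ![apply: smoothD | apply: smoothM | exact: smooth_cst | exact: sX].
pose O1 := [set z | O z /\ m al be z != 0].
have oO1 : open O1 by exact: smooth_open_neq0.
have sO1 : O1 `<=` O by move=> z [].
have sm1 : smooth_on O1 (fun z => (m al be z)^-1).
  by apply: smoothV => //; [move=> z [] | exact: smooth_sub sm].
have sX1 i : smooth_on O1 (X ^~ i) by exact: smooth_sub (sX i).
pose l z (p q : bool) : R :=
  if p then (if q then al true else - al false)
  else (if q then X z i3 * be true + X z i4 * be false
             else X z i1 * be true + X z i2 * be false) * (m al be z)^-1.
pose r z (p q : bool) : R :=
  if p then (if q then be true else - be false)
  else (if q then al true * X z i2 + al false * X z i4
             else al true * X z i1 + al false * X z i3) * (m al be z)^-1.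
have sl p q : smooth_on O1 (fun z => l z p q).
  rewrite /l; case: p; first by case: q; exact: smooth_cst.
  by apply: smoothM => //; case: q; do ![apply: smoothD | apply: smoothM | exact: smooth_cst | exact: sX1].
have sr p q : smooth_on O1 (fun z => r z p q).
  rewrite /r; case: p; first by case: q; exact: smooth_cst.
  by apply: smoothM => //; case: q; do ![apply: smoothD | apply: smoothM | exact: smooth_cst | exact: sX1].
pose G z : 'M[R]_6 := \matrix_(i, j) tensor_entry (l z) (r z) i j.
have lE z : O1 z -> l z false false * l z true true - l z false true * l z true false = 1.
  move=> [_ mz]; rewrite /l /=; apply: (mulfI mz); rewrite /m; field; exact: mz.
have rE z : O1 z -> r z false false * r z true true - r z false true * r z true false = 1.
  move=> [_ mz]; rewrite /r /=; apply: (mulfI mz); rewrite /m; field; exact: mz.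
have iG z : O1 z -> isotropic_frame (G z).
  by move=> Oz; apply: tensor_frame_isotropic; [exact: lE | exact: rE].
have sG : smooth_mx O1 G.
  apply: smooth_matrix => // i j; rewrite /tensor_entry.
  by case: (tg i && tg j); [apply: smoothM | exact: smooth_cst].
exists O1, G; split; first by split.
split => // y Oy Vy; have [Oy' my] := Oy.
have y0' : y 0 ord_max = 0 by apply/(slice_trace sV) => //; apply: sI.
have rank1 := X0 y Oy' y0'.
split.
- move=> v v0; rewrite (coframe4_gauge oO1 sG iG (cf_skew cw v Oy') Oy) !mxE /tensor_entry /=.
  have := XE y v Oy'; rewrite v0 => h.
  have E i : tg i -> l y false (2 < i)%N * r y false (~~ odd i) = X y i * (m al be y)^-1.
    have key (a b x : R) : a * b = m al be y * x ->
        a * (m al be y)^-1 * (b * (m al be y)^-1) = x * (m al be y)^-1.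
      by move=> ab; rewrite mulrACA ab; field; exact: my.
    have rk a b := congr1 ( *%R (al a * be b)) rank1.
    have [r1 r2] := (rk true true, rk true false); have [r3 r4] := (rk false true, rk false false).
    by move: i; elim/ind6 => // _; apply: key; rewrite /m; lra.
  have [E1 E2] := (E i1 isT, E i2 isT); have [E3 E4] := (E i3 isT, E i4 isT).
  rewrite /= in E1 E2 E3 E4; rewrite E1 E2 E3 E4.
  transitivity (- (m al be y)^-1 * (w y v i0 i2 * X y i3 + w y v i0 i3 * X y i2
        - w y v i0 i1 * X y i4 - w y v i0 i4 * X y i1)); first by ring.
  by rewrite h mulr0.
- exists (- l y false true, l y false false).
    apply/negP => /eqP h.
    have l1 : l y false true = 0 by case: h => /eqP; rewrite oppr_eq0 => /eqP.
    have l2 : l y false false = 0 by case: h.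
    by have := lE y Oy; rewrite l1 l2 !mul0r subr0 => /eqP; rewrite eq_sym oner_eq0.
  by move=> a; rewrite !inE => /orP[] /eqP ->; rewrite !mxE /tensor_entry /=; split; ring.
- exists (- r y false true, r y false false).
    apply/negP => /eqP h.
    have l1 : r y false true = 0 by case: h => /eqP; rewrite oppr_eq0 => /eqP.
    have l2 : r y false false = 0 by case: h.
    by have := rE y Oy; rewrite l1 l2 !mul0r subr0 => /eqP; rewrite eq_sym oner_eq0.
  by move=> a; rewrite !inE => /orP[] /eqP ->; rewrite !mxE /tensor_entry /=; split; ring.
Qed.

End Existence.

(** Cartan's lemma for the relation that omega^2 /\ omega_1^3 and
    omega^3 /\ omega_1^2 add up to zero, the forms omega^1, omega^2, omega^3
    being coordinates on T with the dual basis f1, f2, f3: its value on each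
    pair of basis vectors is one of the three symmetries. *)
Lemma cartan_symmetric (R : realType) (W : Type) (T : W -> Prop)
    (N : W -> 'M[R]_6) (f1 f2 f3 : W) :
  [/\ T f1, T f2 & T f3] ->
  [/\ N f1 i0 i1 = 1, N f1 i0 i2 = 0 & N f1 i0 i3 = 0] ->
  [/\ N f2 i0 i1 = 0, N f2 i0 i2 = 1 & N f2 i0 i3 = 0] ->
  [/\ N f3 i0 i1 = 0, N f3 i0 i2 = 0 & N f3 i0 i3 = 1] ->
  (forall r s, T r -> T s ->
    N r i0 i2 * N s i1 i3 - N s i0 i2 * N r i1 i3
    + (N r i0 i3 * N s i1 i2 - N s i0 i3 * N r i1 i2) = 0) ->
  (forall v, T v -> forall a b,
    N v a b = N v i0 i1 * N f1 a b + N v i0 i2 * N f2 a b + N v i0 i3 * N f3 a b) ->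
  forall v, T v ->
  N v i1 i3 = N f2 i1 i3 * N v i0 i2 + N f3 i1 i3 * N v i0 i3 /\
  N v i1 i2 = N f3 i1 i3 * N v i0 i2 + N f3 i1 i2 * N v i0 i3.
Proof.
move=> [t1 t2 t3] [d11 d12 d13] [d21 d22 d23] [d31 d32 d33] ext lin v v0.
have E1 := ext _ _ t1 t2; have E2 := ext _ _ t1 t3; have E3 := ext _ _ t2 t3.
rewrite d12 d13 d22 d23 d32 d33 in E1 E2 E3.
have n13 : N f1 i1 i3 = 0 by clear -E1; lra.
have n12 : N f1 i1 i2 = 0 by clear -E2; lra.
have n23 : N f2 i1 i2 = N f3 i1 i3 by clear -E3; lra.
by split; rewrite (lin v v0 i1) ?n13 ?n12 ?n23; ring.
Qed.

Section HigherOrder.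
Variable R : realType.
Local Notation W := 'rV[R]_4.
Implicit Types (y v t : W).
Variables (M : manifold4 R) (c : set (tensor2 M)) (V : set M) (u : chart R M).
Variables (O : set W) (w : forms R).
Hypotheses (hc : conformal_structure22 c) (hV : lightlike_hypersurface c V).
Hypotheses (sV : slice_chart V u) (rf : reference_frame c u O w).

Lemma first_order_connection O1 G : first_order_frame_field V u O w O1 G ->
  [/\ connection_forms O1 w, smooth_mx O1 G, forall z, O1 z -> isotropic_frame (G z) &
      connection_forms O1 (frame_forms w G)].
Proof.
move=> [[oO sO] sG iG _].
have cw := connection_forms_sub oO sO (reference_connection_forms hc sV.1 rf).
by split => //; exact: connection_forms_gauge.
Qed.

Lemma first_order_curvature O1 G : first_order_frame_field V u O w O1 G ->
  exists C, conformal_curvature O1 (frame_forms w G) C.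
Proof.
move=> fo; have [cw sG iG _] := first_order_connection fo.
have [[oO sO] _ _ _] := fo; have [_ _ _ [C [wC [C3 sC se]]]] := rf.
have sC' y i j k : O1 y -> C3 y i k j = - C3 y i j k by move=> Oy; apply: sC; exact: sO.
have C1 : conformal_curvature O1 w C.
  split; first by move=> y /sO; exact: wC.
  by exists C3 => // y v t /sO; exact: se.
exact: (conformal_curvature_gauge oO (cf_smooth cw) (cf_skew cw) sG iG C1).
Qed.

Lemma first_order_trace O1 G z : first_order_frame_field V u O w O1 G -> O1 z ->
  V (cinv u z) <-> z 0 ord_max = 0.
Proof.
move=> [[_ sO] _ _ _] Oz; have [[_ sI _ _] _ _ _] := rf.
by apply: (slice_trace sV); apply: sI; exact: sO.
Qed.

(** Along the hypersurface omega_1^3 and omega_1^2 are combinations of omega^2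
    and omega^3 with a common coefficient lambda_23; this is the exterior
    derivative of omega^4 = 0 and Cartan's lemma. *)
Lemma first_order_lambda O1 G y v : first_order_frame_field V u O w O1 G -> O1 y ->
  y 0 ord_max = 0 -> tangentV v ->
  let N := frame_forms w G y in let f i := dualv (frame_forms w G) y i in
  [/\ N v i0 i4 = 0,
      N v i1 i3 = N (f j2) i1 i3 * N v i0 i2 + N (f j3) i1 i3 * N v i0 i3 &
      N v i1 i2 = N (f j3) i1 i3 * N v i0 i2 + N (f j3) i1 i2 * N v i0 i3].
Proof.
move=> fo Oy y0 v0 N f; have [_ _ _ cf] := first_order_connection fo.
have f4 z s : O1 z -> z 0 ord_max = 0 -> tangentV s -> frame_forms w G z s i0 i4 = 0.
  by move=> Oz z0 s0; have [_ _ _ /(_ z Oz ((first_order_trace fo Oz).2 z0))[h _ _]] := fo; exact: h.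
have t4 s := f4 y s Oy y0.
have tan i : N (f i) i0 i4 = 0 -> tangentV (f i) by exact: (tangent_dualv cf Oy t4).
have [_ _ _ e4] := tgiE.
have d4 i : (i == j4) = false -> N (f i) i0 i4 = 0.
  by move=> i4; rewrite -e4 /N /f (dualvE cf _ _ Oy) i4.
have [t1 t2 t3] := And3 (tan _ (d4 j1 erefl)) (tan _ (d4 j2 erefl)) (tan _ (d4 j3 erefl)).
have [C [_ [C3 _ se]]] := first_order_curvature fo.
have ext r s : tangentV r -> tangentV s ->
    N r i0 i2 * N s i1 i3 - N s i0 i2 * N r i1 i3
    + (N r i0 i3 * N s i1 i2 - N s i0 i3 * N r i1 i2) = 0.
  move=> r0 s0; have [/(_ i4 isT) + _ _ _] := se y r s Oy.
  rewrite sum_tg /dform /wedge.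
  have z0 a b : tangentV a -> tangentV b ->
      'D_a (fun z => frame_forms w G z b i0 i4 : R^o) y = 0.
    move=> a0 b0; rewrite (@derive_tangent _ O1 _ (cst 0) _ _ (cf_open cf) Oy y0 a0).
      exact: derive_cst.
    by move=> z Oz z0; rewrite f4.
  rewrite (z0 r s r0 s0) (z0 s r s0 r0) subrr.
  have [[_ + _ _] _ [_ _ + + _] _ _] := skewE (cf_skew cf r Oy).
  have [[_ + _ _] _ [_ _ + + _] _ _] := skewE (cf_skew cf s Oy).
  move: (t4 r r0) (t4 s s0); rewrite /N.
  move: (frame_forms w G y r) (frame_forms w G y s) => A B p4 q4 q14 q24 q34 p14 p24 p34 h.
  apply: (etrans _ (esym h)); rewrite p4 q4 p14 q14 p24 q24 p34 q34.
  by rewrite !(mulr0, mul0r, oppr0, add0r, addr0).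
have lin r : tangentV r -> forall a b,
    N r a b = N r i0 i1 * N (f j1) a b + N r i0 i2 * N (f j2) a b + N r i0 i3 * N (f j3) a b.
  move=> r0 a b; have h := coframe_expand cf r Oy; rewrite (t4 r r0) scale0r addr0 in h.
  pose L : {linear W -> 'M[R]_6} :=
    HB.pack N (GRing.isLinear.Build _ _ _ _ N (cf_linear cf Oy)).
  have hN : N r = N r i0 i1 *: N (f j1) + N r i0 i2 *: N (f j2) + N r i0 i3 *: N (f j3).
    by rewrite {1}h -[N]/(L : _ -> _) !linearD !linearZ.
  have hE (A1 A2 A3 : 'M[R]_6) (p q k : R) : N r = p *: A1 + q *: A2 + k *: A3 ->
      N r a b = p * A1 a b + q * A2 a b + k * A3 a b by move=> ->; rewrite !mxE.
  exact: hE hN.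
have [D1 D2 D3] := dual_values cf Oy.
have [h13 h12] := cartan_symmetric (And3 t1 t2 t3) D1 D2 D3 ext lin v0.
by split; [exact: t4 | |].
Qed.

(** Moving A_1 by - lambda_23 A_0 makes lambda_23 vanish; the coefficients
    lambda_22 and lambda_33 then become h_22 and h_33. *)
Lemma second_order_exists y0 : O y0 ->
  exists2 s, second_order_frame_field V u O w s & ff_dom s y0.
Proof.
move=> Oy0; have [P1 [G [Oy fo]]] := first_order_exists hc hV sV rf Oy0.
have [_ _ _ cf] := first_order_connection fo; have oO := cf_open cf.
have sf i := smooth_dualv cf i.
have sN i a b := smooth_contract cf (sf i) a b.
pose k z := - frame_forms w G z (dualv (frame_forms w G) z j3) i1 i3.
pose T z : 'M[R]_6 := \matrix_(i, j) shift_entry (k z) i j.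
have sk : smooth_on P1 k by exact: smoothN oO (sN j3 i1 i3).
have sT : smooth_mx P1 T.
  apply: smooth_matrix => // i j; rewrite /shift_entry.
  case: (_ && _); first exact: sk.
  by case: (_ && _); [exact: smoothN | exact: smooth_cst].
have aT z : adapted (T z) by exact: shift_adapted.
have iT z : isotropic_frame (T z) by case: (aT z).
have [foT ch] := first_order_mul hc sV rf fo sT (fun z _ => iT z) (fun z _ _ => aT z).
have [C cC] := first_order_curvature foT.
exists (FrameField P1 (fun z => T z *m G z) C
  (fun z => frame_forms w G z (dualv (frame_forms w G) z j2) i1 i3)
  (fun z => frame_forms w G z (dualv (frame_forms w G) z j3) i1 i2)) => //=.
split=> //=.
move=> y v Dy Vy v0; have yy := (first_order_trace fo Dy).1 Vy.
have [c2 c3 c12 c13] := ch y v Dy yy v0.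
have [_ l13 l12] := first_order_lambda fo Dy yy v0.
have TE i j : T y i j = shift_entry (k y) i j by rewrite mxE.
move: c2 c3 c12 c13; rewrite !TE /shift_entry /= /k.
set N := frame_forms w G y v; set N' := frame_forms w (fun z => T z *m G z) y v.
rewrite -/N in l13 l12; rewrite !(mul1r, mulr1) => -> -> -> ->.
by rewrite l13 l12; split; ring.
Qed.

Lemma second_order_restrict s D' : second_order_frame_field V u O w s ->
  open D' -> D' `<=` ff_dom s ->
  second_order_frame_field V u O w (FrameField D' s (ff_C s) (ff_h22 s) (ff_h33 s)).
Proof.
move=> [[[oD sD] sm iG fo] [wC [C3 sC se]] s22 s33 h] oD' sD'; split => /=.
- split.
  + by split => // z /sD' /sD.
  + by move=> a b; apply: smooth_sub (sm a b).
  + by move=> y /sD'; exact: iG.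
  + by move=> y /sD'; exact: fo.
- split; first by move=> y /sD'; exact: wC.
  by exists C3 => [y i j k /sD'|y v t /sD']; [exact: sC | exact: se].
- exact: smooth_sub s22.
- exact: smooth_sub s33.
- by move=> y v /sD'; exact: h.
Qed.

(** By the transformation law, the vanishing of the third-order quantities of the
    new frame amounts to two linear systems, for (Q - A h_22, P) and for
    (S - P h_33, A); the product of their determinants is - D.  They are solved
    with coefficients depending smoothly on the point. *)
Lemma third_order_frame_exists s y0 : second_order_frame_field V u O w s ->
  ff_dom s y0 -> y0 0 ord_max = 0 -> Dinv s y0 != 0 ->
  exists s', [/\ second_order_frame_field V u O w s', ff_dom s' y0 &
    forall y, ff_dom s' y -> y 0 ord_max = 0 -> third_order_quantities w s' y 0 0 0 0].
Proof.
move=> so Dy0 y00 D0.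
have cf := second_order_connection_forms hc sV rf so; have oD := cf_open cf.
pose th2 i z := theta22 w s z (dualv (frame_forms w s) z i).
pose th3 i z := theta33 w s z (dualv (frame_forms w s) z i).
have st2 i : smooth_on (ff_dom s) (th2 i) by exact: smooth_theta22 hc sV rf so i.
have st3 i : smooth_on (ff_dom s) (th3 i) by exact: smooth_theta33 hc sV rf so i.
have [_ _ s22 s33 _] := so.
(* On the hypersurface th2 j1 = - 2 a_0 and th3 j1 = - 2 b_0, so that
   d1 d2 is a smooth function that restricts to D. *)
pose d1 z := 3 * ff_h22 s z * th3 j1 z + ff_h33 s z * th2 j1 z.
pose d2 z := ff_h22 s z * th3 j1 z + 3 * ff_h33 s z * th2 j1 z.
have sd1 : smooth_on (ff_dom s) d1 := smoothD oD
  (smoothM oD (smoothM oD (smooth_cst _ _) s22) (st3 j1)) (smoothM oD s33 (st2 j1)).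
have sd2 : smooth_on (ff_dom s) d2 := smoothD oD (smoothM oD s22 (st3 j1))
  (smoothM oD (smoothM oD (smooth_cst _ _) s33) (st2 j1)).
have sd := smoothM oD sd1 sd2.
pose D' := [set z | ff_dom s z /\ d1 z * d2 z != 0].
have oD' : open D' by exact: smooth_open_neq0 oD sd.
have sD' : D' `<=` ff_dom s by move=> z [].
have nz z : D' z -> d1 z != 0 /\ d2 z != 0.
  by move=> [_]; rewrite mulf_eq0 negb_or => /andP[].
have [a0E b0E _] := third_order_exists hc sV rf so Dy0 y00.
have Dy0' : D' y0.
  split => //; apply: contraNneq D0 => d12.
  have -> : Dinv s y0 = d1 y0 * d2 y0; last by rewrite d12.
  by rewrite /d1 /d2 /th2 /th3 a0E b0E /Dinv; ring.
have so1 := second_order_restrict so oD' sD'.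
set s1 := FrameField _ _ _ _ _ in so1.
pose h z := ff_h22 s z; pose k z := ff_h33 s z.
pose p z := - (k z * th2 j2 z + 3 * h z * th3 j2 z) * (d1 z)^-1.
pose a z := - (3 * k z * th2 j3 z + h z * th3 j3 z) * (d2 z)^-1.
pose x z := (th3 j1 z * th2 j2 z - th2 j1 z * th3 j2 z) * (d1 z)^-1.
pose e z := (th2 j1 z * th3 j3 z - th3 j1 z * th2 j3 z) * (d2 z)^-1.
pose q z := x z + a z * h z; pose t z := e z + p z * k z.
have r2 i : smooth_on D' (th2 i) := smooth_sub sD' (st2 i).
have r3 i : smooth_on D' (th3 i) := smooth_sub sD' (st3 i).
have rh : smooth_on D' h := smooth_sub sD' s22.
have rk : smooth_on D' k := smooth_sub sD' s33.
have rc (r : R) : smooth_on D' (fun=> r) := smooth_cst D' r.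
have i1' : smooth_on D' (fun z => (d1 z)^-1).
  by apply: smoothV => //; [move=> z /nz[] | exact: smooth_sub sd1].
have i2' : smooth_on D' (fun z => (d2 z)^-1).
  by apply: smoothV => //; [move=> z /nz[] | exact: smooth_sub sd2].
have sp : smooth_on D' p := smoothM oD' (smoothN oD' (smoothD oD' (smoothM oD' rk (r2 j2))
  (smoothM oD' (smoothM oD' (rc 3) rh) (r3 j2)))) i1'.
have sa : smooth_on D' a := smoothM oD' (smoothN oD' (smoothD oD'
  (smoothM oD' (smoothM oD' (rc 3) rk) (r2 j3)) (smoothM oD' rh (r3 j3)))) i2'.
have sx : smooth_on D' x := smoothM oD' (smoothB oD' (smoothM oD' (r3 j1) (r2 j2))
  (smoothM oD' (r2 j1) (r3 j2))) i1'.
have se : smooth_on D' e := smoothM oD' (smoothB oD' (smoothM oD' (r2 j1) (r3 j3))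
  (smoothM oD' (r3 j1) (r2 j3))) i2'.
have sq : smooth_on D' q := smoothD oD' sx (smoothM oD' sa rh).
have st : smooth_on D' t := smoothD oD' se (smoothM oD' sp rk).
pose T z : 'M[R]_6 := \matrix_(i, j) unipotent_entry (p z) (q z) (a z) (t z) i j.
have sT : smooth_mx D' T.
  apply: smooth_matrix => //; elim/ind6; elim/ind6; rewrite /unipotent_entry /=;
    first [exact: rc | exact: sp | exact: sq | exact: sa | exact: st
          | exact: (smoothM oD' sa sp) | exact: (smoothM oD' st sq)
          | exact: (smoothD oD' (smoothM oD' sa sq) (smoothM oD' sp st))].
have aT z : adapted (T z) by exact: unipotent_adapted.
have iT z : isotropic_frame (T z) by case: (aT z).
have [fo1 _ _ _ hs] := so1.
have [foT ch] := first_order_mul hc sV rf fo1 sT (fun z _ => iT z) (fun z _ _ => aT z).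
have [C cC] := first_order_curvature foT.
have TE z i j : T z i j = unipotent_entry (p z) (q z) (a z) (t z) i j by rewrite mxE.
pose s3 := FrameField D' (fun z => T z *m s z) C (ff_h22 s) (ff_h33 s).
have so3 : second_order_frame_field V u O w s3.
  split=> //= y v Dy Vy v0; have yy := (first_order_trace fo1 Dy).1 Vy.
  have [c2 c3 c12 c13] := ch y v Dy yy v0; have [h13 h12] := hs y v Dy Vy v0.
  move: c2 c3 c12 c13; rewrite !TE /unipotent_entry /= !(mul1r, mulr1, mul0r, add0r).
  by move=> -> -> -> ->.
exists s3; split => //= y Dy yy.
have Ey : (ff_dom s1 `&` ff_dom s3) y by [].
have chE : change s1 s3 y = T y.
  have [_ us _] := field_orthogonal so1 Dy.
  by rewrite /change /= mulmxK.
have [[L1 L2] [L3 L4]] := third_order_change hc sV rf so1 so3 Ey yy.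
have [_ _ tq] := third_order_exists hc sV rf so3 (y := y) Dy yy.
have [aE bE _] := third_order_exists hc sV rf so1 (y := y) Dy yy.
rewrite chE !TE /unipotent_entry /= in L1 L2 L3 L4.
have [n1 n2] := nz y Dy.
have A2 : 2 * ca0 s1 y = - th2 j1 y by rewrite [th2 _ _]aE opprK.
have B2 : 2 * cb0 s1 y = - th3 j1 y by rewrite [th3 _ _]bE opprK.
rewrite A2 !(expr1n, mulr1, mul1r) in L1 L2; rewrite B2 !(expr1n, mulr1, mul1r) in L3 L4.
rewrite -[ff_h22 s1 y]/(h y) -[ff_h33 s1 y]/(k y) in L1 L2 L3 L4.
have qx : q y - a y * h y = x y by rewrite /q addrK.
have te : t y - p y * k y = e y by rewrite /t addrK.
rewrite qx in L1 L3; rewrite te in L2 L4.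
rewrite -[theta22 w s1 y _]/(th2 j2 y) in L1; rewrite -[theta22 w s1 y _]/(th2 j3 y) in L2.
rewrite -[theta33 w s1 y _]/(th3 j2 y) in L3; rewrite -[theta33 w s1 y _]/(th3 j3 y) in L4.
have [Z1 Z2] : th2 j2 y + -3 * h y * x y - - th2 j1 y * p y = 0 /\
               th3 j2 y + k y * x y - - th3 j1 y * p y = 0.
  move: n1; rewrite /x /p /d1 -/(h y) -/(k y).
  move: (th2 j1 y) (th2 j2 y) (th3 j1 y) (th3 j2 y) (h y) (k y) => g1 g2 g3 g4 g5 g6 n1.
  by split; field.
have [Z3 Z4] : th2 j3 y + h y * e y - - th2 j1 y * a y = 0 /\
               th3 j3 y + -3 * k y * e y - - th3 j1 y * a y = 0.
  move: n2; rewrite /e /a /d2 -/(h y) -/(k y).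
  move: (th2 j1 y) (th2 j3 y) (th3 j1 y) (th3 j3 y) (h y) (k y) => g1 g2 g3 g4 g5 g6 n2.
  by split; field.
rewrite Z1 in L1; rewrite Z3 in L2; rewrite Z2 in L3; rewrite Z4 in L4.
by rewrite L1 L2 L3 L4 in tq.
Qed.

End HigherOrder.

(** * The vertices A_2 and A_3 *)

Section Vertices.
Variable R : realType.
Implicit Types (T F : 'M[R]_6).

Lemma row_combination T F i : T i i4 = 0 -> T i i5 = 0 -> T i i3 = 0 ->
  row i (T *m F) = T i i0 *: row i0 F + T i i1 *: row i1 F + T i i2 *: row i2 F.
Proof.
move=> e4 e5 e3; rewrite row_mul mulmx_sum_row sum6 !mxE e3 e4 e5.
by rewrite !scale0r !addr0 addrA.
Qed.

(** The vertices of a frame are linearly independent. *)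
Lemma same_point_row T F i : F \in unitmx -> T i i != 0 ->
  same_point (row i F) (row i (T *m F)) <-> forall j, j != i -> T i j = 0.
Proof.
move=> uF Tii; split=> [[k k0 e] j ji|T0].
  have : delta_mx 0 i = k *: row i T :> 'rV[R]_6.
    by apply: (can_inj (mulmxK uF)); rewrite -rowE e row_mul scalemxAl.
  move=> /rowP/(_ j); rewrite !mxE eqxx (negbTE ji) /= => /esym/eqP.
  by rewrite mulf_eq0 (negbTE k0) => /eqP.
exists (T i i)^-1; first by rewrite invr_eq0.
have -> : row i (T *m F) = T i i *: row i F.
  rewrite row_mul mulmx_sum_row (bigD1 i) //= big1 ?addr0 ?mxE // => j ji.
  by rewrite mxE T0 // scale0r.
by rewrite scalerA mulVf // scale1r.
Qed.

(** The two linear systems, in (X, P) and in (Y, A), have nonzero determinants. *)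
Lemma third_order_system (h k a0 b0 k222 k223 k233 k333 P X Y A : R) :
  (3 * h * b0 + k * a0) * (h * b0 + 3 * k * a0) != 0 ->
  k222 + -3 * h * X - 2 * a0 * P = 0 -> k223 + h * Y - 2 * a0 * A = 0 ->
  k233 + k * X - 2 * b0 * P = 0 -> k333 + -3 * k * Y - 2 * b0 * A = 0 ->
  [/\ k222 = 0, k223 = 0, k233 = 0 & k333 = 0] <-> [/\ P = 0, X = 0, Y = 0 & A = 0].
Proof.
rewrite mulf_eq0 negb_or => /andP[n1 n2] e1 e2 e3 e4.
split=> -[z1 z2 z3 z4]; last by rewrite z1 z2 z3 z4 in e1 e2 e3 e4; split; lra.
rewrite z1 in e1; rewrite z2 in e2; rewrite z3 in e3; rewrite z4 in e4.
split.
- apply: (mulfI n1); transitivity (- (k * (0 + -3 * h * X - 2 * a0 * P)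
    + 3 * h * (0 + k * X - 2 * b0 * P)) / 2); first by field.
  by rewrite e1 e3; ring.
- apply: (mulfI n1); transitivity (- (b0 * (0 + -3 * h * X - 2 * a0 * P)
    - a0 * (0 + k * X - 2 * b0 * P))); first by ring.
  by rewrite e1 e3; ring.
- apply: (mulfI n2); transitivity (b0 * (0 + h * Y - 2 * a0 * A)
    - a0 * (0 + -3 * k * Y - 2 * b0 * A)); first by ring.
  by rewrite e2 e4; ring.
- apply: (mulfI n2); transitivity (- (3 * k * (0 + h * Y - 2 * a0 * A)
    + h * (0 + -3 * k * Y - 2 * b0 * A)) / 2); first by field.
  by rewrite e2 e4; ring.
Qed.

End Vertices.

Theorem theorem5 (R : realType) (M : manifold4 R) (c : set (tensor2 M)) (V : set M)
  (hc : conformal_structure22 c)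
  (hV : lightlike_hypersurface c V)
  (hgeo : isotropic_geodesics_prolongable c V)
  (hD : forall (x : M) (u : chart R M) (O : set 'rV[R]_4) (w : forms R)
          (s : frame_field R),
     V x -> slice_chart V u -> cdom u x -> reference_frame c u O w ->
     second_order_frame_field V u O w s -> ff_dom s (cmap u x) ->
     Dinv s (cmap u x) != 0) :
  forall (x : M) (u : chart R M) (O : set 'rV[R]_4) (w : forms R),
  V x -> slice_chart V u -> cdom u x -> reference_frame c u O w -> O (cmap u x) ->
  (exists P2 P3 : 'rV[R]_6,
     (exists s : frame_field R,
        [/\ second_order_frame_field V u O w s, ff_dom s (cmap u x),
            same_point (row i2 (s (cmap u x))) P2 &
            same_point (row i3 (s (cmap u x))) P3]) /\
     (forall s : frame_field R,
        second_order_frame_field V u O w s -> ff_dom s (cmap u x) ->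
        let F := s (cmap u x) in
        [/\ (P2 <= row i0 F + row i1 F + row i2 F)%MS,
            (P3 <= row i0 F + row i1 F + row i3 F)%MS &
            third_order_quantities w s (cmap u x) 0 0 0 0 <->
            same_point (row i2 F) P2 /\ same_point (row i3 F) P3])) /\
  (exists s : frame_field R,
     [/\ second_order_frame_field V u O w s, ff_dom s (cmap u x) &
         forall y, ff_dom s y -> V (cinv u y) ->
           third_order_quantities w s y 0 0 0 0]).
Proof.
move=> x u O w Vx sV cx rf Ox; set y := cmap u x.
have y0 : y 0 ord_max = 0 by exact/(sV.2 x cx).
have [s2 so2 Dy2] := second_order_exists hc hV sV rf Ox.
have [s3 [so3 Dy3 tq3]] := third_order_frame_exists hc sV rf so2 Dy2 y0
  (hD x u O w s2 Vx sV cx rf so2 Dy2).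
split; last first.
  exists s3; split => // z Dz Vz; apply: tq3 => //.
  by have [fo _ _ _ _] := so3; apply/(first_order_trace sV rf fo).
exists (row i2 (s3 y)), (row i3 (s3 y)); split.
  by exists s3; split => //; exists 1; rewrite ?oner_eq0 // scale1r.
move=> s so Dy F; have Ey : (ff_dom s `&` ff_dom s3) y by [].
have aT := adapted_change hc sV rf so so3 Ey y0.
have T10 := change_H hc sV rf so so3 Ey y0.
have TF : change s s3 y *m F = s3 y := change_mul so Ey.
have [[L1 L2] [L3 L4]] := third_order_change hc sV rf so so3 Ey y0.
have D0 := hD x u O w s Vx sV cx rf so Dy; rewrite -/y in D0.
have [_ uF _] := field_orthogonal so Dy; rewrite -/F in uF.
move: aT T10 TF L1 L2 L3 L4; set T := change s s3 y => aT T10 TF L1 L2 L3 L4.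
have [[n0 n1 n2 n3] _] := adapted_entries aT.
have [iT [_ [e23 e24 e32 e34]]] := aT; have [_ t5 _] := isotropic_frame_tg iT.
have [u1 u2 u3 u4] := third_order_unique hc sV rf so3 Dy3 y0 (tq3 y Dy3 y0).
have [_ _ tq] := third_order_exists hc sV rf so Dy y0.
rewrite -u1 mul0r in L1; rewrite -u2 mul0r in L2; rewrite -u3 mul0r in L3; rewrite -u4 mul0r in L4.
have nz2 : T i1 i1 * T i2 i2 ^+ 2 != 0 by rewrite mulf_neq0 // expf_neq0.
have nz3 : T i1 i1 * T i3 i3 ^+ 2 != 0 by rewrite mulf_neq0 // expf_neq0.
have C (a b : R) : a != 0 -> 0 = a * b -> b = 0.
  by move=> a0 /esym/eqP; rewrite mulf_eq0 (negbTE a0) => /eqP.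
have Dn : (3 * ff_h22 s y * cb0 s y + ff_h33 s y * ca0 s y)
        * (ff_h22 s y * cb0 s y + 3 * ff_h33 s y * ca0 s y) != 0.
  by move: D0; rewrite /Dinv -mulrA mulf_eq0 negb_or => /andP[].
have sys := third_order_system Dn (C _ _ nz2 L1) (C _ _ nz2 L2) (C _ _ nz3 L3) (C _ _ nz3 L4).
have P2E := @same_point_row _ T F i2 uF n2; have P3E := @same_point_row _ T F i3 uF n3.
rewrite TF in P2E P3E.
split.
- rewrite -TF row_combination ?(t5 i2) //.
  by rewrite !addmx_sub_adds // scalemx_sub.
- rewrite -TF row_mul mulmx_sum_row sum6 ![row i3 T _ _]mxE e32 e34 (t5 i3) // !scale0r !addr0 add0r addrA.
  by rewrite !addmx_sub_adds // scalemx_sub.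
- split=> [tq0|[/P2E r2 /P3E r3]].
    have [v1 v2 v3 v4] := third_order_unique hc sV rf so Dy y0 tq0.
    have [P0 X0 Y0 A0] := sys.1 (And4 (esym v1) (esym v2) (esym v3) (esym v4)).
    rewrite A0 mul0r subr0 in X0; rewrite P0 mul0r subr0 in Y0.
    have cancel (a b : R) : b != 0 -> a * b = 0 -> a = 0.
      by move=> b0 /eqP; rewrite mulf_eq0 (negbTE b0) orbF => /eqP.
    have [p0 q0] := (cancel _ _ n3 P0, cancel _ _ n3 X0).
    have [a0 s0] := (cancel _ _ n2 A0, cancel _ _ n2 Y0).
    split; [apply/P2E | apply/P3E]; by elim/ind6 => // _; apply: t5.
  have h0 := (r2 i1 isT, r2 i0 isT, r3 i1 isT, r3 i0 isT).
  have [|z1 z2 z3 z4] := sys.2; first by rewrite !h0; split; rewrite !mul0r ?subr0.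
  by move: tq; rewrite z1 z2 z3 z4.
Qed.
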